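(* Let $\beta>0$, $\lambda\in\mathbb R$ and define $A^{RS}(\beta,\lambda)=\inf_{\bar q\in\mathcal D_{\beta,\lambda}}\tilde A(\beta,\lambda,\bar q)$. Then $$A^{RS}(\beta,\lambda)=\begin{cases}-\frac12\log(1-\lambda), & \lambda<1,\ \beta\le1-\lambda,\\[2pt] -\frac12\log\beta+\frac{\beta\bar q^*}{2}+\frac{\beta^2(\bar q^* )^2}{4}, & \beta>1-\lambda,\end{cases}\qquad \bar q^*=\frac{\beta-(1-\lambda)}{\beta^2},$$ the infimum being attained at $\bar q=0$ in the first case and at $\bar q=\bar q^*$ in the second, and for every $N\ge1$ $$A_N(\beta,\lambda)\le A^{RS}(\beta,\lambda).$$
   Context: For $N\ge 1$, $\beta>0$, $\lambda\in\mathbb{R}$, let $J=(J_{ij})_{i,j=1}^N$ be $N^2$ i.i.d. standard Gaussian $\mathcal N(0,1)$ random variables (one for each ordered pair $(i,j)$, diagonal pairs included). $\mathbb E_z$ denotes integration with respect to the standard Gaussian measure $(2\pi)^{-N/2}e^{-\|z\|^2/2}dz$ on $\mathbb R^N$, and $\mathbb E$ denotes expectation with respect to the disorder. The (zero-field) partition function is $$Z_N(\beta,\lambda;J)=\mathbb E_z\exp\Big(\frac{\beta}{\sqrt{2N}}\sum_{i,j=1}^N J_{ij}z_iz_j-\frac{\beta^2}{4N}\Big(\sum_{i=1}^N z_i^2\Big)^2+\frac{\lambda}{2}\sum_{i=1}^N z_i^2\Big),$$ and $A_N(\beta,\lambda)=\frac1N\mathbb E\log Z_N(\beta,\lambda;J)$.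 Further, $\mathcal D_{\beta,\lambda}=\{\bar q\ge0:\ 1-\lambda+\beta^2\bar q>0\}$, $\sigma=(1-\lambda+\beta^2\bar q)^{-1/2}$, and $\tilde A(\beta,\lambda,\bar q)=\log\sigma+\frac12\beta^2\bar q\sigma^2+\frac{\beta^2}{4}\bar q^2$. *)

(* Defs.v *)
From Stdlib Require Import Reals Lra ClassicalEpsilon.
Open Scope R_scope.

Fixpoint sumR (n : nat) (f : nat -> R) : R :=
  match n with
  | O => 0
  | S m => sumR m f + f m
  end.

(* Proper Riemann integral of f on [a,b] (value is irrelevant of the
   integrability proof; arbitrary when f is not Riemann integrable). *)
Definition RInt (f : R -> R) (a b : R) : R :=
  epsilon (inhabits 0)
    (fun l => exists pr : Riemann_integrable f a b, RiemannInt pr = l).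

Definition is_ImpInt (f : R -> R) (l : R) : Prop :=
  forall eps, 0 < eps -> exists M, forall a b, a <= - M -> M <= b ->
    Rabs (RInt f a b - l) < eps.

Definition ImpInt (f : R -> R) : R := epsilon (inhabits 0) (is_ImpInt f).

Definition upd (v : nat -> R) (k : nat) (x : R) : nat -> R :=
  fun i => if Nat.eq_dec i k then x else v i.

(* Iterated integral over R^n (coordinates 0..n-1) of f : (nat -> R) -> R;
   coordinates >= n are fixed to 0. *)
Fixpoint IntN (n : nat) (f : (nat -> R) -> R) : R :=
  match n with
  | O => f (fun _ => 0)
  | S m => ImpInt (fun x => IntN m (fun v => f (upd v m x)))
  end.

Definition gdens (n : nat) (z : nat -> R) : R :=
  / (sqrt (2 * PI)) ^ n * exp (- sumR n (fun i => z i ^ 2) / 2).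

Definition Egauss (n : nat) (F : (nat -> R) -> R) : R :=
  IntN n (fun z => gdens n z * F z).

(* Disorder J = (J_ij)_{i,j<N} is encoded as a vector of length N*N,
   J_ij = J (i*N + j). *)
Definition Jentry (N : nat) (J : nat -> R) (i j : nat) : R := J (i * N + j)%nat.

Definition Hamil (N : nat) (beta lambda : R) (J z : nat -> R) : R :=
  beta / sqrt (2 * INR N) *
    sumR N (fun i => sumR N (fun j => Jentry N J i j * z i * z j))
  - beta ^ 2 / (4 * INR N) * (sumR N (fun i => z i ^ 2)) ^ 2
  + lambda / 2 * sumR N (fun i => z i ^ 2).

Definition Z_N (N : nat) (beta lambda : R) (J : nat -> R) : R :=
  Egauss N (fun z => exp (Hamil N beta lambda J z)).

Definition A_N (N : nat) (beta lambda : R) : R :=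
  / INR N * Egauss (N * N) (fun J => ln (Z_N N beta lambda J)).

Definition D_set (beta lambda qbar : R) : Prop :=
  0 <= qbar /\ 1 - lambda + beta ^ 2 * qbar > 0.

Definition sigma (beta lambda qbar : R) : R :=
  / sqrt (1 - lambda + beta ^ 2 * qbar).

Definition Atilde (beta lambda qbar : R) : R :=
  ln (sigma beta lambda qbar)
  + 1 / 2 * beta ^ 2 * qbar * (sigma beta lambda qbar) ^ 2
  + beta ^ 2 / 4 * qbar ^ 2.

Definition qstar (beta lambda : R) : R := (beta - (1 - lambda)) / beta ^ 2.

Definition is_inf (E : R -> Prop) (m : R) : Prop :=
  (forall x, E x -> m <= x) /\
  (forall m', (forall x, E x -> m' <= x) -> m' <= m).

(* Main.v *)
From Stdlib Require Import Reals Lra Lia Psatz FunctionalExtensionality ClassicalEpsilon.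
From Coquelicot Require Import Coquelicot.
Require Import Defs.
Open Scope R_scope.

(** Rescaling z -> s z turns (beta, lambda) into (beta s^2, 1 - s^2 (1 - lambda)) at the cost of the
    factor s^N, so one may assume lambda = beta^2 q with q >= 0 (that is, sigma = 1); the choice s = sigma
    at the minimiser of Atilde gives the theorem.  In this case Guerra's interpolation
    sin(t) * (quadratic field) + cos(t) * (linear field of variance lambda) has, by Gaussian integration
    by parts, a derivative equal to sin t cos t times the mean of
    lambda |<z>|^2 - beta^2/(2N) |<z z^T>|^2 <= N lambda^2 / (2 beta^2).
    The interpolation is carried out with the z-integral replaced by a finite sum, which makes every
    derivative elementary; a Lipschitz partition of unity on a large box compares this sum with the
    integral, multiplicatively, up to errors of controlled growth in the disorder.
    All integrands are kept in a class of locally Lipschitz functions with exponential weights. *)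

(** * Improper Riemann integrals and the Gaussian integral *)

(** The counterterm [beta^2/(4N) |z|^4] is exactly half the variance of the quadratic field, and
    [lambda/2 |z|^2] is half the variance of the linear field. Hence the diagonal terms cancel in
    the derivative, only squares of Gibbs means survive, and maximising [lambda x - beta^2 x^2/(2N)]
    over [x = |<z>|^2] gives the constant; no concentration of overlaps is needed. The linear model
    is explicit: its log-partition function is [lambda |g|^2/2], of mean [lambda/2] per site, and
    [lambda/2 + lambda^2/(4 beta^2)] is [Atilde] at [sigma = 1]. The analytic obstacle is that the
    partition function can grow like the exponential of a quadratic in [J], too fast for exponential
    weights. Its logarithm is therefore estimated directly through Gibbs means, and only finite sums
    are differentiated. Sine and cosine, unlike the usual square roots, are Lipschitz up to both
    endpoints, so time can be treated as one more coordinate. The mesh is refined at fixed box size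
    before the box grows, because the mesh error depends on the box. *)

Ltac toR := match goal with |- ?a = ?b => change (@eq R a b) end.

Notation RI := Coquelicot.RInt.RInt.

(** The value picked by [epsilon] comes from some integrability proof, and [RInt_Reals] identifies
    the integral of any such proof with the Coquelicot one. *)
Lemma RInt_of_is_RInt (f : R -> R) (a b l : R) : is_RInt f a b l -> Defs.RInt f a b = l.
Proof.
  intros H. unfold Defs.RInt.
  assert (E : exists l, exists pr : Riemann_integrable f a b, RiemannInt pr = l).
  { assert (pr := ex_RInt_Reals_0 f a b (ex_intro _ l H)).
    exists (RiemannInt pr), pr. reflexivity. }
  destruct (epsilon_spec (inhabits 0) _ E) as [pr Hpr].
  rewrite <- Hpr, <- RInt_Reals. now apply is_RInt_unique.
Qed.

Lemma RInt_of_ex_RInt (f : R -> R) (a b : R) : ex_RInt f a b -> Defs.RInt f a b = RI f a b.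
Proof. intros H. apply RInt_of_is_RInt. now apply (RInt_correct (V := R_CompleteNormedModule)). Qed.

Lemma is_ImpInt_unique f l1 l2 : is_ImpInt f l1 -> is_ImpInt f l2 -> l1 = l2.
Proof.
  intros H1 H2. apply cond_eq. intros eps He.
  destruct (H1 (eps/2)) as [M1 K1]; [lra|]. destruct (H2 (eps/2)) as [M2 K2]; [lra|].
  set (M := Rmax M1 M2).
  assert (M1 <= M) by apply Rmax_l. assert (M2 <= M) by apply Rmax_r.
  specialize (K1 (-M) M ltac:(lra) ltac:(lra)). specialize (K2 (-M) M ltac:(lra) ltac:(lra)).
  apply Rabs_def2 in K1. apply Rabs_def2 in K2. apply Rabs_def1; lra.
Qed.

Lemma ImpInt_eq f l : is_ImpInt f l -> ImpInt f = l.
Proof.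
  intros H. apply (is_ImpInt_unique f); auto. unfold ImpInt.
  apply epsilon_spec. now exists l.
Qed.

Lemma ex_RInt_of_cont (f : R -> R) a b : (forall x, continuous f x) -> ex_RInt f a b.
Proof. intros H. apply (ex_RInt_continuous (V := R_CompleteNormedModule)). intros; apply H. Qed.

Lemma is_ImpInt_linear f g a b l m :
  (forall x, continuous f x) -> (forall x, continuous g x) ->
  is_ImpInt f l -> is_ImpInt g m -> is_ImpInt (fun x => a * f x + b * g x) (a * l + b * m).
Proof.
  intros cf cg Hf Hg eps He.
  set (K := Rabs a + Rabs b + 1).
  assert (HK : 0 < K) by (unfold K; pose proof (Rabs_pos a); pose proof (Rabs_pos b); lra).
  assert (He' : 0 < eps / K) by (now apply Rdiv_lt_0_compat).
  destruct (Hf _ He') as [M1 K1]. destruct (Hg _ He') as [M2 K2].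
  exists (Rmax M1 M2). intros x y Hx Hy.
  pose proof (Rmax_l M1 M2). pose proof (Rmax_r M1 M2).
  specialize (K1 x y ltac:(lra) ltac:(lra)). specialize (K2 x y ltac:(lra) ltac:(lra)).
  rewrite (RInt_of_ex_RInt f) in K1 by now apply ex_RInt_of_cont.
  rewrite (RInt_of_ex_RInt g) in K2 by now apply ex_RInt_of_cont.
  rewrite (RInt_of_is_RInt _ x y (a * RI f x y + b * RI g x y)).
  2:{ apply (is_RInt_plus (V := R_NormedModule)); apply (is_RInt_scal (V := R_NormedModule));
      apply (RInt_correct (V := R_CompleteNormedModule)); now apply ex_RInt_of_cont. }
  replace (a * RI f x y + b * RI g x y - (a * l + b * m))
    with (a * (RI f x y - l) + b * (RI g x y - m)) by ring.
  eapply Rle_lt_trans; [apply Rabs_triang|]. rewrite !Rabs_mult.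
  assert (Rabs a * Rabs (RI f x y - l) <= Rabs a * (eps / K))
    by (apply Rmult_le_compat_l; [apply Rabs_pos | lra]).
  assert (Rabs b * Rabs (RI g x y - m) <= Rabs b * (eps / K))
    by (apply Rmult_le_compat_l; [apply Rabs_pos | lra]).
  assert (E : (Rabs a + Rabs b + 1) * (eps / K) = eps) by (fold K; field; lra).
  lra.
Qed.

Lemma is_ImpInt_le f g l m :
  (forall x, continuous f x) -> (forall x, continuous g x) ->
  (forall x, f x <= g x) -> is_ImpInt f l -> is_ImpInt g m -> l <= m.
Proof.
  intros cf cg Hle Hf Hg. apply Rnot_lt_le. intros Hlt.
  destruct (Hf ((l-m)/2)) as [M1 K1]; [lra|]. destruct (Hg ((l-m)/2)) as [M2 K2]; [lra|].
  set (M := Rmax (Rmax M1 M2) 0).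
  assert (Rmax M1 M2 <= M) by apply Rmax_l. assert (0 <= M) by apply Rmax_r.
  pose proof (Rmax_l M1 M2). pose proof (Rmax_r M1 M2).
  specialize (K1 (-M) M ltac:(lra) ltac:(lra)). specialize (K2 (-M) M ltac:(lra) ltac:(lra)).
  rewrite (RInt_of_ex_RInt f) in K1 by now apply ex_RInt_of_cont.
  rewrite (RInt_of_ex_RInt g) in K2 by now apply ex_RInt_of_cont.
  assert (RI f (-M) M <= RI g (-M) M).
  { apply RInt_le; [lra|now apply ex_RInt_of_cont|now apply ex_RInt_of_cont|auto]. }
  apply Rabs_def2 in K1. apply Rabs_def2 in K2. lra.
Qed.

(** The envelope [C / (1 + x^2)] has the bounded primitive [C * atan], so functions below it have
    explicit tails; all Gaussian integrands of the proof fit under it. *)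
Lemma RInt_bound_atan (f : R -> R) C a b :
  (forall x, continuous f x) -> (forall x, Rabs (f x) <= C / (1 + x^2)) ->
  a <= b -> Rabs (RI f a b) <= C * (atan b - atan a).
Proof.
  intros cf Hf Hab.
  assert (HI : is_RInt (fun x => C / (1 + x^2)) a b (C * (atan b - atan a))).
  { replace (C * (atan b - atan a)) with (minus (C * atan b) (C * atan a))
      by (unfold minus, plus, opp; simpl; ring).
    apply (is_RInt_derive (V := R_CompleteNormedModule) (fun x => C * atan x)).
    - intros x _. auto_derive; [easy|]. field. nra.
    - intros x _. apply (ex_derive_continuous (V := R_NormedModule)). auto_derive. nra. }
  refine (norm_RInt_le (V := R_NormedModule) f (fun x => C / (1+x^2)) a b _ _ Hab (fun x _ => Hf x) _ HI).
  apply (RInt_correct (V := R_CompleteNormedModule)). now apply ex_RInt_of_cont.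
Qed.

Lemma atan_tail eps : 0 < eps -> exists M, 0 <= M /\ forall x y, M <= x -> M <= y ->
  Rabs (atan x - atan y) < eps.
Proof.
  intros He. pose proof PI_RGT_0.
  (* Capping at [PI/2] keeps [PI/2 - e/2] in the range where [tan] is positive and inverted by
     [atan]. *)
  set (e := Rmin eps (PI/2)).
  assert (0 < e) by (unfold e; apply Rmin_case; lra).
  assert (e <= eps) by apply Rmin_l. assert (e <= PI/2) by apply Rmin_r.
  exists (tan (PI/2 - e/2)).
  assert (Hm : forall x, tan (PI/2 - e/2) <= x -> PI/2 - e/2 <= atan x < PI/2).
  { intros x Hx. split; [|apply atan_bound].
    destruct Hx as [Hx|Hx].
    - apply atan_increasing in Hx. rewrite atan_tan in Hx; lra.
    - subst x. rewrite atan_tan; lra. }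
  split.
  - apply Rlt_le. apply tan_gt_0; lra.
  - intros x y Hx Hy. apply Hm in Hx. apply Hm in Hy. apply Rabs_def1; lra.
Qed.

Lemma RI_tail f C :
  (forall x, continuous f x) -> (forall x, Rabs (f x) <= C / (1 + x^2)) ->
  forall eps, 0 < eps -> exists M, 0 <= M /\ forall a b a' b', a <= -M -> a' <= -M -> M <= b -> M <= b' ->
    Rabs (RI f a b - RI f a' b') < eps.
Proof.
  intros cf Hf eps He.
  assert (HC : 0 <= C).
  { specialize (Hf 0). pose proof (Rabs_pos (f 0)). replace (1 + 0^2) with 1 in Hf by ring. lra. }
  assert (He' : 0 < eps / (2 * (C + 1))) by (apply Rdiv_lt_0_compat; lra).
  destruct (atan_tail _ He') as [M [HM K]].
  exists M; split; auto. intros a b a' b' Ha Ha' Hb Hb'.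
  assert (Hd : forall x y, Rabs (RI f x y) <= C * Rabs (atan y - atan x)).
  { assert (Hd0 : forall x y, x <= y -> Rabs (RI f x y) <= C * Rabs (atan y - atan x)).
    { intros x y Hxy. eapply Rle_trans; [apply RInt_bound_atan with (C:=C); auto|].
      apply Rmult_le_compat_l; [auto|apply Rle_abs]. }
    intros x y. destruct (Rle_dec x y) as [Hxy|Hxy]; [now apply Hd0|].
    rewrite <- (opp_RInt_swap (V := R_CompleteNormedModule)) by now apply ex_RInt_of_cont.
    unfold opp; simpl. rewrite Rabs_Ropp, Rabs_minus_sym. apply Hd0; lra. }
  assert (E : RI f a b - RI f a' b' = RI f a a' + RI f b' b).
  { rewrite <- (RInt_Chasles (V := R_CompleteNormedModule) f a a' b) by now apply ex_RInt_of_cont.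
    rewrite <- (RInt_Chasles (V := R_CompleteNormedModule) f a' b' b) by now apply ex_RInt_of_cont.
    unfold plus; simpl. ring. }
  rewrite E.
  eapply Rle_lt_trans; [apply Rabs_triang|].
  assert (H1 : Rabs (atan a' - atan a) < eps / (2 * (C + 1))).
  { specialize (K (-a) (-a') ltac:(lra) ltac:(lra)). rewrite !atan_opp in K.
    replace (atan a' - atan a) with (- atan a - - atan a') by ring. exact K. }
  assert (H2 := K b b' Hb Hb').
  assert (Hq : (2 * (C+1)) * (eps / (2 * (C + 1))) = eps) by (field; lra).
  pose proof (Hd a a'). pose proof (Hd b' b).
  assert (C * Rabs (atan a' - atan a) <= C * (eps / (2 * (C + 1)))) by (apply Rmult_le_compat_l; lra).
  assert (C * Rabs (atan b - atan b') <= C * (eps / (2 * (C + 1)))) by (apply Rmult_le_compat_l; lra).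
  lra.
Qed.

Lemma is_ImpInt_ex f C :
  (forall x, continuous f x) -> (forall x, Rabs (f x) <= C / (1 + x^2)) ->
  exists l, is_ImpInt f l.
Proof.
  intros cf Hf.
  set (u := (fun n => RI f (- INR n) (INR n)) : nat -> R).
  assert (Hc : Cauchy_crit u).
  { intros eps He. destruct (RI_tail f C cf Hf eps He) as [M [HM K]].
    destruct (INR_unbounded M) as [n0 Hn0]. exists n0. intros n m Hn Hm.
    apply le_INR in Hn. apply le_INR in Hm.
    unfold Rdist, u. apply K; lra. }
  destruct (Rcomplete.R_complete u Hc) as [l Hl]. exists l.
  intros eps He.
  destruct (RI_tail f C cf Hf (eps/2)) as [M [HM K]]; [lra|].
  exists M. intros a b Ha Hb. rewrite RInt_of_ex_RInt by now apply ex_RInt_of_cont.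
  destruct (Hl (eps/2)) as [n0 Hn]; [lra|].
  destruct (INR_unbounded M) as [n1 Hn1].
  set (n := (n0 + n1)%nat).
  specialize (Hn n ltac:(unfold n; lia)). unfold Rdist, u in Hn.
  assert (M <= INR n) by (unfold n; rewrite plus_INR; pose proof (pos_INR n0); lra).
  specialize (K a b (- INR n) (INR n) Ha ltac:(lra) Hb ltac:(lra)).
  replace (RI f a b - l) with ((RI f a b - RI f (- INR n) (INR n)) + (RI f (- INR n) (INR n) - l)) by ring.
  eapply Rle_lt_trans; [apply Rabs_triang|]. lra.
Qed.

(** Decay of the primitive kills both boundary terms; Gaussian integration by parts rests on
    this. *)
Lemma is_ImpInt_derive f df :
  (forall x, is_derive f x (df x)) -> (forall x, continuous df x) ->
  (exists C, forall x, Rabs (f x) <= C / (1 + x^2)) -> is_ImpInt df 0.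
Proof.
  intros Hd Hc [C HC] eps He.
  assert (HC0 : 0 <= C).
  { specialize (HC 0). pose proof (Rabs_pos (f 0)). replace (1 + 0^2) with 1 in HC by ring. lra. }
  (* This threshold is at least 1, so [x^2] exceeds it as soon as [Rabs x] does, and then
     [C / (1 + x^2)] is below [eps / 2]. *)
  exists (2 * C / eps + 1). intros a b Ha Hb.
  rewrite (RInt_of_is_RInt _ a b (f b - f a)).
  2:{ apply (is_RInt_derive (V := R_CompleteNormedModule)); auto. }
  assert (Hq : 0 <= 2 * C / eps) by (apply Rdiv_le_0_compat; lra).
  assert (Hs : forall x, 2*C/eps + 1 <= Rabs x -> Rabs (f x) < eps / 2).
  { intros x Hx. eapply Rle_lt_trans; [apply HC|].
    apply Rlt_div_l; [nra|].
    assert (2*C/eps + 1 <= x^2).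
    { rewrite <- (pow2_abs x). nra. }
    assert (eps / 2 * (1 + (2*C/eps+1)) <= eps/2 * (1 + x^2)) by (apply Rmult_le_compat_l; lra).
    replace (eps / 2 * (1 + (2*C/eps+1))) with (C + eps) in H0 by (field; lra). lra. }
  pose proof (Hs a ltac:(rewrite Rabs_left1; lra)). pose proof (Hs b ltac:(rewrite Rabs_right; lra)).
  rewrite Rminus_0_r. unfold Rminus. eapply Rle_lt_trans; [apply Rabs_triang|]. rewrite Rabs_Ropp. lra.
Qed.

Lemma is_ImpInt_comp_lin f l u v : 0 < u ->
  (forall x, continuous f x) -> is_ImpInt f l -> is_ImpInt (fun x => f (u * x + v)) (l / u).
Proof.
  intros Hu cf Hf eps He.
  destruct (Hf (eps * u)) as [M K]; [nra|].
  exists ((Rabs M + Rabs v) / u). intros a b Ha Hb.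
  assert (H1 : u * a + v <= - M).
  { assert (u * a <= - (Rabs M + Rabs v)).
    { replace (-(Rabs M + Rabs v)) with (u * (- ((Rabs M + Rabs v) / u))) by (field; lra).
      apply Rmult_le_compat_l; lra. }
    pose proof (Rle_abs M). pose proof (Rle_abs v). lra. }
  assert (H2 : M <= u * b + v).
  { assert ((Rabs M + Rabs v) <= u * b).
    { replace ((Rabs M + Rabs v)) with (u * (((Rabs M + Rabs v) / u))) by (field; lra).
      apply Rmult_le_compat_l; lra. }
    pose proof (Rle_abs M). pose proof (Rle_abs (-v)) as Hv. rewrite Rabs_Ropp in Hv. lra. }
  specialize (K _ _ H1 H2).
  rewrite RInt_of_ex_RInt in K by now apply ex_RInt_of_cont.
  set (I := RI f (u * a + v) (u * b + v)) in *.
  rewrite (RInt_of_is_RInt _ a b (/ u * I)).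
  - replace (/ u * I - l / u) with ((I - l) / u) by (field; lra).
    unfold Rdiv. rewrite Rabs_mult, (Rabs_right (/ u)).
    + apply Rlt_div_l; [lra|]. exact K.
    + apply Rle_ge, Rlt_le, Rinv_0_lt_compat, Hu.
  - apply is_RInt_ext with (fun x => / u * (u * f (u * x + v))).
    { intros x _. change (/ u * (u * f (u * x + v)) = f (u * x + v)). field; lra. }
    apply (is_RInt_scal (V := R_NormedModule)).
    apply (is_RInt_comp_lin (V := R_NormedModule) f u v a b).
    apply (RInt_correct (V := R_CompleteNormedModule)). now apply ex_RInt_of_cont.
Qed.

Section GaussianIntegral.

Let g (x : R) := exp (- x^2 / 2).
(** A one-variable substitute for polar coordinates: the integral of [h t] over [0,1] varies in [t]
    oppositely to the square of the half Gaussian integral. *)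
Let h (t u : R) := 2 * exp (- t^2 * (1 + u^2) / 2) / (1 + u^2).
Let dh (t u : R) := - 2 * t * exp (- t^2 * (1 + u^2) / 2).

Lemma g_cont x : continuous g x.
Proof. apply (ex_derive_continuous (V := R_NormedModule)). unfold g. auto_derive. easy. Qed.

Lemma h_derive (t u : R) : is_derive (fun t => h t u) t (dh t u).
Proof.
  unfold h, dh. auto_derive; [nra|].
  replace (- (t * (t * 1)) * (1 + u * (u * 1)) * / 2) with (- t ^ 2 * (1 + u ^ 2) / 2) by (simpl; field).
  field. nra.
Qed.

(** The left side is constant in [t]: substituting [x = t u] turns the integral of [dh t] into
    [- 2 * g t * RI g 0 t], which cancels the derivative of the square. At [t = 0] only [2 * atan 1]
    remains. *)
Lemma half_gauss_identity t : (RI g 0 t)^2 + RI (h t) 0 1 = PI / 2.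
Proof.
  assert (cg : forall a b, ex_RInt g a b) by (intros; apply ex_RInt_of_cont; intro; apply g_cont).
  assert (ch : forall t u, continuous (h t) u).
  { intros s u. apply (ex_derive_continuous (V := R_NormedModule)). unfold h. auto_derive. nra. }
  assert (D1 : forall s, is_derive (fun s => (RI g 0 s)^2) s (2 * RI g 0 s * g s)).
  { intros s.
    assert (Hs : is_derive (fun s => RI g 0 s) s (g s)).
    { apply (is_derive_RInt (V := R_CompleteNormedModule) g (fun b => RI g 0 b) 0 s).
      - exists (mkposreal 1 Rlt_0_1). intros y _. apply (RInt_correct (V := R_CompleteNormedModule)). apply cg.
      - apply g_cont. }
    replace (2 * RI g 0 s * g s) with (INR 2 * (g s) * (RI g 0 s)^(pred 2)) by (simpl; ring).
    apply (is_derive_pow (fun s => RI g 0 s) 2 s (g s) Hs). }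
  assert (D2 : forall s, is_derive (fun s => RI (h s) 0 1) s (RI (dh s) 0 1)).
  { intros s.
    assert (HD : forall x y, Derive (fun z => h z y) x = dh x y)
      by (intros; apply is_derive_unique, h_derive).
    rewrite <- (RInt_ext (V := R_CompleteNormedModule) (fun t => Derive (fun u => h u t) s) (dh s))
      by (intros; apply HD).
    apply (is_derive_RInt_param h 0 1 s).
    - exists (mkposreal 1 Rlt_0_1). intros y _ x _. exists (dh y x). apply h_derive.
    - intros x _. apply continuity_2d_pt_ext with dh.
      { intros; symmetry; apply HD. }
      unfold dh. apply continuity_2d_pt_mult.
      + apply continuity_2d_pt_mult; [apply continuity_2d_pt_const | apply continuity_2d_pt_id1].
      + apply (continuity_1d_2d_pt_comp exp (fun t u => - t^2 * (1+u^2) / 2)).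
        * apply derivable_continuous_pt, derivable_pt_exp.
        * apply continuity_2d_pt_ext with (fun t u => (- (1/2)) * ((t * t) * (1 + u * u))).
          { intros; simpl; field. }
          repeat first [apply continuity_2d_pt_mult | apply continuity_2d_pt_plus
                       | apply continuity_2d_pt_const | apply continuity_2d_pt_id1 | apply continuity_2d_pt_id2].
    - exists (mkposreal 1 Rlt_0_1). intros y _. apply ex_RInt_of_cont. intro; apply ch. }
  assert (Hsub : forall s, RI (dh s) 0 1 = - 2 * g s * RI g 0 s).
  { intros s.
    rewrite (RInt_ext (V := R_CompleteNormedModule) (dh s) (fun u => (- 2 * g s) * (s * g (s * u + 0)))).
    2:{ intros u _. unfold dh, g. rewrite Rplus_0_r.
        replace (- s^2 * (1 + u^2) / 2) with (- s^2/2 + - (s*u)^2/2) by (simpl; field).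
        rewrite exp_plus. toR. ring. }
    apply is_RInt_unique.
    apply (is_RInt_scal (V := R_NormedModule) (fun u => s * g (s * u + 0)) 0 1 (-2 * g s)).
    apply (is_RInt_comp_lin (V := R_NormedModule) g s 0 0 1).
    replace (s * 0 + 0) with 0 by ring. replace (s * 1 + 0) with s by ring.
    apply (RInt_correct (V := R_CompleteNormedModule)), cg. }
  assert (Hconst : forall s, is_derive (fun s => (RI g 0 s)^2 + RI (h s) 0 1) s 0).
  { intros s. pose proof (is_derive_plus (V := R_NormedModule) _ _ s _ _ (D1 s) (D2 s)) as P.
    rewrite Hsub in P. unfold plus in P; simpl in P.
    replace (2 * RI g 0 s * g s + -2 * g s * RI g 0 s) with 0 in P by ring. exact P. }
  transitivity ((RI g 0 0)^2 + RI (h 0) 0 1).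
  - destruct (MVT_gen (fun s => (RI g 0 s)^2 + RI (h s) 0 1) 0 t (fun _ => 0)) as [c [_ Hc]].
    + intros; apply Hconst.
    + intros x _. apply derivable_continuous_pt. exists 0. apply is_derive_Reals, Hconst.
    + lra.
  - rewrite (RInt_point (V := R_CompleteNormedModule)). unfold zero; simpl.
    assert (E : is_RInt (h 0) 0 1 (minus (2 * atan 1) (2 * atan 0))).
    { apply (is_RInt_derive (V := R_CompleteNormedModule) (fun x => 2 * atan x)); [|intros; apply ch].
      intros x _. unfold h. auto_derive; [easy|].
      replace (- 0 ^ 2 * (1 + x ^ 2) / 2) with 0 by (simpl; field). rewrite exp_0. toR. field. nra. }
    rewrite (is_RInt_unique _ _ _ _ E). unfold minus, plus, opp; simpl.
    rewrite atan_1, atan_0. lra.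
Qed.

Lemma half_gauss_bounds t : 1 <= t -> PI / 2 - 2 / t <= (RI g 0 t)^2 <= PI / 2.
Proof.
  intros Ht. pose proof (half_gauss_identity t) as E.
  assert (ch : ex_RInt (h t) 0 1).
  { apply ex_RInt_of_cont. intros u.
    apply (ex_derive_continuous (V := R_NormedModule)). unfold h. auto_derive. nra. }
  assert (H0 : 0 <= RI (h t) 0 1).
  { apply RInt_ge_0; [lra|auto|]. intros x _. unfold h.
    apply Rdiv_le_0_compat; [|nra]. pose proof (exp_pos (- t^2 * (1 + x^2) / 2)). lra. }
  assert (H1 : Rabs (RI (h t) 0 1) <= (1 - 0) * (2 / t)).
  { apply abs_RInt_le_const; [lra|auto|]. intros x _. unfold h.
    rewrite Rabs_right.
    2:{ apply Rle_ge. apply Rdiv_le_0_compat; [|nra]. pose proof (exp_pos (- t^2 * (1 + x^2) / 2)). lra. }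
    set (y := t^2 * (1+x^2)/2).
    replace (- t^2 * (1+x^2)/2) with (- y) by (unfold y; field).
    assert (Hy : t / 2 <= y) by (unfold y; nra).
    pose proof (exp_ineq1_le y) as Hey.
    assert (Hinv : exp (- y) <= / t).
    { assert (Hy2 : t <= exp y).
      { pose proof (exp_ineq1_le (y/2)) as Hh.
        replace y with (y/2 + y/2) by field. rewrite exp_plus.
        assert (t^2/2 <= y) by (unfold y; nra).
        destruct (Rle_dec t 2).
        - assert (t/2 <= y) by lra. assert (t^2/4 <= y/2) by lra.
          assert (exp (y/2) >= 1 + t^2/4) by lra. nra.
        - nra. }
      rewrite exp_Ropp. apply Rinv_le_contravar; lra. }
    apply Rle_div_l; [nra|].
    assert (0 < 2 / t) by (apply Rdiv_lt_0_compat; lra).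
    assert (2 * exp (-y) <= 2 / t) by (unfold Rdiv; lra). nra. }
  rewrite Rabs_right in H1 by lra. lra.
Qed.

Lemma is_ImpInt_gauss : is_ImpInt (fun x => exp (- x^2 / 2)) (sqrt (2 * PI)).
Proof.
  assert (cg : forall a b, ex_RInt g a b) by (intros; apply ex_RInt_of_cont; intro; apply g_cont).
  pose proof PI_RGT_0.
  set (p := sqrt (PI/2)).
  assert (Hp : p * p = PI/2) by (apply sqrt_sqrt; lra).
  assert (Hp0 : 0 < p) by (apply sqrt_lt_R0; lra).
  replace (sqrt (2 * PI)) with (p + p).
  2:{ symmetry. apply sqrt_lem_1; [lra|lra|]. nra. }
  assert (Hpos : forall t, 0 <= t -> 0 <= RI g 0 t).
  { intros t Ht. apply RInt_ge_0; [auto|apply cg|]. intros x _. apply Rlt_le, exp_pos. }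
  assert (Hlim : forall eps, 0 < eps -> exists M, forall t, M <= t -> Rabs (RI g 0 t - p) < eps).
  { intros eps He. assert (0 < eps * p) by nra.
    exists (Rmax 1 (2 / (eps * p) + 1)). intros t Ht.
    pose proof (Rmax_l 1 (2 / (eps * p) + 1)). pose proof (Rmax_r 1 (2 / (eps * p) + 1)).
    pose proof (half_gauss_bounds t ltac:(lra)) as [B1 B2].
    pose proof (Hpos t ltac:(lra)).
    set (i := RI g 0 t) in *.
    (* From [p^2 - i^2 <= 2 / t < eps * p] and [p + i >= p] one gets [p - i < eps]. *)
    assert (2 / t < eps * p).
    { apply Rlt_div_l; [lra|].
      assert (Hx : eps * p * (2 / (eps * p) + 1) <= eps * p * t) by (apply Rmult_le_compat_l; lra).
      replace (eps * p * (2 / (eps * p) + 1)) with (2 + eps * p) in Hx by (field; lra). lra. }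
    assert (i <= p) by nra.
    rewrite Rabs_left1 by lra. nra. }
  intros eps He. destruct (Hlim (eps/2)) as [M K]; [lra|].
  exists M. intros a b Ha Hb.
  rewrite RInt_of_ex_RInt by apply cg.
  change (fun x => exp (- x^2/2)) with g.
  rewrite <- (RInt_Chasles (V := R_CompleteNormedModule) g a 0 b) by apply cg.
  assert (Hsym : RI g a 0 = RI g 0 (- a)).
  { apply is_RInt_unique.
    apply is_RInt_ext with (fun x => opp (opp (g (- x)))).
    { intros x _. unfold opp; simpl. rewrite Ropp_involutive. unfold g. toR. f_equal. field. }
    replace (RI g 0 (- a)) with (opp (RI g (-a) 0)).
    2:{ unfold opp; simpl. rewrite <- (opp_RInt_swap (V := R_CompleteNormedModule)) by apply cg. unfold opp; simpl. ring. }
    apply (is_RInt_opp (V := R_NormedModule)).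
    apply (is_RInt_comp_opp (V := R_NormedModule) g a 0).
    rewrite Ropp_0. apply (RInt_correct (V := R_CompleteNormedModule)), cg. }
  rewrite Hsym. pose proof (K (-a) ltac:(lra)). pose proof (K b Hb).
  unfold plus; simpl.
  replace (RI g 0 (-a) + RI g 0 b - (p + p)) with ((RI g 0 (-a) - p) + (RI g 0 b - p)) by ring.
  eapply Rle_lt_trans; [apply Rabs_triang|]. lra.
Qed.

End GaussianIntegral.

(** * Gaussian means of exponentially weighted Lipschitz functions *)

Lemma sumR_S n f : sumR (S n) f = sumR n f + f n.
Proof. reflexivity. Qed.

Lemma sumR_ext n f g : (forall i, (i < n)%nat -> f i = g i) -> sumR n f = sumR n g.
Proof. induction n; simpl; intros H; auto. rewrite IHn, H; auto. Qed.

Lemma sumR_plus n f g : sumR n (fun i => f i + g i) = sumR n f + sumR n g.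
Proof. induction n; simpl; [ring|]. rewrite IHn. ring. Qed.

Lemma sumR_scal n c f : sumR n (fun i => c * f i) = c * sumR n f.
Proof. induction n; simpl; [ring|]. rewrite IHn. ring. Qed.

Lemma sumR_scal_r n c f : sumR n (fun i => f i * c) = sumR n f * c.
Proof. induction n; simpl; [ring|]. rewrite IHn. ring. Qed.

Lemma sumR_minus n f g : sumR n (fun i => f i - g i) = sumR n f - sumR n g.
Proof. induction n; simpl; [ring|]. rewrite IHn. ring. Qed.

Lemma sumR_const n c : sumR n (fun _ => c) = INR n * c.
Proof. induction n; [simpl; ring|]. rewrite S_INR. simpl. rewrite IHn. ring. Qed.

Lemma sumR_le n f g : (forall i, (i < n)%nat -> f i <= g i) -> sumR n f <= sumR n g.
Proof. induction n; simpl; intros H; [lra|]. apply Rplus_le_compat; auto. Qed.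

Lemma sumR_nonneg n f : (forall i, (i < n)%nat -> 0 <= f i) -> 0 <= sumR n f.
Proof. induction n; simpl; intros H; [lra|]. apply Rplus_le_le_0_compat; auto. Qed.

Lemma sumR_term_le n f k : (k < n)%nat -> (forall i, (i < n)%nat -> 0 <= f i) -> f k <= sumR n f.
Proof.
  induction n; intros Hk H; [lia|]. simpl.
  destruct (Nat.eq_dec k n) as [->|Hne].
  - pose proof (sumR_nonneg n f ltac:(auto)). lra.
  - assert (f k <= sumR n f) by (apply IHn; auto; lia). specialize (H n ltac:(lia)). lra.
Qed.

Lemma Rabs_sumR n f : Rabs (sumR n f) <= sumR n (fun i => Rabs (f i)).
Proof.
  induction n; simpl; [rewrite Rabs_R0; lra|].
  eapply Rle_trans; [apply Rabs_triang|]. lra.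
Qed.

Lemma sumR_swap n m f : sumR n (fun i => sumR m (fun j => f i j)) = sumR m (fun j => sumR n (fun i => f i j)).
Proof.
  induction n; simpl.
  - rewrite sumR_const. ring.
  - rewrite IHn, <- sumR_plus. reflexivity.
Qed.

Lemma sumR_app p q f : sumR (p + q) f = sumR p f + sumR q (fun j => f (p + j)%nat).
Proof.
  induction q; simpl.
  - rewrite Nat.add_0_r. ring.
  - rewrite Nat.add_succ_r. simpl. rewrite IHq. ring.
Qed.

Lemma sumR_prod p q f : sumR (p * q) f = sumR p (fun i => sumR q (fun j => f (i * q + j)%nat)).
Proof.
  induction p; simpl; auto.
  rewrite (Nat.add_comm q), sumR_app, IHp. reflexivity.
Qed.

Lemma sumR_mult p q f g : sumR p f * sumR q g = sumR p (fun i => sumR q (fun j => f i * g j)).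
Proof.
  rewrite <- sumR_scal_r. apply sumR_ext. intros. rewrite sumR_scal. reflexivity.
Qed.

Definition norm1 (n : nat) (x : nat -> R) : R := sumR n (fun i => Rabs (x i)).

Lemma norm1_pos n x : 0 <= norm1 n x.
Proof. apply sumR_nonneg. intros; apply Rabs_pos. Qed.

Lemma norm1_coord n x k : (k < n)%nat -> Rabs (x k) <= norm1 n x.
Proof. intros H. apply (sumR_term_le n (fun i => Rabs (x i))); auto. intros; apply Rabs_pos. Qed.

Lemma norm1_upd n v x : norm1 (S n) (upd v n x) = norm1 n v + Rabs x.
Proof.
  unfold norm1. simpl. f_equal.
  - apply sumR_ext. intros i Hi. unfold upd. destruct (Nat.eq_dec i n); [lia|auto].
  - unfold upd. destruct (Nat.eq_dec n n); [auto|lia].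
Qed.

Lemma norm1_mono n m x : (n <= m)%nat -> norm1 n x <= norm1 m x.
Proof.
  intros H. replace m with (n + (m - n))%nat by lia. unfold norm1. rewrite sumR_app.
  pose proof (sumR_nonneg (m-n) (fun j => Rabs (x (n+j)%nat)) ltac:(intros; apply Rabs_pos)). lra.
Qed.

Definition dist1 n (x y : nat -> R) := norm1 n (fun i => x i - y i).

Lemma dist1_pos n x y : 0 <= dist1 n x y.
Proof. apply norm1_pos. Qed.

Lemma dist1_upd n v w x y : dist1 (S n) (upd v n x) (upd w n y) = dist1 n v w + Rabs (x - y).
Proof.
  unfold dist1. rewrite <- norm1_upd. apply sumR_ext. intros i Hi. unfold upd.
  destruct (Nat.eq_dec i n); auto.
Qed.

Lemma dist1_refl n x : dist1 n x x = 0.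
Proof.
  unfold dist1, norm1. rewrite (sumR_ext n _ (fun _ => 0)).
  - rewrite sumR_const; ring.
  - intros. rewrite Rminus_diag, Rabs_R0. auto.
Qed.

(** The l1 norm adds over coordinates, so this weight factorises under [upd]; that is what allows
    coordinates to be integrated out one at a time, each factor having a finite Gaussian mean. *)
Definition wt n a (x : nat -> R) := exp (a * norm1 n x).

Lemma wt_pos n a x : 0 < wt n a x.
Proof. apply exp_pos. Qed.

Lemma exp_ge_1 x : 0 <= x -> 1 <= exp x.
Proof. intros. pose proof (exp_ineq1_le x). lra. Qed.

Lemma exp_le x y : x <= y -> exp x <= exp y.
Proof. intros [H|H]; [left; now apply exp_increasing | subst; lra]. Qed.

Lemma wt_ge_1 n a x : 0 <= a -> 1 <= wt n a x.
Proof. intros. apply exp_ge_1. pose proof (norm1_pos n x). nra. Qed.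

Lemma wt_plus n a b x : wt n (a + b) x = wt n a x * wt n b x.
Proof. unfold wt. rewrite <- exp_plus. f_equal. ring. Qed.

Lemma wt_mono n a b x : a <= b -> wt n a x <= wt n b x.
Proof. intros. apply exp_le. apply Rmult_le_compat_r; [apply norm1_pos|auto]. Qed.

Lemma wt_norm n a x : 0 <= a -> 1 + a * norm1 n x <= wt n a x.
Proof. intros. apply exp_ineq1_le. Qed.

(* Locally Lipschitz functions of the first [n] coordinates with exponential weights: this class is stable
   under integrating out Gaussian coordinates by mere monotonicity of the integral. *)
Definition explip (n : nat) (F : (nat -> R) -> R) : Prop :=
  exists C a, 0 <= C /\ 0 <= a /\
    forall x y, Rabs (F x - F y) <= C * (wt n a x * wt n a y) * dist1 n x y.

Lemma explip_growth n F : explip n F -> exists C a, 0 <= C /\ 0 <= a /\ forall x, Rabs (F x) <= C * wt n a x.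
Proof.
  intros (C & a & HC & Ha & H).
  exists (Rabs (F (fun _ => 0)) + C), (a + 1). split; [|split; [lra|]].
  { pose proof (Rabs_pos (F (fun _ => 0))). lra. }
  intros x. specialize (H x (fun _ => 0)).
  assert (E0 : norm1 n (fun _ => 0) = 0).
  { unfold norm1. rewrite (sumR_ext n _ (fun _ => 0)); [rewrite sumR_const; ring|]. intros; apply Rabs_R0. }
  assert (E1 : wt n a (fun _ => 0) = 1).
  { unfold wt. rewrite E0, Rmult_0_r. apply exp_0. }
  assert (E2 : dist1 n x (fun _ => 0) = norm1 n x).
  { apply sumR_ext. intros; f_equal; ring. }
  rewrite E1, E2, Rmult_1_r in H.
  pose proof (wt_norm n 1 x ltac:(lra)). pose proof (norm1_pos n x).
  pose proof (wt_ge_1 n a x Ha). pose proof (wt_ge_1 n 1 x ltac:(lra)).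
  rewrite wt_plus.
  replace (F x) with ((F x - F (fun _ => 0)) + F (fun _ => 0)) by ring.
  eapply Rle_trans; [apply Rabs_triang|].
  pose proof (Rabs_pos (F (fun _ => 0))).
  set (f0 := Rabs (F (fun _ => 0))) in *.
  assert (C * wt n a x * norm1 n x <= C * wt n a x * wt n 1 x).
  { apply Rmult_le_compat_l; [nra|lra]. }
  assert (f0 * 1 <= f0 * (wt n a x * wt n 1 x)) by (apply Rmult_le_compat_l; nra). lra.
Qed.

Lemma explip_const n c : explip n (fun _ => c).
Proof.
  exists 0, 0. split; [lra|split;[lra|]]. intros. rewrite Rminus_diag, Rabs_R0. lra.
Qed.

Lemma explip_coord n k : (k < n)%nat -> explip n (fun x => x k).
Proof.
  intros H. exists 1, 0. split; [lra|split;[lra|]]. intros x y.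
  pose proof (norm1_coord n (fun i => x i - y i) k H). simpl in H0.
  pose proof (wt_ge_1 n 0 x ltac:(lra)). pose proof (wt_ge_1 n 0 y ltac:(lra)).
  pose proof (dist1_pos n x y). unfold dist1 in *.
  assert (1 <= wt n 0 x * wt n 0 y) by nra. nra.
Qed.

Lemma explip_norm1 n : explip n (norm1 n).
Proof.
  exists 1, 0. split; [lra|split;[lra|]]. intros x y.
  assert (Rabs (norm1 n x - norm1 n y) <= dist1 n x y).
  { unfold norm1. rewrite <- sumR_minus. eapply Rle_trans; [apply Rabs_sumR|].
    apply sumR_le. intros. apply Rabs_triang_inv2. }
  pose proof (wt_ge_1 n 0 x ltac:(lra)). pose proof (wt_ge_1 n 0 y ltac:(lra)).
  pose proof (dist1_pos n x y). assert (1 <= wt n 0 x * wt n 0 y) by nra. nra.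
Qed.

Lemma explip_plus n F G : explip n F -> explip n G -> explip n (fun x => F x + G x).
Proof.
  intros (C & a & HC & Ha & H) (D & b & HD & Hb & K).
  exists (C + D), (a + b). split; [lra|split;[lra|]]. intros x y.
  replace (F x + G x - (F y + G y)) with ((F x - F y) + (G x - G y)) by ring.
  eapply Rle_trans; [apply Rabs_triang|].
  specialize (H x y). specialize (K x y).
  pose proof (dist1_pos n x y).
  assert (Hx1 := wt_mono n a (a+b) x ltac:(lra)). assert (Hx2 := wt_mono n b (a+b) x ltac:(lra)).
  assert (Hy1 := wt_mono n a (a+b) y ltac:(lra)). assert (Hy2 := wt_mono n b (a+b) y ltac:(lra)).
  pose proof (wt_pos n a x). pose proof (wt_pos n a y). pose proof (wt_pos n b x). pose proof (wt_pos n b y).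
  assert (wt n a x * wt n a y <= wt n (a+b) x * wt n (a+b) y) by (apply Rmult_le_compat; lra).
  assert (wt n b x * wt n b y <= wt n (a+b) x * wt n (a+b) y) by (apply Rmult_le_compat; lra).
  set (P := wt n (a+b) x * wt n (a+b) y) in *.
  assert (C * (wt n a x * wt n a y) * dist1 n x y <= C * P * dist1 n x y)
    by (apply Rmult_le_compat_r; auto; apply Rmult_le_compat_l; auto).
  assert (D * (wt n b x * wt n b y) * dist1 n x y <= D * P * dist1 n x y)
    by (apply Rmult_le_compat_r; auto; apply Rmult_le_compat_l; auto).
  lra.
Qed.

(** Common criterion for compositions: increments of [F] need only be compared with increments of a
    function already in the class, up to weights. *)
Lemma explip_intro n F G C a : explip n G -> 0 <= C -> 0 <= a ->
  (forall x y, Rabs (F x - F y) <= C * (wt n a x * wt n a y) * Rabs (G x - G y)) -> explip n F.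
Proof.
  intros (D & b & HD & Hb & K) HC Ha H.
  exists (C * D), (a + b). split; [nra|split;[lra|]]. intros x y.
  eapply Rle_trans; [apply H|]. rewrite !wt_plus.
  pose proof (wt_pos n a x). pose proof (wt_pos n a y). pose proof (wt_pos n b x). pose proof (wt_pos n b y).
  specialize (K x y).
  replace (C * D * (wt n a x * wt n b x * (wt n a y * wt n b y)) * dist1 n x y)
    with (C * (wt n a x * wt n a y) * (D * (wt n b x * wt n b y) * dist1 n x y)) by ring.
  apply Rmult_le_compat_l; auto. apply Rmult_le_pos; [auto|apply Rmult_le_pos; lra].
Qed.

Lemma explip_lip n F (psi : R -> R) K : 0 <= K -> (forall s t, Rabs (psi s - psi t) <= K * Rabs (s - t)) ->
  explip n F -> explip n (fun x => psi (F x)).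
Proof.
  intros HK Hpsi H. apply (explip_intro n _ F K 0); auto; [lra|]. intros x y.
  eapply Rle_trans; [apply Hpsi|].
  pose proof (wt_ge_1 n 0 x ltac:(lra)). pose proof (wt_ge_1 n 0 y ltac:(lra)).
  apply Rmult_le_compat_r; [apply Rabs_pos|].
  assert (1 <= wt n 0 x * wt n 0 y) by nra. nra.
Qed.

Lemma explip_scal n c F : explip n F -> explip n (fun x => c * F x).
Proof.
  intros H. apply (explip_lip n F (fun t => c * t) (Rabs c)); auto; [apply Rabs_pos|].
  intros s t. rewrite <- Rabs_mult. right. f_equal. ring.
Qed.

Lemma explip_opp n F : explip n F -> explip n (fun x => - F x).
Proof.
  intros H. apply (explip_lip n F (fun t => - t) 1); auto; [lra|].
  intros s t. rewrite Rmult_1_l, <- Rabs_Ropp. right. f_equal. ring.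
Qed.

Lemma explip_minus n F G : explip n F -> explip n G -> explip n (fun x => F x - G x).
Proof. intros. unfold Rminus. apply explip_plus; auto. now apply explip_opp. Qed.

Lemma explip_mult n F G : explip n F -> explip n G -> explip n (fun x => F x * G x).
Proof.
  intros HF HG.
  destruct (explip_growth _ _ HF) as (C & a & HC & Ha & H).
  destruct (explip_growth _ _ HG) as (D & b & HD & Hb & K).
  destruct HF as (C' & a' & HC' & Ha' & H'). destruct HG as (D' & b' & HD' & Hb' & K').
  exists (C' * D + D' * C), (a' + b + (b' + a)).
  split; [nra|split;[lra|]]. intros x y.
  replace (F x * G x - F y * G y) with ((F x - F y) * G x + F y * (G x - G y)) by ring.
  eapply Rle_trans; [apply Rabs_triang|]. rewrite !Rabs_mult.
  specialize (H y). specialize (K x). specialize (H' x y). specialize (K' x y).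
  assert (Rabs (F x - F y) * Rabs (G x) <= (C' * (wt n a' x * wt n a' y) * dist1 n x y) * (D * wt n b x))
    by (apply Rmult_le_compat; auto; apply Rabs_pos).
  assert (Rabs (F y) * Rabs (G x - G y) <= (C * wt n a y) * (D' * (wt n b' x * wt n b' y) * dist1 n x y))
    by (apply Rmult_le_compat; auto; apply Rabs_pos).
  rewrite !wt_plus.
  pose proof (dist1_pos n x y).
  pose proof (wt_ge_1 n a x Ha). pose proof (wt_ge_1 n a y Ha).
  pose proof (wt_ge_1 n b x Hb). pose proof (wt_ge_1 n b y Hb).
  pose proof (wt_ge_1 n a' x Ha'). pose proof (wt_ge_1 n a' y Ha').
  pose proof (wt_ge_1 n b' x Hb'). pose proof (wt_ge_1 n b' y Hb').
  set (X1 := wt n a' x * wt n b x) in *. set (X2 := wt n b' x * wt n a x) in *.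
  set (Y1 := wt n a' y * wt n b y) in *. set (Y2 := wt n b' y * wt n a y) in *.
  assert (1 <= X1) by (unfold X1; nra). assert (1 <= X2) by (unfold X2; nra).
  assert (1 <= Y1) by (unfold Y1; nra). assert (1 <= Y2) by (unfold Y2; nra).
  assert (wt n a' x * wt n b x * wt n a' y <= X1 * X2 * (Y1 * Y2)).
  { fold X1. assert (wt n a' y <= Y1) by (unfold Y1; nra).
    assert (X1 <= X1 * X2) by nra. assert (Y1 <= Y1 * Y2) by nra.
    apply Rmult_le_compat; lra. }
  assert (wt n b' x * (wt n b' y * wt n a y) <= X1 * X2 * (Y1 * Y2)).
  { fold Y2. assert (wt n b' x <= X2) by (unfold X2; nra).
    assert (X2 <= X1 * X2) by nra. assert (Y2 <= Y1 * Y2) by nra.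
    apply Rmult_le_compat; lra. }
  assert (C' * D * dist1 n x y * (wt n a' x * wt n b x * wt n a' y) <= C' * D * dist1 n x y * (X1 * X2 * (Y1 * Y2))).
  { apply Rmult_le_compat_l; auto. apply Rmult_le_pos; nra. }
  assert (C * D' * dist1 n x y * (wt n b' x * (wt n b' y * wt n a y)) <= C * D' * dist1 n x y * (X1 * X2 * (Y1 * Y2))).
  { apply Rmult_le_compat_l; auto. apply Rmult_le_pos; nra. }
  nra.
Qed.

Lemma explip_sum n K (F : nat -> (nat -> R) -> R) : (forall i, (i < K)%nat -> explip n (F i)) ->
  explip n (fun x => sumR K (fun i => F i x)).
Proof.
  induction K; intros H; simpl; [apply explip_const|].
  apply explip_plus; [apply IHK|]; auto.
Qed.

Lemma exp_diff u v M : u <= M -> v <= M -> Rabs (exp u - exp v) <= exp M * Rabs (u - v).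
Proof.
  assert (K : forall u v, u <= M -> v <= u -> Rabs (exp u - exp v) <= exp M * Rabs (u - v)).
  { intros s t Hs Hts. assert (exp t <= exp s) by now apply exp_le. assert (exp s <= exp M) by now apply exp_le.
    rewrite !Rabs_right by lra.
    pose proof (exp_ineq1_le (t - s)) as H1. pose proof (exp_pos s).
    assert (exp t = exp s * exp (t - s)) by (rewrite <- exp_plus; f_equal; ring).
    assert (exp s * (s - t) <= exp M * (s - t)) by (apply Rmult_le_compat_r; lra). nra. }
  intros Hu Hv. destruct (Rle_dec v u); [now apply K|].
  rewrite Rabs_minus_sym, (Rabs_minus_sym u). apply K; lra.
Qed.

Lemma explip_exp n F A B : 0 <= A -> 0 <= B -> (forall x, F x <= A + B * norm1 n x) -> explip n F -> explip n (fun x => exp (F x)).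
Proof.
  intros HA HB Hb H. apply (explip_intro n _ F (exp A) B); auto; [apply Rlt_le, exp_pos|].
  intros x y.
  replace (exp A * (wt n B x * wt n B y)) with (exp (A + B * norm1 n x + B * norm1 n y)).
  2:{ unfold wt. rewrite <- !exp_plus. f_equal. ring. }
  pose proof (norm1_pos n x). pose proof (norm1_pos n y).
  assert (0 <= B * norm1 n x) by nra. assert (0 <= B * norm1 n y) by nra.
  apply exp_diff; [specialize (Hb x)|specialize (Hb y)]; lra.
Qed.

Lemma wt_opp n a x : wt n (- a) x * wt n a x = 1.
Proof. rewrite <- wt_plus. unfold wt. rewrite Rplus_opp_l, Rmult_0_l. apply exp_0. Qed.

Lemma explip_inv n F c a : 0 < c -> 0 <= a -> (forall x, c * wt n (- a) x <= F x) -> explip n F -> explip n (fun x => / F x).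
Proof.
  intros Hc Ha Hb H. apply (explip_intro n _ F (/ c * / c) a); auto.
  { pose proof (Rinv_0_lt_compat c Hc). nra. }
  intros x y.
  assert (Hi : forall x, 0 < F x /\ 0 < / F x /\ / F x <= / c * wt n a x).
  { intros z. specialize (Hb z). pose proof (wt_pos n (-a) z). pose proof (wt_pos n a z).
    pose proof (wt_opp n a z).
    assert (0 < F z) by nra. split; auto. split; [now apply Rinv_0_lt_compat|].
    replace (/ c * wt n a z) with (/ (c * wt n (-a) z)).
    - apply Rinv_le_contravar; [nra|auto].
    - apply (Rmult_eq_reg_l (c * wt n (-a) z)); [|nra]. rewrite Rinv_r by nra.
      replace (c * wt n (- a) z * (/ c * wt n a z)) with ((c * / c) * (wt n (-a) z * wt n a z)) by ring.
      rewrite H2, Rinv_r; lra. }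
  destruct (Hi x) as (P1 & P2 & P3). destruct (Hi y) as (Q1 & Q2 & Q3).
  replace (/ F x - / F y) with ((/ F x * / F y) * - (F x - F y)) by (field; lra).
  rewrite Rabs_mult, Rabs_Ropp, Rabs_right by nra.
  apply Rmult_le_compat_r; [apply Rabs_pos|].
  replace (/ c * / c * (wt n a x * wt n a y)) with ((/ c * wt n a x) * (/ c * wt n a y)) by ring.
  apply Rmult_le_compat; lra.
Qed.

Lemma ln_le_minus_1 x : 0 < x -> ln x <= x - 1.
Proof. intros H. pose proof (exp_ineq1_le (ln x)). rewrite exp_ln in H0; lra. Qed.

Lemma ln_le' x y : 0 < x -> x <= y -> ln x <= ln y.
Proof. intros H [K|K]; [left; now apply ln_increasing|subst; lra]. Qed.

Lemma ln_diff_abs u v : 0 < u -> 0 < v -> Rabs (ln u - ln v) <= (/ u + / v) * Rabs (u - v).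
Proof.
  assert (K : forall u v, 0 < u -> u <= v -> Rabs (ln u - ln v) <= (/ u + / v) * Rabs (u - v)).
  { intros s t Hs Hst. assert (ln s <= ln t) by now apply ln_le'.
    rewrite !Rabs_left1 by lra.
    assert (E : ln t - ln s = ln (t * / s)).
    { rewrite ln_mult; [|lra|apply Rinv_0_lt_compat; lra]. rewrite ln_Rinv; lra. }
    assert (0 < / s) by (apply Rinv_0_lt_compat; lra). assert (0 < / t) by (apply Rinv_0_lt_compat; lra).
    assert (0 < t * / s) by nra.
    pose proof (ln_le_minus_1 (t * / s) H2).
    assert (t * / s - 1 = / s * (t - s)) by (field; lra).
    nra. }
  intros Hu Hv. destruct (Rle_dec u v); [now apply K|].
  rewrite Rabs_minus_sym, (Rabs_minus_sym u), Rplus_comm. apply K; lra.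
Qed.

(** The slope of [ln] between two points is at most the sum of their inverses, and the lower bound
    on [F] makes these inverses grow no faster than a weight. *)
Lemma explip_ln n F c a : 0 < c -> 0 <= a -> (forall x, c * wt n (- a) x <= F x) -> explip n F -> explip n (fun x => ln (F x)).
Proof.
  intros Hc Ha Hb H. apply (explip_intro n _ F (2 * / c) a); auto.
  { pose proof (Rinv_0_lt_compat c Hc). nra. }
  intros x y.
  assert (Hi : forall x, 0 < F x /\ / F x <= / c * wt n a x).
  { intros z. specialize (Hb z). pose proof (wt_pos n (-a) z). pose proof (wt_pos n a z).
    pose proof (wt_opp n a z).
    assert (0 < F z) by nra. split; auto.
    replace (/ c * wt n a z) with (/ (c * wt n (-a) z)).
    - apply Rinv_le_contravar; [nra|auto].
    - apply (Rmult_eq_reg_l (c * wt n (-a) z)); [|nra]. rewrite Rinv_r by nra.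
      replace (c * wt n (- a) z * (/ c * wt n a z)) with ((c * / c) * (wt n (-a) z * wt n a z)) by ring.
      rewrite H2, Rinv_r; lra. }
  destruct (Hi x) as (P1 & P3). destruct (Hi y) as (Q1 & Q3).
  eapply Rle_trans; [apply ln_diff_abs; auto|].
  apply Rmult_le_compat_r; [apply Rabs_pos|].
  pose proof (Rinv_0_lt_compat c Hc).
  pose proof (wt_ge_1 n a x Ha). pose proof (wt_ge_1 n a y Ha).
  assert (wt n a x <= wt n a x * wt n a y) by nra.
  assert (wt n a y <= wt n a x * wt n a y) by nra. nra.
Qed.

Lemma explip_mono n m F : (n <= m)%nat -> explip n F -> explip m F.
Proof.
  intros Hnm (C & a & HC & Ha & H). exists C, a. split; [auto|split;[auto|]]. intros x y.
  eapply Rle_trans; [apply H|].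
  assert (Hw : forall x, wt n a x <= wt m a x).
  { intros z. apply exp_le. apply Rmult_le_compat_l; auto. now apply norm1_mono. }
  pose proof (Hw x). pose proof (Hw y). pose proof (wt_pos n a x). pose proof (wt_pos n a y).
  assert (dist1 n x y <= dist1 m x y) by now apply norm1_mono.
  pose proof (dist1_pos n x y).
  apply Rmult_le_compat; auto; [apply Rmult_le_pos; [auto|apply Rmult_le_pos; lra]|].
  apply Rmult_le_compat_l; auto. apply Rmult_le_compat; lra.
Qed.

Lemma explip_wt n a : 0 <= a -> explip n (wt n a).
Proof.
  intros Ha. apply (explip_exp n (fun x => a * norm1 n x) 0 a); auto; [lra|intros; lra|].
  apply explip_scal, explip_norm1.
Qed.

Lemma wt_upd n a v x : wt (S n) a (upd v n x) = wt n a v * exp (a * Rabs x).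
Proof. unfold wt. rewrite norm1_upd, <- exp_plus. f_equal; ring. Qed.

Lemma explip_freeze n F t : explip (S n) F -> explip n (fun v => F (upd v n t)).
Proof.
  intros (C & a & HC & Ha & H). exists (C * (exp (a * Rabs t) * exp (a * Rabs t))), a.
  pose proof (exp_pos (a * Rabs t)).
  split; [apply Rmult_le_pos; [auto|apply Rmult_le_pos; lra]|split;[auto|]]. intros x y. eapply Rle_trans; [apply H|].
  rewrite !wt_upd, dist1_upd, Rminus_diag, Rabs_R0. right. ring.
Qed.

Definition explip1 (f : R -> R) : Prop :=
  exists C a, 0 <= C /\ 0 <= a /\
    forall x y, Rabs (f x - f y) <= C * (exp (a * Rabs x) * exp (a * Rabs y)) * Rabs (x - y).

Lemma explip1_of_explip n F v : explip (S n) F -> explip1 (fun x => F (upd v n x)).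
Proof.
  intros (C & a & HC & Ha & H). exists (C * (wt n a v * wt n a v)), a.
  pose proof (wt_pos n a v).
  split; [apply Rmult_le_pos; [auto|apply Rmult_le_pos; lra]|split;[auto|]]. intros x y. eapply Rle_trans; [apply H|].
  rewrite !wt_upd, dist1_upd, dist1_refl. right. ring.
Qed.

Lemma explip1_iff f : explip1 f <-> explip 1 (fun x => f (x O)).
Proof.
  split.
  - intros (C & a & HC & Ha & H). exists C, a. split; [auto|split;[auto|]]. intros x y.
    eapply Rle_trans; [apply H|]. unfold wt, dist1, norm1. simpl. rewrite !Rplus_0_l. lra.
  - intros H. apply (explip1_of_explip 0 _ (fun _ => 0)) in H. exact H.
Qed.

Lemma explip1_const c : explip1 (fun _ => c).
Proof. apply explip1_iff. apply explip_const. Qed.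
Lemma explip1_id : explip1 (fun x => x).
Proof. apply explip1_iff. apply explip_coord. lia. Qed.
Lemma explip1_mult f g : explip1 f -> explip1 g -> explip1 (fun x => f x * g x).
Proof. rewrite !explip1_iff. apply explip_mult. Qed.
Lemma explip1_scal c f : explip1 f -> explip1 (fun x => c * f x).
Proof. rewrite !explip1_iff. apply explip_scal. Qed.
Lemma explip1_expl c : explip1 (fun x => exp (c * x)).
Proof.
  apply explip1_iff. apply (explip_exp 1 (fun x => c * x O) 0 (Rabs c)); [lra|apply Rabs_pos| |].
  - intros x. unfold norm1; simpl. rewrite !Rplus_0_l, <- Rabs_mult. apply Rle_abs.
  - apply explip_scal, explip_coord. lia.
Qed.

Lemma explip1_cont f x : explip1 f -> continuous f x.
Proof.
  intros (C & a & HC & Ha & H).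
  apply continuity_pt_filterlim. intros eps He.
  set (K := C * (exp (a * (Rabs x + 1)) * exp (a * Rabs x)) + 1).
  assert (HK : 0 < K).
  { unfold K. pose proof (exp_pos (a * (Rabs x + 1))). pose proof (exp_pos (a * Rabs x)).
    assert (0 <= exp (a * (Rabs x + 1)) * exp (a * Rabs x)) by nra. nra. }
  exists (Rmin 1 (eps / K)). split.
  { apply Rmin_case; [lra|]. now apply Rdiv_lt_0_compat. }
  intros y [_ Hy]. simpl in *. unfold Rdist in *.
  pose proof (Rmin_l 1 (eps / K)). pose proof (Rmin_r 1 (eps/K)).
  eapply Rle_lt_trans; [apply H|].
  assert (Rabs y <= Rabs x + 1).
  { replace y with ((y - x) + x) by ring. eapply Rle_trans; [apply Rabs_triang|]. lra. }
  assert (exp (a * Rabs y) <= exp (a * (Rabs x + 1))) by (apply exp_le; nra).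
  pose proof (exp_pos (a * Rabs y)). pose proof (exp_pos (a * Rabs x)). pose proof (Rabs_pos (y - x)).
  assert (C * (exp (a * Rabs y) * exp (a * Rabs x)) <= K).
  { unfold K. assert (exp (a * Rabs y) * exp (a * Rabs x) <= exp (a * (Rabs x + 1)) * exp (a * Rabs x)) by nra. nra. }
  apply Rle_lt_trans with (K * Rabs (y - x)); [nra|].
  assert (K * (eps / K) = eps) by (field; lra). nra.
Qed.

Lemma explip1_growth f : explip1 f -> exists C a, 0 <= C /\ 0 <= a /\ forall x, Rabs (f x) <= C * exp (a * Rabs x).
Proof.
  intros H. apply explip1_iff in H. apply explip_growth in H. destruct H as (C & a & HC & Ha & H).
  exists C, a. split; [auto|split;[auto|]]. intros x. specialize (H (fun _ => x)).
  unfold wt, norm1 in H; simpl in H. now rewrite Rplus_0_l in H.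
Qed.

Definition phi (x : R) : R := / sqrt (2 * PI) * exp (- x^2 / 2).

Lemma sqrt2PI_pos : 0 < sqrt (2 * PI).
Proof. apply sqrt_lt_R0. pose proof PI_RGT_0. lra. Qed.

Lemma phi_pos x : 0 < phi x.
Proof. unfold phi. pose proof (exp_pos (- x^2/2)). pose proof (Rinv_0_lt_compat _ sqrt2PI_pos). nra. Qed.

Lemma phi_cont x : continuous phi x.
Proof. apply (ex_derive_continuous (V := R_NormedModule)). unfold phi. auto_derive. easy. Qed.

Lemma phi_explip1_cont f x : explip1 f -> continuous (fun x => phi x * f x) x.
Proof. intros H. apply (continuous_mult (K := R_AbsRing)); [apply phi_cont | now apply explip1_cont]. Qed.

(** The exponent [x^2/2] is split in two: one [x^2/4] absorbs [a |x|] at the cost [exp (a^2)], by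
    [(a - |x|/2)^2 >= 0], and the other absorbs [1 + x^2] at the cost 4. *)
Lemma phi_explip1_decay f : explip1 f -> exists C, forall x, Rabs (phi x * f x) <= C / (1 + x^2).
Proof.
  intros H. destruct (explip1_growth f H) as (C & a & HC & Ha & K).
  exists (/ sqrt (2*PI) * C * (4 * exp (a^2))). intros x.
  rewrite Rabs_mult, (Rabs_right (phi x)) by (pose proof (phi_pos x); lra).
  unfold phi. specialize (K x).
  assert (Hs := Rinv_0_lt_compat _ sqrt2PI_pos).
  assert (Hx2 : 0 < 1 + x^2) by (pose proof (pow2_ge_0 x); lra).
  apply (proj1 (Rle_div_r _ _ _ Hx2)). apply Rlt_le in Hx2.
  apply Rle_trans with (/ sqrt (2*PI) * exp (- x^2/2) * (C * exp (a * Rabs x)) * (1 + x^2)).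
  { apply Rmult_le_compat_r; [auto|]. apply Rmult_le_compat_l; auto.
    pose proof (exp_pos (- x^2/2)). nra. }
  replace (/ sqrt (2 * PI) * exp (- x ^ 2 / 2) * (C * exp (a * Rabs x)) * (1 + x ^ 2))
    with (/ sqrt (2*PI) * C * ((exp (- x^2/2) * exp (a * Rabs x)) * (1 + x^2))) by ring.
  apply Rmult_le_compat_l; [nra|].
  rewrite <- exp_plus.
  assert (E1 : 1 + x^2 <= 4 * exp (x^2/4)).
  { pose proof (exp_ineq1_le (x^2/4)). lra. }
  assert (E2 : exp (- x^2/2 + a * Rabs x) <= exp (a^2) * exp (- (x^2/4))).
  { rewrite <- exp_plus. apply exp_le. rewrite <- (pow2_abs x).
    assert (0 <= (a - Rabs x / 2)^2) by apply pow2_ge_0. nra. }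
  assert (E3 : exp (-(x^2/4)) * exp (x^2/4) = 1) by (rewrite <- exp_plus, Rplus_opp_l; apply exp_0).
  pose proof (exp_pos (- x^2/2 + a * Rabs x)). pose proof (exp_pos (a^2)). pose proof (exp_pos (- (x^2/4))).
  apply Rle_trans with ((exp (a^2) * exp (- (x^2/4))) * (4 * exp (x^2/4))).
  { apply Rmult_le_compat; lra. }
  right. replace (exp (a ^ 2) * exp (- (x ^ 2 / 4)) * (4 * exp (x ^ 2 / 4)))
    with (4 * exp (a^2) * (exp (- (x ^ 2 / 4)) * exp (x^2/4))) by ring.
  rewrite E3. ring.
Qed.

Definition E1 (f : R -> R) : R := ImpInt (fun x => phi x * f x).

Lemma E1_correct f : explip1 f -> is_ImpInt (fun x => phi x * f x) (E1 f).
Proof.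
  intros H. destruct (phi_explip1_decay f H) as [C HC].
  destruct (is_ImpInt_ex _ C (fun x => phi_explip1_cont f x H) HC) as [l Hl].
  replace (E1 f) with l; [exact Hl|]. symmetry. exact (ImpInt_eq _ _ Hl).
Qed.

Lemma E1_linear f g a b : explip1 f -> explip1 g -> E1 (fun x => a * f x + b * g x) = a * E1 f + b * E1 g.
Proof.
  intros Hf Hg. apply ImpInt_eq.
  replace (fun x => phi x * (a * f x + b * g x)) with (fun x => a * (phi x * f x) + b * (phi x * g x))
    by (apply functional_extensionality; intros; ring).
  apply is_ImpInt_linear; try (intros; now apply phi_explip1_cont); now apply E1_correct.
Qed.

Lemma E1_le f g : explip1 f -> explip1 g -> (forall x, f x <= g x) -> E1 f <= E1 g.
Proof.
  intros Hf Hg H.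
  apply (is_ImpInt_le (fun x => phi x * f x) (fun x => phi x * g x)); try (intros; now apply phi_explip1_cont).
  - intros x. apply Rmult_le_compat_l; auto. apply Rlt_le, phi_pos.
  - now apply E1_correct.
  - now apply E1_correct.
Qed.

Lemma E1_const c : E1 (fun _ => c) = c.
Proof.
  apply ImpInt_eq.
  assert (cg : forall x, continuous (fun x => exp (- x^2/2)) x).
  { intros x. apply (ex_derive_continuous (V := R_NormedModule)). auto_derive. easy. }
  pose proof (is_ImpInt_linear _ _ (/ sqrt (2 * PI) * c) 0 _ _ cg cg is_ImpInt_gauss is_ImpInt_gauss) as H.
  replace (/ sqrt (2 * PI) * c * sqrt (2 * PI) + 0 * sqrt (2 * PI)) with c in H
    by (field; pose proof sqrt2PI_pos; lra).
  replace (fun x => phi x * c) with (fun x => / sqrt (2 * PI) * c * exp (- x ^ 2 / 2) + 0 * exp (- x ^ 2 / 2)); auto.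
  apply functional_extensionality; intros; unfold phi; ring.
Qed.

Lemma E1_scal c f : explip1 f -> E1 (fun x => c * f x) = c * E1 f.
Proof.
  intros H. replace (fun x => c * f x) with (fun x => c * f x + 0 * f x)
    by (apply functional_extensionality; intros; ring).
  rewrite E1_linear; auto. ring.
Qed.

Lemma phi_derive x : is_derive phi x (- x * phi x).
Proof.
  unfold phi. auto_derive; [easy|].
  replace (- (x * (x * 1)) * / 2) with (- x ^ 2 / 2) by (simpl; field). field.
  pose proof sqrt2PI_pos. lra.
Qed.

(** The derivative of [phi * f] is [phi * (df - x f)], and it integrates to zero. *)
Lemma E1_ibp f df : explip1 f -> explip1 df -> (forall x, is_derive f x (df x)) -> E1 (fun x => x * f x) = E1 df.
Proof.
  intros Hf Hdf Hd.
  assert (Hxf : explip1 (fun x => x * f x)) by (apply explip1_mult; auto; apply explip1_id).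
  assert (Z : is_ImpInt (fun x => 1 * (phi x * df x) + (-1) * (phi x * (x * f x))) 0).
  { apply is_ImpInt_derive with (fun x => phi x * f x).
    - intros x. replace (1 * (phi x * df x) + -1 * (phi x * (x * f x))) with (- x * phi x * f x + phi x * df x) by ring.
      apply (is_derive_mult (K := R_AbsRing) phi f x); auto; [apply phi_derive|]. intros; apply Rmult_comm.
    - intros x. apply (continuous_plus (V := R_NormedModule) (fun x => 1 * (phi x * df x)) (fun x => (-1) * (phi x * (x * f x)))).
      + apply (continuous_mult (K := R_AbsRing)); [apply continuous_const|now apply phi_explip1_cont].
      + apply (continuous_mult (K := R_AbsRing)); [apply continuous_const|now apply (phi_explip1_cont (fun x => x * f x))].
    - now apply phi_explip1_decay. }
  assert (Z' : is_ImpInt (fun x => 1 * (phi x * df x) + (-1) * (phi x * (x * f x))) (1 * E1 df + (-1) * E1 (fun x => x * f x))).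
  { apply is_ImpInt_linear.
    - intros; now apply (phi_explip1_cont df).
    - intros; now apply (phi_explip1_cont (fun x => x * f x)).
    - now apply E1_correct.
    - now apply (E1_correct (fun x => x * f x)). }
  pose proof (is_ImpInt_unique _ _ _ Z Z'). lra.
Qed.

(** Completing the square turns the integrand into the density translated by [c], times the constant
    [exp (c^2/2)]. *)
Lemma E1_exp c : E1 (fun x => exp (c * x)) = exp (c^2/2).
Proof.
  apply ImpInt_eq.
  assert (H : is_ImpInt (fun x => exp (c^2/2) * phi (1 * x + - c) + 0 * phi (1 * x + - c)) (exp (c^2/2) * (1/1) + 0 * (1/1))).
  { assert (cp : forall x, continuous (fun x => phi (1 * x + - c)) x).
    { intros x. apply (ex_derive_continuous (V := R_NormedModule)). unfold phi. auto_derive. easy. }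
    assert (ip : is_ImpInt (fun x => phi (1 * x + - c)) (1/1)).
    { apply is_ImpInt_comp_lin; [lra|apply phi_cont|].
      pose proof (E1_correct (fun _ => 1) (explip1_const 1)) as H. rewrite E1_const in H.
      replace phi with (fun x => phi x * 1); auto. apply functional_extensionality; intros; ring. }
    now apply is_ImpInt_linear. }
  replace (exp (c^2/2) * (1/1) + 0 * (1/1)) with (exp (c^2/2)) in H by field.
  replace (fun x => phi x * exp (c * x)) with (fun x => exp (c^2/2) * phi (1 * x + - c) + 0 * phi (1 * x + - c)); auto.
  apply functional_extensionality; intros x. unfold phi.
  rewrite Rmult_0_l, Rplus_0_r.
  replace (exp (c ^ 2 / 2) * (/ sqrt (2 * PI) * exp (- (1 * x + - c) ^ 2 / 2)))
    with (/ sqrt (2 * PI) * (exp (c ^ 2 / 2) * exp (- (1 * x + - c) ^ 2 / 2))) by ring.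
  rewrite Rmult_assoc, <- !exp_plus. f_equal. f_equal. field.
Qed.

(** Substitution [x -> s x]; the exponential is the ratio of the two densities. It grows when
    [s < 1], so membership of the product in the class is asked separately. *)
Lemma E1_scale s f : 0 < s -> explip1 f -> explip1 (fun x => f (s * x) * exp ((1 - s^2)/2 * x^2)) ->
  E1 f = s * E1 (fun x => f (s * x) * exp ((1 - s^2)/2 * x^2)).
Proof.
  intros Hs Hf Hg.
  assert (H := is_ImpInt_comp_lin _ _ s 0 Hs (fun x => phi_explip1_cont f x Hf) (E1_correct f Hf)).
  simpl in H.
  assert (K := E1_correct _ Hg).
  replace (fun x => phi (s * x + 0) * f (s * x + 0)) with
    (fun x => phi x * (f (s * x) * exp ((1 - s ^ 2) / 2 * x ^ 2))) in H.
  - pose proof (is_ImpInt_unique _ _ _ H K) as E. rewrite <- E. field. lra.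
  - apply functional_extensionality; intros x. rewrite Rplus_0_r. unfold phi.
    replace (/ sqrt (2 * PI) * exp (- x ^ 2 / 2) * (f (s * x) * exp ((1 - s ^ 2) / 2 * x ^ 2)))
      with (/ sqrt (2 * PI) * (exp (- x ^ 2 / 2) * exp ((1 - s ^ 2) / 2 * x ^ 2)) * f (s * x)) by ring.
    rewrite <- exp_plus. do 3 f_equal. field.
Qed.

(** * Iterated Gaussian means *)

(** The iterated integral of [Egauss] with the density handed out one factor per coordinate, so that
    every layer is a one-dimensional mean of total mass 1. *)
Fixpoint EG (n : nat) (F : (nat -> R) -> R) : R :=
  match n with
  | O => F (fun _ => 0)
  | S m => E1 (fun x => EG m (fun v => F (upd v m x)))
  end.

Lemma EG_S n F : EG (S n) F = E1 (fun x => EG n (fun v => F (upd v n x))).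
Proof. reflexivity. Qed.

(** These properties go through the induction together: linearity and monotonicity in [n]
    coordinates are what makes the inner mean regular in the next coordinate, and the
    one-dimensional lemmas need that regularity. *)
Definition EG_good (n : nat) : Prop :=
  (forall F G a b, explip n F -> explip n G -> EG n (fun v => a * F v + b * G v) = a * EG n F + b * EG n G) /\
  (forall F G, explip n F -> explip n G -> (forall v, F v <= G v) -> EG n F <= EG n G) /\
  (forall c, EG n (fun _ => c) = c).

Lemma EG_good_abs n F G K : EG_good n -> explip n F -> explip n G -> explip n K ->
  (forall v, Rabs (F v - G v) <= K v) -> Rabs (EG n F - EG n G) <= EG n K.
Proof.
  intros (L & M & C) HF HG HK H.
  assert (A : EG n F <= 1 * EG n G + 1 * EG n K).
  { rewrite <- L by auto. apply M; auto.
    - apply explip_plus; now apply explip_scal.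
    - intros v. specialize (H v). pose proof (Rle_abs (F v - G v)). lra. }
  assert (B : EG n G <= 1 * EG n F + 1 * EG n K).
  { rewrite <- L by auto. apply M; auto.
    - apply explip_plus; now apply explip_scal.
    - intros v. specialize (H v). pose proof (Rle_abs (- (F v - G v))). rewrite Rabs_Ropp in *. lra. }
  apply Rabs_le. lra.
Qed.

Lemma EG_good_explip1 n F : EG_good n -> explip (S n) F -> explip1 (fun x => EG n (fun v => F (upd v n x))).
Proof.
  intros HG HF. pose proof HF as (C & a & HC & Ha & H).
  (* Both points share the coordinates [v], so their weights multiply to [wt n (2 * a) v]; its mean
     enters as a constant that need not be computed. *)
  set (K := EG n (wt n (2 * a))).
  assert (HK : 0 <= K).
  { destruct HG as (L & M & Cc). rewrite <- (Cc 0). apply M; [apply explip_const|apply explip_wt; lra|].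
    intros; apply Rlt_le, wt_pos. }
  exists (C * K), a. split; [nra|split;[auto|]]. intros x y.
  set (c := C * (exp (a * Rabs x) * exp (a * Rabs y)) * Rabs (x - y)).
  replace (C * K * (exp (a * Rabs x) * exp (a * Rabs y)) * Rabs (x - y)) with (EG n (fun v => c * wt n (2*a) v + 0 * 0)).
  2:{ destruct HG as (L & M & Cc). rewrite L; [|apply explip_wt; lra|apply explip_const]. fold K. unfold c. ring. }
  apply EG_good_abs; auto; try now apply explip_freeze.
  { apply explip_plus; [apply explip_scal, explip_wt; lra|apply explip_const]. }
  intros v. eapply Rle_trans; [apply H|].
  rewrite !wt_upd, dist1_upd, dist1_refl. unfold c.
  replace (2 * a) with (a + a) by ring. rewrite wt_plus. right. ring.
Qed.

Lemma EG_is_good n : EG_good n.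
Proof.
  induction n as [|n IH].
  - split; [|split]; simpl; auto.
  - split; [|split]; simpl.
    + intros F G a b HF HG. rewrite <- E1_linear; try now apply EG_good_explip1.
      f_equal. apply functional_extensionality; intros x.
      destruct IH as (L & M & C). apply L; now apply explip_freeze.
    + intros F G HF HG H. apply E1_le; try now apply EG_good_explip1.
      intros x. destruct IH as (L & M & C). apply M; auto; now apply explip_freeze.
    + intros c. destruct IH as (L & M & C).
      replace (fun x : R => EG n (fun _ => c)) with (fun _ : R => c).
      * apply E1_const.
      * apply functional_extensionality; intros. now rewrite C.
Qed.

Lemma EG_linear n F G a b : explip n F -> explip n G ->
  EG n (fun v => a * F v + b * G v) = a * EG n F + b * EG n G.
Proof. destruct (EG_is_good n) as (L & M & C). apply L. Qed.

Lemma EG_le n F G : explip n F -> explip n G -> (forall v, F v <= G v) -> EG n F <= EG n G.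
Proof. destruct (EG_is_good n) as (L & M & C). apply M. Qed.

Lemma EG_const n c : EG n (fun _ => c) = c.
Proof. destruct (EG_is_good n) as (L & M & C). apply C. Qed.

Lemma EG_abs n F G K : explip n F -> explip n G -> explip n K ->
  (forall v, Rabs (F v - G v) <= K v) -> Rabs (EG n F - EG n G) <= EG n K.
Proof. apply EG_good_abs, EG_is_good. Qed.

Lemma EG_explip1 n F : explip (S n) F -> explip1 (fun x => EG n (fun v => F (upd v n x))).
Proof. apply EG_good_explip1, EG_is_good. Qed.

Lemma EG_scal n F c : explip n F -> EG n (fun v => c * F v) = c * EG n F.
Proof.
  intros H. replace (fun v => c * F v) with (fun v => c * F v + 0 * F v)
    by (apply functional_extensionality; intros; ring).
  rewrite EG_linear; auto. ring.
Qed.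

Lemma EG_plus n F G : explip n F -> explip n G -> EG n (fun v => F v + G v) = EG n F + EG n G.
Proof.
  intros HF HG. replace (fun v => F v + G v) with (fun v => 1 * F v + 1 * G v)
    by (apply functional_extensionality; intros; ring).
  rewrite EG_linear; auto. ring.
Qed.

Lemma EG_minus n F G : explip n F -> explip n G -> EG n (fun v => F v - G v) = EG n F - EG n G.
Proof.
  intros HF HG. replace (fun v => F v - G v) with (fun v => 1 * F v + (-1) * G v)
    by (apply functional_extensionality; intros; ring).
  rewrite EG_linear; auto. ring.
Qed.

Lemma EG_sum n K (F : nat -> (nat -> R) -> R) : (forall i, (i < K)%nat -> explip n (F i)) ->
  EG n (fun v => sumR K (fun i => F i v)) = sumR K (fun i => EG n (F i)).
Proof.
  induction K; intros H; simpl; [apply EG_const|].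
  rewrite EG_plus; auto.
  - rewrite IHK; auto.
  - apply explip_sum; auto.
Qed.

Lemma EG_nonneg n F : explip n F -> (forall v, 0 <= F v) -> 0 <= EG n F.
Proof. intros H K. rewrite <- (EG_const n 0). apply EG_le; auto. apply explip_const. Qed.

Lemma gdens_upd m v x : gdens (S m) (upd v m x) = phi x * gdens m v.
Proof.
  unfold gdens, phi.
  rewrite sumR_S.
  rewrite (sumR_ext m (fun i => upd v m x i ^ 2) (fun i => v i ^ 2)).
  2:{ intros i Hi. unfold upd. destruct (Nat.eq_dec i m); [lia|auto]. }
  replace (upd v m x m) with x by (unfold upd; destruct (Nat.eq_dec m m); [auto|lia]).
  set (S := sumR m (fun i => v i ^ 2)).
  replace (- (S + x ^ 2) / 2) with (- x ^ 2 / 2 + - S / 2) by field.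
  rewrite exp_plus. simpl ((sqrt (2 * PI)) ^ _). rewrite Rinv_mult. ring.
Qed.

Lemma Egauss_EG n : forall F, explip n F -> Egauss n F = EG n F.
Proof.
  induction n as [|n IH]; intros F HF.
  - unfold Egauss; simpl. unfold gdens; simpl.
    replace (- 0 / 2) with 0 by field. rewrite exp_0, Rinv_1. ring.
  - unfold Egauss; simpl. unfold E1. f_equal.
    apply functional_extensionality; intros x.
    rewrite <- EG_scal by now apply explip_freeze.
    rewrite <- IH by now apply explip_scal, explip_freeze.
    unfold Egauss. f_equal. apply functional_extensionality; intros v.
    rewrite gdens_upd. ring.
Qed.

(** * Calculus under iterated Gaussian means: derivatives, integration by parts, dilations *)

Lemma upd_same v k t : upd v k t k = t.
Proof. unfold upd. destruct (Nat.eq_dec k k); [auto|lia]. Qed.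

Lemma upd_other v k t i : i <> k -> upd v k t i = v i.
Proof. intros H. unfold upd. destruct (Nat.eq_dec i k); [lia|auto]. Qed.

Lemma upd_upd v k s t : upd (upd v k s) k t = upd v k t.
Proof. apply functional_extensionality; intros i. unfold upd. destruct (Nat.eq_dec i k); auto. Qed.

Lemma upd_id v k : upd v k (v k) = v.
Proof. apply functional_extensionality; intros i. unfold upd. destruct (Nat.eq_dec i k); subst; auto. Qed.

Lemma upd_comm v k l s t : k <> l -> upd (upd v k s) l t = upd (upd v l t) k s.
Proof.
  intros H. apply functional_extensionality; intros i. unfold upd.
  destruct (Nat.eq_dec i k), (Nat.eq_dec i l); auto; lia.
Qed.

Definition pderiv (k : nat) (F F' : (nat -> R) -> R) : Prop :=
  forall y, is_derive (fun s => F (upd y k s)) (y k) (F' y).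

Lemma pderiv_at k F F' y t : pderiv k F F' -> is_derive (fun s => F (upd y k s)) t (F' (upd y k t)).
Proof.
  intros H. specialize (H (upd y k t)). rewrite upd_same in H.
  eapply is_derive_ext; [|exact H]. intros s. simpl. now rewrite upd_upd.
Qed.

Lemma is_derive_quadratic (f : R -> R) x l K :
  (forall h, Rabs h <= 1 -> Rabs (f (x + h) - f x - h * l) <= K * h^2) -> is_derive f x l.
Proof.
  intros H. apply is_derive_Reals. intros eps He.
  assert (HK : 0 < Rabs K + 1) by (pose proof (Rabs_pos K); lra).
  assert (Hd : 0 < Rmin 1 (eps / (Rabs K + 1))).
  { apply Rmin_case; [lra|]. now apply Rdiv_lt_0_compat. }
  exists (mkposreal _ Hd). intros h Hh Hlt. simpl in Hlt.
  pose proof (Rmin_l 1 (eps / (Rabs K + 1))). pose proof (Rmin_r 1 (eps / (Rabs K + 1))).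
  specialize (H h ltac:(lra)).
  replace ((f (x + h) - f x) / h - l) with ((f (x + h) - f x - h * l) * / h) by (field; auto).
  rewrite Rabs_mult, Rabs_inv. pose proof (Rabs_pos_lt h Hh).
  apply (Rmult_lt_reg_r (Rabs h)); auto. rewrite Rmult_assoc, Rinv_l by lra. rewrite Rmult_1_r.
  eapply Rle_lt_trans; [apply H|].
  rewrite <- (pow2_abs h). pose proof (Rle_abs K).
  assert ((Rabs K + 1) * Rabs h < eps).
  { replace eps with ((Rabs K + 1) * (eps / (Rabs K + 1))) by (field; lra).
    apply Rmult_lt_compat_l; lra. }
  assert (K * Rabs h ^ 2 <= (Rabs K + 1) * Rabs h * Rabs h) by (simpl; nra). nra.
Qed.

(** Differentiation under the mean without dominated convergence: the weighted Lipschitz bound on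
    [F'] makes the Taylor remainder at most [h^2] times a weight, and the mean of that weight is the
    constant required by [is_derive_quadratic]. *)
Lemma EG_derive n F F' t : explip (S n) F -> explip (S n) F' -> pderiv n F F' ->
  is_derive (fun s => EG n (fun v => F (upd v n s))) t (EG n (fun v => F' (upd v n t))).
Proof.
  intros HF HF' HD. pose proof HF' as (C & a & HC & Ha & H).
  (* Increments have size at most 1, so [Rabs t + 1] bounds every intermediate point. *)
  set (c := C * (exp (a * Rabs t) * exp (a * (Rabs t + 1)))).
  apply is_derive_quadratic with (K := EG n (fun v => c * wt n (2*a) v)).
  intros h Hh.
  rewrite <- EG_scal by now apply explip_freeze.
  rewrite <- (EG_minus n (fun v => F (upd v n (t+h)))) by now apply explip_freeze.
  assert (Hw : explip n (fun v => c * wt n (2*a) v)) by (apply explip_scal, explip_wt; lra).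
  replace (EG n (fun v => c * wt n (2*a) v) * h^2) with (EG n (fun v => h^2 * (c * wt n (2*a) v)))
    by (rewrite EG_scal; auto; ring).
  apply EG_abs.
  - apply explip_minus; now apply explip_freeze.
  - apply explip_scal; now apply explip_freeze.
  - now apply explip_scal.
  - intros v.
    destruct (MVT_gen (fun s => F (upd v n s)) t (t + h) (fun s => F' (upd v n s))) as [s [Hs Hs']].
    { intros; now apply pderiv_at. }
    { intros s _. apply derivable_continuous_pt. exists (F' (upd v n s)). apply is_derive_Reals. now apply pderiv_at. }
    rewrite Hs'.
    replace (F' (upd v n s) * (t + h - t) - h * F' (upd v n t)) with (h * (F' (upd v n s) - F' (upd v n t))) by ring.
    rewrite Rabs_mult.
    assert (Hst : Rabs (s - t) <= Rabs h).
    { unfold Rmin, Rmax in Hs. destruct (Rle_dec t (t + h)).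
      - rewrite (Rabs_right h) by lra. apply Rabs_le. lra.
      - rewrite (Rabs_left h) by lra. apply Rabs_le. lra. }
    assert (Hsa : Rabs s <= Rabs t + 1).
    { replace s with ((s - t) + t) by ring. eapply Rle_trans; [apply Rabs_triang|]. lra. }
    specialize (H (upd v n s) (upd v n t)).
    rewrite !wt_upd, dist1_upd, dist1_refl, Rplus_0_l in H.
    assert (He : exp (a * Rabs s) <= exp (a * (Rabs t + 1))) by (apply exp_le; nra).
    rewrite <- (pow2_abs h). pose proof (Rabs_pos h).
    assert (Rabs (F' (upd v n s) - F' (upd v n t)) <= Rabs h * (c * wt n (2*a) v)).
    { eapply Rle_trans; [apply H|]. unfold c.
      replace (2 * a) with (a + a) by ring. rewrite wt_plus.
      pose proof (wt_pos n a v). pose proof (exp_pos (a * Rabs t)). pose proof (exp_pos (a * Rabs s)).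
      pose proof (Rabs_pos (s - t)).
      replace (C * (wt n a v * exp (a * Rabs s) * (wt n a v * exp (a * Rabs t))) * Rabs (s - t))
        with ((C * (wt n a v * wt n a v * exp (a * Rabs t))) * (exp (a * Rabs s) * Rabs (s - t))) by ring.
      replace (Rabs h * (C * (exp (a * Rabs t) * exp (a * (Rabs t + 1))) * (wt n a v * wt n a v)))
        with ((C * (wt n a v * wt n a v * exp (a * Rabs t))) * (exp (a * (Rabs t + 1)) * Rabs h)) by ring.
      apply Rmult_le_compat_l; [apply Rmult_le_pos; [auto|repeat apply Rmult_le_pos; lra]|].
      apply Rmult_le_compat; lra. }
    simpl. nra.
Qed.

Lemma EG_ibp n : forall k F F', (k < n)%nat -> explip n F -> explip n F' -> pderiv k F F' ->
  EG n (fun v => v k * F v) = EG n F'.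
Proof.
  induction n as [|n IH]; intros k F F' Hk HF HF' HD; [lia|].
  simpl. destruct (Nat.eq_dec k n) as [->|Hne].
  - transitivity (E1 (fun x => x * EG n (fun v => F (upd v n x)))).
    + f_equal. apply functional_extensionality; intros x.
      rewrite <- EG_scal by now apply explip_freeze.
      f_equal. apply functional_extensionality; intros v. now rewrite upd_same.
    + apply E1_ibp; try now apply EG_explip1. intros x. now apply EG_derive.
  - f_equal. apply functional_extensionality; intros x.
    rewrite <- (IH k (fun v => F (upd v n x)) (fun v => F' (upd v n x))); [|lia|now apply explip_freeze|now apply explip_freeze|].
    + f_equal. apply functional_extensionality; intros v. now rewrite upd_other.
    + intros y. specialize (HD (upd y n x)). rewrite upd_other in HD by auto.
      eapply is_derive_ext; [|exact HD]. intros s. simpl. rewrite upd_comm; auto.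
Qed.

(** Membership in the class with [n] coordinates forces [F] to ignore all later ones, since
    [dist1 n] does not see them. This places functions of [J] on the joint space of [J] and the
    linear field. *)
Lemma EG_extend n m F : explip n F -> EG (n + m) F = EG n F.
Proof.
  intros HF. induction m; [now rewrite Nat.add_0_r|].
  rewrite Nat.add_succ_r. simpl. rewrite <- (E1_const (EG n F)). f_equal.
  apply functional_extensionality; intros x. rewrite <- IHm. f_equal.
  apply functional_extensionality; intros v.
  destruct HF as (C & a & HC & Ha & H). specialize (H (upd v (n+m) x) v).
  replace (dist1 n (upd v (n+m) x) v) with 0 in H.
  - rewrite Rmult_0_r in H. apply cond_eq. intros eps He. lra.
  - symmetry. rewrite <- (dist1_refl n v). apply sumR_ext. intros i Hi. rewrite upd_other by lia. auto.
Qed.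

Lemma EG_sq n k : (k < n)%nat -> EG n (fun v => v k ^ 2) = 1.
Proof.
  intros Hk. transitivity (EG n (fun v => v k * v k)).
  - f_equal. apply functional_extensionality; intros; ring.
  - rewrite (EG_ibp n k (fun v => v k) (fun _ => 1)); auto.
    + apply EG_const.
    + now apply explip_coord.
    + apply explip_const.
    + intros y. apply is_derive_ext with (fun s => s); [intros; now rewrite upd_same|].
      apply (is_derive_id (K := R_AbsRing)).
Qed.

Lemma explip_linear n b : explip n (fun v => sumR n (fun i => b i * v i)).
Proof. apply explip_sum. intros. apply explip_scal. now apply explip_coord. Qed.

Lemma linear_bound n (b : nat -> R) B : 0 <= B -> (forall i, (i < n)%nat -> Rabs (b i) <= B) ->
  forall v, sumR n (fun i => b i * v i) <= B * norm1 n v.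
Proof.
  intros HB Hb v. unfold norm1. rewrite <- sumR_scal. apply sumR_le. intros i Hi.
  eapply Rle_trans; [apply Rle_abs|]. rewrite Rabs_mult. apply Rmult_le_compat_r; [apply Rabs_pos|auto].
Qed.

Lemma explip_exp_linear n b : explip n (fun v => exp (sumR n (fun i => b i * v i))).
Proof.
  apply (explip_exp n _ 0 (norm1 n b)); [lra|apply norm1_pos| |apply explip_linear].
  intros x. rewrite Rplus_0_l. apply linear_bound; [apply norm1_pos|]. intros; now apply norm1_coord.
Qed.

Lemma EG_exp_linear n : forall b, EG n (fun v => exp (sumR n (fun i => b i * v i))) = exp (sumR n (fun i => b i ^ 2) / 2).
Proof.
  induction n as [|n IH]; intros b.
  - simpl. f_equal. field.
  - rewrite EG_S, sumR_S.
    transitivity (E1 (fun x => exp (sumR n (fun i => b i ^ 2) / 2) * exp (b n * x))).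
    + f_equal. apply functional_extensionality; intros x. rewrite <- IH.
      rewrite Rmult_comm, <- EG_scal by apply explip_exp_linear. f_equal.
      apply functional_extensionality; intros v. rewrite <- exp_plus. f_equal.
      rewrite sumR_S, upd_same, Rplus_comm. f_equal. apply sumR_ext. intros i Hi. rewrite upd_other by lia. auto.
    + rewrite E1_scal by apply explip1_expl. rewrite E1_exp, <- exp_plus. f_equal. field.
Qed.

Lemma EG_scale s n : 0 < s -> forall F, explip n F ->
  explip n (fun v => F (fun i => s * v i) * exp ((1 - s^2)/2 * sumR n (fun i => v i ^ 2))) ->
  EG n F = s ^ n * EG n (fun v => F (fun i => s * v i) * exp ((1 - s^2)/2 * sumR n (fun i => v i ^ 2))).
Proof.
  intros Hs. induction n as [|n IH]; intros F HF HG.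
  - simpl. rewrite !Rmult_0_r, exp_0, Rmult_1_r, Rmult_1_l. reflexivity.
  - set (G := fun v => F (fun i => s * v i) * exp ((1 - s^2)/2 * sumR (S n) (fun i => v i ^ 2))) in *.
    rewrite !EG_S.
    assert (Hup : forall v x, (fun i => s * upd v n x i) = upd (fun i => s * v i) n (s * x)).
    { intros v x. apply functional_extensionality; intros i. unfold upd. destruct (Nat.eq_dec i n); auto. }
    assert (HGu : forall v x, G (upd v n x) = exp ((1 - s^2)/2 * x^2) *
      (F (upd (fun i => s * v i) n (s * x)) * exp ((1 - s^2)/2 * sumR n (fun i => v i ^ 2)))).
    { intros v x. unfold G. rewrite Hup, sumR_S, upd_same, Rmult_plus_distr_l, exp_plus.
      rewrite (sumR_ext n (fun i => upd v n x i ^ 2) (fun i => v i ^ 2)).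
      - ring.
      - intros i Hi. rewrite upd_other by lia. auto. }
    (* Obtained from the hypothesis on [G] by freezing the last coordinate and dividing by the
       positive constant which that coordinate contributes. *)
    assert (Hin : forall x, explip n (fun v => F (upd (fun i => s * v i) n (s * x)) * exp ((1 - s^2)/2 * sumR n (fun i => v i ^ 2)))).
    { intros x. apply (explip_freeze n G x) in HG.
      apply (explip_scal n (/ exp ((1 - s^2)/2 * x^2))) in HG.
      replace (fun v => F (upd (fun i => s * v i) n (s * x)) * exp ((1 - s^2)/2 * sumR n (fun i => v i ^ 2)))
        with (fun v => / exp ((1 - s ^ 2) / 2 * x ^ 2) * G (upd v n x)); auto.
      apply functional_extensionality; intros v. rewrite HGu.
      pose proof (exp_pos ((1 - s ^ 2) / 2 * x ^ 2)). field. lra. }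
    assert (Key : forall x, s ^ n * EG n (fun v => G (upd v n x)) =
       EG n (fun v => F (upd v n (s * x))) * exp ((1 - s^2)/2 * x^2)).
    { intros x. rewrite (IH (fun v => F (upd v n (s * x)))); [|now apply explip_freeze|apply Hin].
      rewrite Rmult_assoc. f_equal. rewrite Rmult_comm, <- EG_scal by apply Hin.
      f_equal. apply functional_extensionality; intros v. apply HGu. }
    rewrite (E1_scale s).
    + replace (fun x => EG n (fun v => F (upd v n (s * x))) * exp ((1 - s ^ 2) / 2 * x ^ 2))
        with (fun x => s ^ n * EG n (fun v => G (upd v n x))).
      * rewrite E1_scal by now apply EG_explip1. rewrite <- tech_pow_Rmult. ring.
      * apply functional_extensionality; intros x. apply Key.
    + exact Hs.
    + now apply EG_explip1.
    + replace (fun x => EG n (fun v => F (upd v n (s * x))) * exp ((1 - s ^ 2) / 2 * x ^ 2))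
        with (fun x => s ^ n * EG n (fun v => G (upd v n x))).
      * apply explip1_scal. now apply EG_explip1.
      * apply functional_extensionality; intros x. apply Key.
Qed.

(** * Gaussian interpolation for finite sums *)

Lemma is_derive_sumR K (f : nat -> R -> R) (df : nat -> R) x :
  (forall a, (a < K)%nat -> is_derive (f a) x (df a)) ->
  is_derive (fun s => sumR K (fun a => f a s)) x (sumR K df).
Proof.
  induction K; intros H; simpl.
  - apply (is_derive_const (K := R_AbsRing) (V := R_NormedModule)).
  - apply (is_derive_plus (V := R_NormedModule) (fun s => sumR K (fun a => f a s)) (f K)); auto.
Qed.

Lemma nonpos_derive_le (f df : R -> R) a b : a <= b ->
  (forall x, is_derive f x (df x)) -> (forall x, a <= x <= b -> df x <= 0) -> f b <= f a.
Proof.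
  intros Hab Hd Hn.
  destruct (MVT_gen f a b df) as [c [Hc Hc']].
  - intros; apply Hd.
  - intros x _. apply derivable_continuous_pt. exists (df x). apply is_derive_Reals, Hd.
  - rewrite Rmin_left, Rmax_right in Hc by auto. specialize (Hn c Hc). nra.
Qed.

Section Interpolation.

Variables (M P K : nat) (A : nat -> nat -> R) (W : nat -> R) (a0 : nat).
Hypothesis W_nonneg : forall a, (a < K)%nat -> 0 <= W a.
Hypothesis Ha0 : (a0 < K)%nat.
Hypothesis Wa0 : 0 < W a0.

(* Coordinates [k < P] are switched on by [sin], the others switched off by [cos];
   the interpolation parameter is the extra coordinate [y M]. *)
Definition tr (k : nat) (t : R) : R := if (k <? P)%nat then sin t else cos t.
Definition dtr (k : nat) (t : R) : R := if (k <? P)%nat then cos t else - sin t.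

(** A Gaussian field at node [a] minus half its variance, so that [exp (Hf a)] has mean 1 at every
    time. *)
Definition Hf (a : nat) (y : nat -> R) : R :=
  sumR M (fun k => A a k * tr k (y M) * y k) - / 2 * sumR M (fun k => (A a k * tr k (y M)) ^ 2).
Definition dHf (a : nat) (y : nat -> R) : R :=
  sumR M (fun k => dtr k (y M) * y k * A a k) - sumR M (fun k => tr k (y M) * dtr k (y M) * A a k ^ 2).
(** Unnormalised Gibbs sum; [Zf] is the partition function and [Gb] the Gibbs average for the node
    weights [W a * exp (Hf a y)]. *)
Definition num (f : nat -> (nat -> R) -> R) (y : nat -> R) : R :=
  sumR K (fun a => f a y * (W a * exp (Hf a y))).
Definition Zf (y : nat -> R) : R := num (fun _ _ => 1) y.
Definition Gb (f : nat -> (nat -> R) -> R) (y : nat -> R) : R := num f y * / Zf y.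

Lemma tr_bound k t : Rabs (tr k t) <= 1.
Proof.
  unfold tr. pose proof (SIN_bound t). pose proof (COS_bound t).
  destruct (k <? P)%nat; apply Rabs_le; lra.
Qed.

Lemma is_derive_tr k t : is_derive (tr k) t (dtr k t).
Proof.
  unfold tr, dtr. destruct (k <? P)%nat; auto_derive; auto; ring.
Qed.

Lemma lip_of_derive (f df : R -> R) : (forall x, is_derive f x (df x)) -> (forall x, Rabs (df x) <= 1) ->
  forall s t, Rabs (f s - f t) <= 1 * Rabs (s - t).
Proof.
  intros Hd Hb s t.
  destruct (MVT_gen f t s df) as [c [Hc Hc']].
  - intros; apply Hd.
  - intros x _. apply derivable_continuous_pt. exists (df x). apply is_derive_Reals, Hd.
  - rewrite Hc', Rabs_mult. apply Rmult_le_compat_r; [apply Rabs_pos|auto].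
Qed.

Lemma dtr_bound k t : Rabs (dtr k t) <= 1.
Proof.
  unfold dtr. pose proof (SIN_bound t). pose proof (COS_bound t).
  destruct (k <? P)%nat; apply Rabs_le; lra.
Qed.

Lemma explip_tr k : explip (S M) (fun y => tr k (y M)).
Proof.
  apply (explip_lip (S M) (fun y => y M) (tr k) 1); [lra| |apply explip_coord; lia].
  apply lip_of_derive with (dtr k); [apply is_derive_tr|apply dtr_bound].
Qed.

Lemma explip_dtr k : explip (S M) (fun y => dtr k (y M)).
Proof.
  apply (explip_lip (S M) (fun y => y M) (dtr k) 1); [lra| |apply explip_coord; lia].
  apply lip_of_derive with (fun t => - tr k t); [|intros; rewrite Rabs_Ropp; apply tr_bound].
  intros t. unfold tr, dtr. destruct (k <? P)%nat; auto_derive; auto; ring.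
Qed.

Lemma explip_pow2 n F : explip n F -> explip n (fun y => F y ^ 2).
Proof.
  intros H. replace (fun y => F y ^ 2) with (fun y => F y * F y)
    by (apply functional_extensionality; intros; ring). now apply explip_mult.
Qed.

Lemma explip_Hf a : explip (S M) (Hf a).
Proof.
  apply explip_minus.
  - apply explip_sum. intros k Hk. apply explip_mult; [apply explip_scal, explip_tr|apply explip_coord; lia].
  - apply explip_scal, explip_sum. intros k Hk. apply explip_pow2, explip_scal, explip_tr.
Qed.

Lemma explip_dHf a : explip (S M) (dHf a).
Proof.
  apply explip_minus; apply explip_sum; intros k Hk.
  - apply explip_mult; [|apply explip_const]. apply explip_mult; [apply explip_dtr|apply explip_coord; lia].
  - apply explip_mult; [|apply explip_const]. apply explip_mult; [apply explip_tr|apply explip_dtr].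
Qed.

Lemma Hf_lin_bound a y : Rabs (sumR M (fun k => A a k * tr k (y M) * y k)) <= norm1 M (A a) * norm1 (S M) y.
Proof.
  eapply Rle_trans; [apply Rabs_sumR|].
  apply Rle_trans with (norm1 M (A a) * norm1 M y).
  - unfold norm1 at 2. rewrite <- sumR_scal. apply sumR_le. intros k Hk. rewrite !Rabs_mult.
    apply Rmult_le_compat_r; [apply Rabs_pos|].
    apply Rle_trans with (Rabs (A a k) * 1).
    + apply Rmult_le_compat_l; [apply Rabs_pos|apply tr_bound].
    + rewrite Rmult_1_r. now apply norm1_coord.
  - apply Rmult_le_compat_l; [apply norm1_pos|]. apply norm1_mono. lia.
Qed.

Lemma explip_expHf a : explip (S M) (fun y => exp (Hf a y)).
Proof.
  apply (explip_exp (S M) _ 0 (norm1 M (A a))); [lra|apply norm1_pos| |apply explip_Hf].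
  intros y. pose proof (Hf_lin_bound a y). unfold Hf.
  pose proof (Rle_abs (sumR M (fun k => A a k * tr k (y M) * y k))).
  pose proof (sumR_nonneg M (fun k => (A a k * tr k (y M)) ^ 2) ltac:(intros; apply pow2_ge_0)). lra.
Qed.

Lemma explip_num f : (forall a, (a < K)%nat -> explip (S M) (f a)) -> explip (S M) (num f).
Proof.
  intros H. apply explip_sum. intros a Ha. apply explip_mult; auto. apply explip_scal, explip_expHf.
Qed.

(** One node of positive weight suffices, and [|tr| <= 1] makes the bound uniform in time; this
    gives access to [1 / Zf] and [ln Zf] in the class. *)
Lemma Zf_lower : exists c b, 0 < c /\ 0 <= b /\ forall y, c * wt (S M) (- b) y <= Zf y.
Proof.
  exists (W a0 * exp (- (/ 2 * sumR M (fun k => A a0 k ^ 2)))), (norm1 M (A a0)).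
  pose proof (exp_pos (- (/ 2 * sumR M (fun k => A a0 k ^ 2)))).
  split; [nra|split; [apply norm1_pos|]]. intros y.
  apply Rle_trans with (W a0 * exp (Hf a0 y)).
  - rewrite Rmult_assoc. apply Rmult_le_compat_l; [lra|]. unfold wt. rewrite <- exp_plus.
    apply exp_le. unfold Hf.
    pose proof (Hf_lin_bound a0 y) as Hb. apply Rabs_le_between in Hb.
    assert (sumR M (fun k => (A a0 k * tr k (y M)) ^ 2) <= sumR M (fun k => A a0 k ^ 2)).
    { apply sumR_le. intros k Hk. pose proof (tr_bound k (y M)) as Ht.
      assert (tr k (y M) ^ 2 <= 1) by (rewrite <- pow2_abs; pose proof (Rabs_pos (tr k (y M))); nra).
      rewrite Rpow_mult_distr. pose proof (pow2_ge_0 (A a0 k)). nra. }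
    lra.
  - unfold Zf, num.
    replace (W a0 * exp (Hf a0 y)) with (1 * (W a0 * exp (Hf a0 y))) by ring.
    apply (sumR_term_le K (fun a => 1 * (W a * exp (Hf a y))) a0); auto.
    intros i Hi. rewrite Rmult_1_l. apply Rmult_le_pos; auto. apply Rlt_le, exp_pos.
Qed.

Lemma Zf_pos y : 0 < Zf y.
Proof.
  destruct Zf_lower as (c & b & Hc & Hb & H). specialize (H y). pose proof (wt_pos (S M) (-b) y). nra.
Qed.

Lemma explip_Zf : explip (S M) Zf.
Proof. apply explip_num. intros; apply explip_const. Qed.

Lemma explip_Gb f : (forall a, (a < K)%nat -> explip (S M) (f a)) -> explip (S M) (Gb f).
Proof.
  intros H. apply explip_mult; [now apply explip_num|].
  destruct Zf_lower as (c & b & Hc & Hb & HZ). apply (explip_inv (S M) Zf c b); auto. apply explip_Zf.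
Qed.

Lemma explip_lnZf : explip (S M) (fun y => ln (Zf y)).
Proof.
  destruct Zf_lower as (c & b & Hc & Hb & HZ). apply (explip_ln (S M) Zf c b); auto. apply explip_Zf.
Qed.

Lemma pderiv_Hf k a : (k < M)%nat -> pderiv k (Hf a) (fun y => A a k * tr k (y M)).
Proof.
  intros Hk y. unfold Hf.
  assert (D : is_derive (fun s => sumR M (fun j => A a j * tr j (y M) * upd y k s j)) (y k)
              (sumR M (fun j => A a j * tr j (y M) * (if Nat.eq_dec j k then 1 else 0)))).
  { apply is_derive_sumR. intros j Hj. unfold upd. destruct (Nat.eq_dec j k).
    - auto_derive; auto.
    - auto_derive; auto. ring. }
  assert (E : sumR M (fun j => A a j * tr j (y M) * (if Nat.eq_dec j k then 1 else 0)) = A a k * tr k (y M)).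
  { clear D. revert Hk. generalize (y M) as t. intros t. induction M as [|m IH]; intros Hk; [lia|].
    rewrite sumR_S. destruct (Nat.eq_dec m k) as [->|Hne].
    - rewrite (sumR_ext k _ (fun _ => 0)); [rewrite sumR_const; ring|].
      intros i Hi. destruct (Nat.eq_dec i k); [lia|ring].
    - rewrite IH by lia. ring. }
  rewrite E in D.
  apply is_derive_ext with (fun s => sumR M (fun j => A a j * tr j (y M) * upd y k s j)
     + (- (/ 2 * sumR M (fun k => (A a k * tr k (y M)) ^ 2)))).
  - intros s. rewrite upd_other by lia. toR. ring.
  - replace (A a k * tr k (y M)) with (A a k * tr k (y M) + 0) by ring.
    apply (is_derive_plus (V := R_NormedModule)); [exact D|].
    apply (is_derive_const (K := R_AbsRing) (V := R_NormedModule)).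
Qed.

Lemma pderiv_Hf_param a : pderiv M (Hf a) (dHf a).
Proof.
  intros y. unfold Hf, dHf.
  apply is_derive_ext with (fun s => sumR M (fun k => A a k * tr k s * y k - / 2 * (A a k * tr k s) ^ 2)).
  { intros s. rewrite upd_same, sumR_minus, sumR_scal. toR. f_equal.
    - apply sumR_ext. intros i Hi. rewrite upd_other by lia. auto. }
  rewrite <- sumR_minus. apply (is_derive_sumR M (fun k s => A a k * tr k s * y k - / 2 * (A a k * tr k s) ^ 2)).
  intros k Hk. pose proof (is_derive_tr k (y M)) as D.
  auto_derive; [split; [eexists; exact D|split; [eexists; exact D|auto]]|].
  replace (Derive (fun x => tr k x) (y M)) with (dtr k (y M)) by (symmetry; now apply is_derive_unique).
  field.
Qed.

Lemma pderiv_num k f f' h : (forall a, (a < K)%nat -> pderiv k (f a) (f' a)) ->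
  (forall a, (a < K)%nat -> pderiv k (Hf a) (h a)) ->
  pderiv k (num f) (num (fun a y => f' a y + f a y * h a y)).
Proof.
  intros Hd H y. unfold num.
  apply (is_derive_sumR K (fun a s => f a (upd y k s) * (W a * exp (Hf a (upd y k s))))).
  intros a Ha. specialize (Hd a Ha y). specialize (H a Ha y).
  pose proof (is_derive_mult (K := R_AbsRing) (fun s => f a (upd y k s)) (fun s => W a * exp (Hf a (upd y k s))) (y k)
     (f' a y) (W a * (h a y * exp (Hf a (upd y k (y k)))))) as D.
  cbv beta in D. rewrite upd_id in D.
  replace ((f' a y + f a y * h a y) * (W a * exp (Hf a y)))
    with (f' a y * (W a * exp (Hf a y)) + f a y * (W a * (h a y * exp (Hf a y)))) by ring.
  apply D; [exact Hd| |intros; apply Rmult_comm].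
  apply (is_derive_scal (fun s => exp (Hf a (upd y k s)))).
  pose proof (is_derive_comp (K := R_AbsRing) (V := R_NormedModule) exp (fun s => Hf a (upd y k s)) (y k)
     (exp (Hf a (upd y k (y k)))) (h a y)) as D2. rewrite upd_id in D2.
  apply D2; [|exact H]. apply is_derive_Reals. rewrite upd_id. apply derivable_pt_lim_exp.
Qed.

Lemma pderiv_const k c : pderiv k (fun _ => c) (fun _ => 0).
Proof. intros y. apply (is_derive_const (K := R_AbsRing) (V := R_NormedModule)). Qed.

Lemma pderiv_Zf k h : (forall a, (a < K)%nat -> pderiv k (Hf a) (h a)) -> pderiv k Zf (num h).
Proof.
  intros H y. pose proof (pderiv_num k (fun _ _ => 1) (fun _ _ => 0) h (fun a _ => pderiv_const k 1) H y) as D.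
  replace (num h y) with (num (fun a y => 0 + 1 * h a y) y); [exact D|].
  apply sumR_ext. intros; ring.
Qed.

Lemma pderiv_lnZf k h : (forall a, (a < K)%nat -> pderiv k (Hf a) (h a)) ->
  pderiv k (fun y => ln (Zf y)) (Gb h).
Proof.
  intros H y. pose proof (pderiv_Zf k h H y) as D.
  pose proof (is_derive_comp (K := R_AbsRing) (V := R_NormedModule) ln (fun s => Zf (upd y k s)) (y k)
     (/ Zf (upd y k (y k))) (num h y)) as D2. rewrite upd_id in D2.
  apply D2; [|exact D]. apply is_derive_Reals. rewrite upd_id. apply derivable_pt_lim_ln, Zf_pos.
Qed.

(** The derivative of a Gibbs average is the Gibbs covariance with the derivative of the
    exponent. *)
Lemma pderiv_Gb_const k f h : (forall a, (a < K)%nat -> pderiv k (Hf a) (h a)) ->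
  pderiv k (Gb (fun a _ => f a)) (fun y => Gb (fun a y => f a * h a y) y - Gb (fun a _ => f a) y * Gb h y).
Proof.
  intros H y.
  pose proof (pderiv_num k (fun a _ => f a) (fun _ _ => 0) h (fun a _ => pderiv_const k (f a)) H y) as D1.
  pose proof (pderiv_Zf k h H y) as D2.
  unfold Gb.
  pose proof (is_derive_inv (fun s => Zf (upd y k s)) (y k) _ D2) as D3.
  cbv beta in D3. rewrite upd_id in D3. specialize (D3 ltac:(pose proof (Zf_pos y); lra)).
  pose proof (is_derive_mult (K := R_AbsRing) _ _ _ _ _ D1 D3 Rmult_comm) as D. cbv beta in D.
  rewrite upd_id in D.
  replace (num (fun a y => 0 + f a * h a y) y) with (num (fun a y => f a * h a y) y) in D
    by (apply sumR_ext; intros; ring).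
  match goal with |- is_derive _ _ ?l => match type of D with is_derive _ _ ?l' => replace l with l'; [exact D|] end end.
  unfold plus, mult; simpl. field. pose proof (Zf_pos y). lra.
Qed.

Lemma Gb_scal c f y : Gb (fun a y => c y * f a y) y = c y * Gb f y.
Proof.
  unfold Gb, num. rewrite <- Rmult_assoc, <- sumR_scal. f_equal. apply sumR_ext; intros; ring.
Qed.

Lemma Gb_dHf y : Gb dHf y =
  sumR M (fun k => dtr k (y M) * (y k * Gb (fun a _ => A a k) y)) -
  sumR M (fun k => tr k (y M) * dtr k (y M) * Gb (fun a _ => A a k ^ 2) y).
Proof.
  unfold Gb, num, dHf.
  rewrite <- sumR_minus.
  rewrite (sumR_ext M _ (fun k => sumR K (fun a =>
     (dtr k (y M) * y k * A a k - tr k (y M) * dtr k (y M) * A a k ^ 2) * (W a * exp (Hf a y)) * / Zf y))).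
  - rewrite sumR_swap, <- sumR_scal_r. apply sumR_ext. intros a Ha.
    rewrite sumR_scal_r, sumR_scal_r, sumR_minus. reflexivity.
  - intros k Hk. rewrite sumR_scal_r.
    rewrite (sumR_ext K (fun a => (_ - _) * _) (fun a =>
       (dtr k (y M) * y k) * (A a k * (W a * exp (Hf a y)))
       - (tr k (y M) * dtr k (y M)) * (A a k ^ 2 * (W a * exp (Hf a y))))) by (intros; ring).
    rewrite sumR_minus, !sumR_scal. ring.
Qed.

(** Sign with which the squared Gibbs mean of coordinate [k] enters the derivative: negative for
    fields being switched on, positive for those being switched off. *)
Definition sgn (k : nat) : R := if (k <? P)%nat then - 1 else 1.

Lemma tr_dtr k t : tr k t * dtr k t = - sgn k * (sin t * cos t).
Proof. unfold tr, dtr, sgn. destruct (k <? P)%nat; ring. Qed.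

Lemma explip_A k : forall a, (a < K)%nat -> explip (S M) (fun _ => A a k).
Proof. intros. apply explip_const. Qed.

(** Integration by parts replaces [v k * <A_k>] by [tr k t * (<A_k^2> - <A_k>^2)]. The derivative of
    the subtracted half variance cancels [<A_k^2>], leaving only [<A_k>^2]. *)
Lemma EG_Gb_dHf t : EG M (fun v => Gb dHf (upd v M t)) =
  EG M (fun v => sin t * cos t * sumR M (fun k => sgn k * Gb (fun a _ => A a k) (upd v M t) ^ 2)).
Proof.
  assert (c1 : forall k, explip M (fun v => Gb (fun a _ => A a k) (upd v M t)))
    by (intros; apply explip_freeze, explip_Gb, explip_A).
  assert (c2 : forall k, explip M (fun v => Gb (fun a _ => A a k ^ 2) (upd v M t)))
    by (intros; apply explip_freeze, explip_Gb; intros; apply explip_const).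
  assert (c3 : forall k, (k < M)%nat -> explip M (fun v => v k * Gb (fun a _ => A a k) (upd v M t)))
    by (intros; apply explip_mult; [now apply explip_coord|apply c1]).
  transitivity (EG M (fun v => sumR M (fun k => dtr k t * (v k * Gb (fun a _ => A a k) (upd v M t))) -
     sumR M (fun k => tr k t * dtr k t * Gb (fun a _ => A a k ^ 2) (upd v M t)))).
  { f_equal. apply functional_extensionality; intros v. rewrite Gb_dHf, upd_same. f_equal.
    apply sumR_ext. intros i Hi. rewrite upd_other by lia. auto. }
  rewrite EG_minus.
  2:{ apply explip_sum; intros; now apply explip_scal, c3. }
  2:{ apply explip_sum; intros; apply explip_scal, c2. }
  rewrite (EG_sum M M (fun k v => dtr k t * (v k * Gb (fun a _ => A a k) (upd v M t))))
    by (intros; now apply explip_scal, c3).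
  rewrite (EG_sum M M (fun k v => tr k t * dtr k t * Gb (fun a _ => A a k ^ 2) (upd v M t)))
    by (intros; now apply explip_scal, c2).
  rewrite EG_scal by (apply explip_sum; intros; now apply explip_scal, explip_pow2, c1).
  rewrite (EG_sum M M (fun k v => sgn k * Gb (fun a _ => A a k) (upd v M t) ^ 2))
    by (intros; now apply explip_scal, explip_pow2, c1).
  rewrite <- sumR_minus, <- sumR_scal. apply sumR_ext. intros k Hk.
  rewrite EG_scal by now apply c3. rewrite EG_scal by apply c2.
  rewrite EG_scal by apply explip_pow2, c1.
  assert (I : EG M (fun v => v k * Gb (fun a _ => A a k) (upd v M t)) =
    EG M (fun v => tr k t * (Gb (fun a _ => A a k ^ 2) (upd v M t) - Gb (fun a _ => A a k) (upd v M t) ^ 2))).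
  { apply EG_ibp; auto.
    - apply explip_scal, explip_minus; [apply c2|apply explip_pow2, c1].
    - intros v.
      pose proof (pderiv_at k _ _ (upd v M t) (v k)
        (pderiv_Gb_const k (fun a => A a k) (fun a y => A a k * tr k (y M)) (fun a _ => pderiv_Hf k a Hk))) as D.
      cbv beta in D.
      replace (upd (upd v M t) k (v k)) with (upd v M t) in D
        by (rewrite upd_comm, upd_id by lia; auto).
      match goal with |- is_derive _ _ ?l => match type of D with is_derive _ _ ?l' => replace l with l' end end.
      + eapply is_derive_ext; [|exact D]. intros s. simpl. rewrite upd_comm by lia. reflexivity.
      + replace (Gb (fun a y => A a k * (A a k * tr k (y M))) (upd v M t))
          with (tr k t * Gb (fun a _ => A a k ^ 2) (upd v M t)).
        2:{ rewrite <- (Gb_scal (fun y => tr k t) (fun a _ => A a k ^ 2)). unfold Gb, num. f_equal.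
            apply sumR_ext. intros; rewrite upd_same; ring. }
        replace (Gb (fun a y => A a k * tr k (y M)) (upd v M t))
          with (tr k t * Gb (fun a _ => A a k) (upd v M t)).
        2:{ rewrite <- (Gb_scal (fun y => tr k t) (fun a _ => A a k)). unfold Gb, num. f_equal.
            apply sumR_ext. intros; rewrite upd_same; ring. }
        ring. }
  rewrite I, EG_scal by (apply explip_minus; [apply c2|apply explip_pow2, c1]).
  rewrite EG_minus by (first [apply c2|apply explip_pow2, c1]).
  set (x := EG M (fun v => Gb (fun a _ => A a k ^ 2) (upd v M t))).
  set (z := EG M (fun v => Gb (fun a _ => A a k) (upd v M t) ^ 2)).
  replace (dtr k t * (tr k t * (x - z)) - tr k t * dtr k t * x) with (- (tr k t * dtr k t) * z) by ring.
  rewrite tr_dtr. ring.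
Qed.

(** The bound [c] is asked for all probability vectors because the Gibbs weights are one, at each
    time and each realisation. The factor 1/2 is the integral of [sin t * cos t] over [0, PI/2]. *)
Lemma interpolation_bound (c : R) :
  (forall p : nat -> R, (forall a, (a < K)%nat -> 0 <= p a) -> sumR K p = 1 ->
     sumR M (fun k => sgn k * (sumR K (fun a => A a k * p a)) ^ 2) <= c) ->
  EG M (fun v => ln (Zf (upd v M (PI / 2)))) <= EG M (fun v => ln (Zf (upd v M 0))) + c / 2.
Proof.
  intros Hc.
  set (Phi := fun t => EG M (fun v => ln (Zf (upd v M t)))).
  (* Subtracting the primitive [c / 2 * (sin t)^2] of [c * sin t * cos t] reduces the claim to a
     nonpositive derivative. *)
  assert (D : forall t, is_derive (fun t => Phi t - c / 2 * (sin t)^2) t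
     (EG M (fun v => Gb dHf (upd v M t)) - c * (sin t * cos t))).
  { intros t.
    pose proof (EG_derive M (fun y => ln (Zf y)) (Gb dHf) t explip_lnZf (explip_Gb _ (fun a _ => explip_dHf a))
      (pderiv_lnZf M dHf (fun a _ => pderiv_Hf_param a))) as D1.
    apply (is_derive_minus (V := R_NormedModule) Phi (fun t => c / 2 * (sin t)^2)); [exact D1|].
    auto_derive; auto. field. }
  pose proof PI_RGT_0.
  assert (L := nonpos_derive_le _ _ 0 (PI/2) ltac:(lra) D).
  cbv beta in L. rewrite sin_0, sin_PI2 in L.
  enough (Hle : Phi (PI/2) - c / 2 * 1^2 <= Phi 0 - c / 2 * 0^2) by (unfold Phi in *; lra).
  apply L. intros t Ht. rewrite EG_Gb_dHf.
  assert (Hs : 0 <= sin t) by (apply sin_ge_0; lra).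
  assert (Hco : 0 <= cos t) by (apply cos_ge_0; lra).
  assert (EG M (fun v => sin t * cos t * sumR M (fun k => sgn k * Gb (fun a _ => A a k) (upd v M t) ^ 2))
    <= EG M (fun _ => sin t * cos t * c)).
  { apply EG_le; [|apply explip_const|].
    - apply explip_scal, explip_sum. intros. apply explip_scal, explip_pow2, explip_freeze, explip_Gb, explip_A.
    - intros v. apply Rmult_le_compat_l; [nra|].
      set (y := upd v M t). pose proof (Zf_pos y) as Zp.
      specialize (Hc (fun a => W a * exp (Hf a y) * / Zf y)).
      eapply Rle_trans; [|apply Hc].
      + right. apply sumR_ext. intros k Hk. f_equal. f_equal. unfold Gb, num.
        rewrite <- sumR_scal_r. apply sumR_ext; intros; ring.
      + intros a Ha. pose proof (exp_pos (Hf a y)). pose proof (Rinv_0_lt_compat _ Zp).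
        pose proof (W_nonneg a Ha). apply Rmult_le_pos; [nra|lra].
      + rewrite sumR_scal_r.
        replace (sumR K (fun i => W i * exp (Hf i y))) with (Zf y).
        * field; lra.
        * apply sumR_ext; intros; ring. }
  rewrite EG_const in H0. lra.
Qed.

End Interpolation.

(** * The replica symmetric comparison on finitely many nodes *)

Lemma sumR_sq_prod N (u : nat -> R) :
  sumR N (fun i => sumR N (fun j => (u i * u j) ^ 2)) = (sumR N (fun i => u i ^ 2)) ^ 2.
Proof.
  replace ((sumR N (fun i => u i ^ 2)) ^ 2) with (sumR N (fun i => u i ^ 2) * sumR N (fun j => u j ^ 2)) by ring.
  rewrite sumR_mult. apply sumR_ext; intros; apply sumR_ext; intros; ring.
Qed.

Lemma mean_sq_le K (p x : nat -> R) : (forall a, (a < K)%nat -> 0 <= p a) -> sumR K p = 1 ->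
  (sumR K (fun a => x a * p a)) ^ 2 <= sumR K (fun a => x a ^ 2 * p a).
Proof.
  intros Hp Hs. set (m := sumR K (fun a => x a * p a)).
  assert (0 <= sumR K (fun a => (x a - m) ^ 2 * p a)).
  { apply sumR_nonneg. intros a Ha. apply Rmult_le_pos; [apply pow2_ge_0|auto]. }
  assert (E : sumR K (fun a => (x a - m) ^ 2 * p a) = sumR K (fun a => x a ^ 2 * p a) - m ^ 2).
  { rewrite (sumR_ext K _ (fun a => x a ^ 2 * p a - (2 * m * (x a * p a) - m ^ 2 * p a))) by (intros; ring).
    rewrite !sumR_minus, !sumR_scal, Hs. fold m. ring. }
  lra.
Qed.

(* With [m = <z>], the squared Hilbert-Schmidt norm of [<z z^T> - m m^T] being nonnegative gives
   [|<z z^T>|^2 >= 2 <(m.z)^2> - |m|^4 >= |m|^4]. *)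
Lemma second_moment_ge N K (p : nat -> R) (z : nat -> nat -> R) :
  (forall a, (a < K)%nat -> 0 <= p a) -> sumR K p = 1 ->
  (sumR N (fun i => sumR K (fun a => z a i * p a) ^ 2)) ^ 2 <=
  sumR N (fun i => sumR N (fun j => (sumR K (fun a => z a i * z a j * p a)) ^ 2)).
Proof.
  intros Hp Hs.
  set (m := fun i => sumR K (fun a => z a i * p a)).
  set (C := fun i j => sumR K (fun a => z a i * z a j * p a)).
  set (x := fun a => sumR N (fun i => m i * z a i)).
  change ((sumR N (fun i => m i ^ 2)) ^ 2 <= sumR N (fun i => sumR N (fun j => C i j ^ 2))).
  assert (E1 : sumR K (fun a => x a * p a) = sumR N (fun i => m i ^ 2)).
  { unfold x. rewrite (sumR_ext K _ (fun a => sumR N (fun i => m i * (z a i * p a)))).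
    - rewrite sumR_swap. apply sumR_ext. intros i Hi. rewrite sumR_scal. fold (m i). ring.
    - intros a Ha. rewrite <- sumR_scal_r. apply sumR_ext; intros; ring. }
  assert (E2 : sumR K (fun a => x a ^ 2 * p a) = sumR N (fun i => sumR N (fun j => m i * m j * C i j))).
  { rewrite (sumR_ext K _ (fun a => sumR N (fun i => sumR N (fun j => m i * m j * (z a i * z a j * p a))))).
    - rewrite sumR_swap. apply sumR_ext. intros i Hi. rewrite sumR_swap. apply sumR_ext. intros j Hj.
      now rewrite sumR_scal.
    - intros a Ha. replace (x a ^ 2) with (x a * x a) by ring. unfold x. rewrite sumR_mult.
      rewrite <- sumR_scal_r. apply sumR_ext. intros i Hi. rewrite <- sumR_scal_r.
      apply sumR_ext; intros; ring. }
  pose proof (mean_sq_le K p x Hp Hs) as H. rewrite E1, E2 in H.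
  assert (P : 0 <= sumR N (fun i => sumR N (fun j => (C i j - m i * m j) ^ 2))).
  { apply sumR_nonneg; intros; apply sumR_nonneg; intros; apply pow2_ge_0. }
  assert (E3 : sumR N (fun i => sumR N (fun j => (C i j - m i * m j) ^ 2)) =
     sumR N (fun i => sumR N (fun j => C i j ^ 2)) - 2 * sumR N (fun i => sumR N (fun j => m i * m j * C i j))
     + (sumR N (fun i => m i ^ 2)) ^ 2).
  { rewrite <- sumR_sq_prod, <- sumR_scal, <- sumR_minus, <- sumR_plus.
    apply sumR_ext. intros i Hi. rewrite <- sumR_scal, <- sumR_minus, <- sumR_plus.
    apply sumR_ext; intros; ring. }
  lra.
Qed.

Lemma sqrt_2N_sq N : (1 <= N)%nat -> sqrt (2 * INR N) ^ 2 = 2 * INR N.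
Proof. intros H. apply le_INR in H. simpl in H. rewrite pow2_sqrt; lra. Qed.

(** Coefficients of the two fields at node [a]: the first [N * N] coordinates are the disorder in
    the row order of [Jentry], the last [N] drive the linear field. *)
Definition Amat (N : nat) (beta lambda : R) (zeta : nat -> nat -> R) (a k : nat) : R :=
  if (k <? N * N)%nat then beta / sqrt (2 * INR N) * (zeta a (k / N)%nat * zeta a (k mod N)%nat)
  else sqrt lambda * zeta a (k - N * N)%nat.

Lemma sum_block N (f : nat -> R) :
  sumR (N * N + N) f = sumR N (fun i => sumR N (fun j => f (i * N + j)%nat)) + sumR N (fun i => f (N * N + i)%nat).
Proof. now rewrite sumR_app, sumR_prod. Qed.

Lemma index_lt N i j : (i < N)%nat -> (j < N)%nat -> (i * N + j < N * N)%nat.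
Proof. nia. Qed.

Lemma Amat_J N beta lambda zeta a i j : (i < N)%nat -> (j < N)%nat ->
  Amat N beta lambda zeta a (i * N + j) = beta / sqrt (2 * INR N) * (zeta a i * zeta a j).
Proof.
  intros Hi Hj. unfold Amat. pose proof (index_lt N i j Hi Hj) as H. apply Nat.ltb_lt in H. rewrite H.
  replace ((i * N + j) / N)%nat with i.
  - replace ((i * N + j) mod N)%nat with j; auto.
    rewrite Nat.add_comm, Nat.Div0.mod_add. symmetry. now apply Nat.mod_small.
  - rewrite Nat.div_add_l by lia. rewrite Nat.div_small by auto. lia.
Qed.

Lemma Amat_g N beta lambda zeta a i : Amat N beta lambda zeta a (N * N + i) = sqrt lambda * zeta a i.
Proof.
  unfold Amat. replace (N * N + i <? N * N)%nat with false by (symmetry; apply Nat.ltb_ge; lia).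
  f_equal. f_equal. lia.
Qed.

Lemma ltb_J N i j : (i < N)%nat -> (j < N)%nat -> (i * N + j <? N * N)%nat = true.
Proof. intros. apply Nat.ltb_lt. now apply index_lt. Qed.

Lemma ltb_g N i : (N * N + i <? N * N)%nat = false.
Proof. apply Nat.ltb_ge. lia. Qed.

Definition Zd N beta lambda Q (w : nat -> R) (zeta : nat -> nat -> R) (J : nat -> R) : R :=
  sumR Q (fun a => w a * exp (Hamil N beta lambda J (zeta a))).

(** No quadratic term appears here: at the linear end the half variance of the field cancels
    [lambda / 2 * |zeta a|^2]. *)
Definition Yd N lambda Q (w : nat -> R) (zeta : nat -> nat -> R) (y : nat -> R) : R :=
  sumR Q (fun a => w a * exp (sqrt lambda * sumR N (fun i => y (N * N + i)%nat * zeta a i))).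

Lemma guerra_nodes N beta lambda Q w zeta a0 : (1 <= N)%nat -> 0 < beta -> 0 <= lambda ->
  (forall a, (a < Q)%nat -> 0 <= w a) -> (a0 < Q)%nat -> 0 < w a0 ->
  EG (N * N + N) (fun y => ln (Zd N beta lambda Q w zeta y)) <=
  EG (N * N + N) (fun y => ln (Yd N lambda Q w zeta y)) + INR N * (lambda ^ 2 / (4 * beta ^ 2)).
Proof.
  intros HN Hb Hl Hw Ha0 Hwa0.
  assert (HN' : 1 <= INR N) by (apply le_INR in HN; exact HN).
  set (M := (N * N + N)%nat). set (b := beta / sqrt (2 * INR N)).
  assert (Hsq : 0 < sqrt (2 * INR N)) by (apply sqrt_lt_R0; lra).
  assert (Hb2 : b ^ 2 = beta ^ 2 / (2 * INR N)).
  { unfold b. rewrite <- (sqrt_2N_sq N HN) at 2. field. lra. }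
  assert (Hb2p : 0 < b ^ 2).
  { rewrite Hb2. apply Rdiv_lt_0_compat; nra. }
  assert (Hsl : sqrt lambda ^ 2 = lambda) by (apply pow2_sqrt; auto).
  set (A := Amat N beta lambda zeta).
  (* The [lambda] term of the Hamiltonian does not depend on time, so it is put into the weights. *)
  set (W := fun a => w a * exp (lambda / 2 * sumR N (fun i => zeta a i ^ 2))).
  assert (HW : forall a, (a < Q)%nat -> 0 <= W a).
  { intros a Ha. unfold W. apply Rmult_le_pos; auto. apply Rlt_le, exp_pos. }
  assert (HW0 : 0 < W a0) by (unfold W; apply Rmult_lt_0_compat; auto; apply exp_pos).
  pose proof (interpolation_bound M (N * N) Q A W a0 HW Ha0 HW0 (INR N * (lambda ^ 2 / (2 * beta ^ 2)))) as IB.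
  (* At [PI / 2] only the quadratic field is present, and its half variance [b^2 / 2 * |zeta a|^4]
     is the quartic term of [Hamil]. *)
  assert (Z1 : forall y, Zf M (N * N) Q A W (upd y M (PI / 2)) = Zd N beta lambda Q w zeta y).
  { intros y. unfold Zf, num, Zd, W. apply sumR_ext. intros a Ha.
    rewrite Rmult_1_l, Rmult_assoc, <- exp_plus. f_equal. f_equal.
    unfold Hf, Hamil, M. rewrite upd_same, !sum_block.
    rewrite (sumR_ext N (fun i => A a (N * N + i)%nat * _ * _) (fun _ => 0)).
    2:{ intros i Hi. unfold tr. rewrite ltb_g, cos_PI2. ring. }
    rewrite (sumR_ext N (fun i => (A a (N * N + i)%nat * _) ^ 2) (fun _ => 0)).
    2:{ intros i Hi. unfold tr. rewrite ltb_g, cos_PI2. ring. }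
    rewrite (sumR_ext N (fun i => sumR N (fun j => A a (i * N + j)%nat * _ * _))
       (fun i => b * sumR N (fun j => Jentry N y i j * zeta a i * zeta a j))).
    2:{ intros i Hi. rewrite <- sumR_scal. apply sumR_ext. intros j Hj.
        unfold tr, A. rewrite ltb_J, sin_PI2, Amat_J by auto. fold b.
        rewrite upd_other by (pose proof (index_lt N i j Hi Hj); lia). unfold Jentry. ring. }
    rewrite (sumR_ext N (fun i => sumR N (fun j => (A a (i * N + j)%nat * _) ^ 2))
       (fun i => b ^ 2 * sumR N (fun j => (zeta a i * zeta a j) ^ 2))).
    2:{ intros i Hi. rewrite <- sumR_scal. apply sumR_ext. intros j Hj.
        unfold tr, A. rewrite ltb_J, sin_PI2, Amat_J by auto. fold b. ring. }
    rewrite !sumR_scal, sumR_sq_prod, !sumR_const, Hb2. fold b. field. lra. }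
  assert (Z0 : forall y, Zf M (N * N) Q A W (upd y M 0) = Yd N lambda Q w zeta y).
  { intros y. unfold Zf, num, Yd, W. apply sumR_ext. intros a Ha.
    rewrite Rmult_1_l, Rmult_assoc, <- exp_plus. f_equal. f_equal.
    unfold Hf, M. rewrite upd_same, !sum_block.
    rewrite (sumR_ext N (fun i => sumR N (fun j => A a (i * N + j)%nat * _ * _)) (fun _ => 0)).
    2:{ intros i Hi. rewrite (sumR_ext N _ (fun _ => 0)); [rewrite sumR_const; ring|].
        intros j Hj. unfold tr. rewrite ltb_J, sin_0 by auto. ring. }
    rewrite (sumR_ext N (fun i => sumR N (fun j => (A a (i * N + j)%nat * _) ^ 2)) (fun _ => 0)).
    2:{ intros i Hi. rewrite (sumR_ext N _ (fun _ => 0)); [rewrite sumR_const; ring|].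
        intros j Hj. unfold tr. rewrite ltb_J, sin_0 by auto. ring. }
    rewrite (sumR_ext N (fun i => A a (N * N + i)%nat * _ * _)
       (fun i => sqrt lambda * (y (N * N + i)%nat * zeta a i))).
    2:{ intros i Hi. unfold tr, A. rewrite ltb_g, cos_0, Amat_g, upd_other by lia. ring. }
    rewrite (sumR_ext N (fun i => (A a (N * N + i)%nat * _) ^ 2) (fun i => lambda * zeta a i ^ 2)).
    2:{ intros i Hi. unfold tr, A. rewrite ltb_g, cos_0, Amat_g. rewrite <- Hsl at 2. ring. }
    rewrite !sumR_scal, !sumR_const. field. }
  replace (EG M (fun y => ln (Zd N beta lambda Q w zeta y)))
    with (EG M (fun v => ln (Zf M (N * N) Q A W (upd v M (PI / 2)))))
    by (f_equal; apply functional_extensionality; intros; now rewrite Z1).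
  replace (EG M (fun y => ln (Yd N lambda Q w zeta y)))
    with (EG M (fun v => ln (Zf M (N * N) Q A W (upd v M 0))))
    by (f_equal; apply functional_extensionality; intros; now rewrite Z0).
  replace (INR N * (lambda ^ 2 / (4 * beta ^ 2))) with (INR N * (lambda ^ 2 / (2 * beta ^ 2)) / 2) by (field; lra).
  apply IB. clear IB Z1 Z0.
  intros p Hp Hs. unfold M. rewrite sum_block.
  rewrite (sumR_ext N (fun i => sumR N (fun j => sgn (N * N) (i * N + j) * _))
     (fun i => (- b ^ 2) * sumR N (fun j => (sumR Q (fun a => zeta a i * zeta a j * p a)) ^ 2))).
  2:{ intros i Hi. rewrite <- sumR_scal. apply sumR_ext. intros j Hj.
      unfold sgn. rewrite ltb_J by auto.
      rewrite (sumR_ext Q (fun a => A a (i * N + j)%nat * p a) (fun a => b * (zeta a i * zeta a j * p a))).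
      - rewrite sumR_scal. ring.
      - intros a Ha. unfold A. rewrite Amat_J by auto. fold b. ring. }
  rewrite (sumR_ext N (fun i => sgn (N * N) (N * N + i) * _)
     (fun i => lambda * (sumR Q (fun a => zeta a i * p a)) ^ 2)).
  2:{ intros i Hi. unfold sgn. rewrite ltb_g.
      rewrite (sumR_ext Q (fun a => A a (N * N + i)%nat * p a) (fun a => sqrt lambda * (zeta a i * p a))).
      - rewrite sumR_scal. rewrite <- Hsl at 2. ring.
      - intros a Ha. unfold A. rewrite Amat_g. ring. }
  rewrite !sumR_scal.
  pose proof (second_moment_ge N Q p zeta Hp Hs) as H2.
  set (x := sumR N (fun i => (sumR Q (fun a => zeta a i * p a)) ^ 2)) in *.
  set (y := sumR N _) in H2 |- *.
  apply Rle_trans with (- b ^ 2 * x ^ 2 + lambda * x); [nra|].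
  (* Completing the square, [lambda * x - b^2 * x^2] is at most [lambda^2 / (4 * b^2)], which is the
     claimed constant as [b^2 = beta^2 / (2 * INR N)]. *)
  apply (Rmult_le_reg_l (4 * b ^ 2)); [lra|].
  replace (4 * b ^ 2 * (INR N * (lambda ^ 2 / (2 * beta ^ 2)))) with (lambda ^ 2).
  2:{ rewrite Hb2. field. lra. }
  pose proof (pow2_ge_0 (2 * b ^ 2 * x - lambda)). nra.
Qed.

(** * A Lipschitz partition of unity on a box *)

Definition clamp (u : R) : R := Rmax 0 (Rmin 1 u).

Lemma clamp_cases u : (u <= 0 /\ clamp u = 0) \/ (0 <= u <= 1 /\ clamp u = u) \/ (1 <= u /\ clamp u = 1).
Proof.
  unfold clamp, Rmax, Rmin.
  destruct (Rle_dec 1 u); destruct (Rle_dec 0 _); lra.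
Qed.

Lemma clamp_lip s t : Rabs (clamp s - clamp t) <= 1 * Rabs (s - t).
Proof.
  pose proof (Rle_abs (s - t)). pose proof (Rle_abs (- (s - t))) as Hn. rewrite Rabs_Ropp in Hn.
  apply Rabs_le.
  destruct (clamp_cases s) as [[? ->]|[[? ->]|[? ->]]]; destruct (clamp_cases t) as [[? ->]|[[? ->]|[? ->]]]; lra.
Qed.

Lemma clamp_mono s t : s <= t -> clamp s <= clamp t.
Proof.
  intros. destruct (clamp_cases s) as [[? ->]|[[? ->]|[? ->]]]; destruct (clamp_cases t) as [[? ->]|[[? ->]|[? ->]]]; lra.
Qed.

(* Telescoping differences of clamps give a Lipschitz partition of unity on the line. *)
Definition bump (h : R) (m k : nat) (x : R) : R :=
  clamp (x / h - (INR k - INR m)) - clamp (x / h - (INR (S k) - INR m)).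

Lemma bump_nonneg h m k x : 0 <= bump h m k x.
Proof.
  unfold bump. pose proof (clamp_mono (x / h - (INR (S k) - INR m)) (x / h - (INR k - INR m))).
  rewrite S_INR in *. lra.
Qed.

Lemma bump_supp h m k x : 0 < h -> bump h m k x <> 0 -> Rabs (x - h * (INR k - INR m)) <= 2 * h.
Proof.
  intros Hh. unfold bump. rewrite S_INR. intros H.
  assert (E : x - h * (INR k - INR m) = h * (x / h - (INR k - INR m))) by (field; lra).
  set (u := x / h - (INR k - INR m)) in *.
  replace (x / h - (INR k + 1 - INR m)) with (u - 1) in H by (unfold u; ring).
  assert (0 <= u <= 2).
  { destruct (clamp_cases u) as [[? K]|[[? K]|[? K]]]; destruct (clamp_cases (u-1)) as [[? K']|[[? K']|[? K']]];
    rewrite K, K' in H; lra. }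
  rewrite E, Rabs_right; nra.
Qed.

Lemma bump_sum h m n x : sumR n (fun k => bump h m k x) = clamp (x / h + INR m) - clamp (x / h - (INR n - INR m)).
Proof.
  induction n.
  - simpl. rewrite Rminus_diag_eq; auto. f_equal. ring.
  - rewrite sumR_S, IHn. unfold bump. ring.
Qed.

Lemma explip_bump n i h m k : (i < n)%nat -> explip n (fun z => bump h m k (z i)).
Proof.
  intros Hi. unfold bump. unfold Rdiv.
  assert (K : forall c, explip n (fun z => clamp (z i * / h - c))).
  { intros c. apply (explip_lip n (fun z => z i * / h - c) clamp 1); [lra|apply clamp_lip|].
    apply explip_minus; [|apply explip_const]. apply explip_mult; [now apply explip_coord|apply explip_const]. }
  apply explip_minus; apply K.
Qed.

(** Products of one-dimensional bumps of mesh [L / m]. Their sum is 1 on the box of half-side [L],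
    so the missing mass is controlled by Chebyshev's [|z|^2 / L^2]; each product is supported within
    two mesh widths of its node in every coordinate. *)
Lemma nodes_exist N L m : 1 <= L -> (1 <= m)%nat ->
  exists (Q : nat) (T : nat -> (nat -> R) -> R) (zeta : nat -> nat -> R),
    (forall a, (a < Q)%nat -> explip N (T a)) /\
    (forall a z, (a < Q)%nat -> 0 <= T a z) /\
    (forall z, 0 <= sumR Q (fun a => T a z) <= 1) /\
    (forall z, 1 - sumR Q (fun a => T a z) <= sumR N (fun i => z i ^ 2) * / L ^ 2) /\
    (forall a z, (a < Q)%nat -> T a z <> 0 -> forall i, (i < N)%nat ->
       Rabs (z i - zeta a i) <= 2 * L / INR m /\ Rabs (zeta a i) <= 2 * L).
Proof.
  intros HL Hm.
  assert (Hm' : 1 <= INR m) by (apply le_INR in Hm; exact Hm).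
  set (h := L / INR m).
  assert (Hh : 0 < h) by (apply Rdiv_lt_0_compat; lra).
  assert (Ehm : h * INR m = L) by (unfold h; field; lra).
  (* With [2 (m + 1)] bumps the telescoped sum is [clamp (u + (m + 1)) - clamp (u - (m + 1))], equal
     to 1 for [-m <= u <= m]. *)
  set (D := (2 * S m)%nat).
  assert (Hchi : forall x, 0 <= sumR D (fun k => bump h (S m) k x) <= 1 /\
     1 - sumR D (fun k => bump h (S m) k x) <= x ^ 2 * / L ^ 2).
  { intros x. rewrite bump_sum.
    assert (ED : INR D - INR (S m) = INR m + 1).
    { unfold D. rewrite mult_INR, !S_INR. simpl INR. lra. }
    rewrite ED, S_INR.
    assert (Ex : x = h * (x / h)) by (field; lra).
    set (u := x / h) in *.
    assert (HL2 : 0 < L ^ 2) by nra.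
    assert (0 <= x ^ 2 * / L ^ 2).
    { apply Rmult_le_pos; [apply pow2_ge_0|]. apply Rlt_le, Rinv_0_lt_compat; auto. }
    assert (Hbig : INR m <= Rabs u -> 1 <= x ^ 2 * / L ^ 2).
    { intros Hu. apply (Rmult_le_reg_r (L ^ 2)); auto. rewrite Rmult_assoc, Rinv_l by lra.
      rewrite <- Ehm. rewrite Ex. rewrite <- (pow2_abs (h * u)), Rabs_mult, (Rabs_right h) by lra.
      rewrite Rmult_1_l, Rmult_1_r. apply pow_incr. split; [apply Rmult_le_pos; lra|]. apply Rmult_le_compat_l; lra. }
    destruct (clamp_cases (u + (INR m + 1))) as [[B1 ->]|[[B1 ->]|[B1 ->]]];
    destruct (clamp_cases (u - (INR m + 1))) as [[B2 ->]|[[B2 ->]|[B2 ->]]]; split; try lra;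
    (apply Rle_trans with 1; [lra|]); apply Hbig; unfold Rabs; destruct (Rcase_abs u); lra. }
  (* The multi-index of a node is written in base [D]: the last coordinate is [a mod D], the earlier
     ones are in [a / D]. *)
  induction N as [|N IH].
  - exists 1%nat, (fun _ _ => 1), (fun _ _ => 0). simpl.
    split; [intros; apply explip_const|]. split; [intros; lra|]. split; [intros; lra|]. split; [intros; lra|].
    intros; lia.
  - destruct IH as (Q & T & zeta & H1 & H2 & H3 & H4 & H5).
    assert (Ha : forall a, (a < Q * D)%nat -> (a / D < Q)%nat /\ (a mod D < D)%nat).
    { intros a Ha. split; [apply Nat.Div0.div_lt_upper_bound; lia|apply Nat.mod_upper_bound; unfold D; lia]. }
    assert (Es : forall z, sumR (Q * D) (fun a => T (a / D)%nat z * bump h (S m) (a mod D) (z N)) =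
       sumR Q (fun a => T a z) * sumR D (fun k => bump h (S m) k (z N))).
    { intros z. rewrite sumR_prod, sumR_mult. apply sumR_ext. intros i Hi. apply sumR_ext. intros j Hj.
      rewrite Nat.div_add_l by (unfold D; lia). rewrite Nat.div_small, Nat.add_0_r by auto.
      rewrite Nat.add_comm, Nat.Div0.mod_add, Nat.mod_small by auto. reflexivity. }
    exists (Q * D)%nat, (fun a z => T (a / D)%nat z * bump h (S m) (a mod D) (z N)),
      (fun a i => if Nat.eq_dec i N then h * (INR (a mod D) - INR (S m)) else zeta (a / D)%nat i).
    split; [|split; [|split; [|split]]].
    + intros a Hlt. destruct (Ha a Hlt). apply explip_mult; [apply (explip_mono N); auto|apply explip_bump; lia].
    + intros a z Hlt. destruct (Ha a Hlt). apply Rmult_le_pos; [auto|apply bump_nonneg].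
    + intros z. rewrite Es. destruct (Hchi (z N)) as [[? ?] _]. destruct (H3 z). split; nra.
    (* The missing masses add up: [1 - X Y <= (1 - X) + (1 - Y)] for [X] and [Y] in [0,1]. *)
    + intros z. rewrite Es, sumR_S. destruct (Hchi (z N)) as [[? ?] ?]. destruct (H3 z). specialize (H4 z).
      rewrite Rmult_plus_distr_r. nra.
    + intros a z Hlt HT i Hi. destruct (Ha a Hlt) as [A1 A2].
      assert (T (a / D)%nat z <> 0) by (intros E; apply HT; rewrite E; ring).
      assert (Hbn : bump h (S m) (a mod D) (z N) <> 0) by (intros E; apply HT; rewrite E; ring).
      destruct (Nat.eq_dec i N) as [->|Hne].
      * split.
        { replace (2 * L / INR m) with (2 * h) by (unfold h; field; lra). now apply bump_supp. }
        assert (0 <= INR (a mod D) <= 2 * INR m + 1).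
        { split; [apply pos_INR|].
          replace (2 * INR m + 1) with (INR (2 * m + 1)) by (rewrite plus_INR, mult_INR; simpl INR; ring).
          apply le_INR. revert A2. generalize (a mod D)%nat. intros r A2. unfold D in A2. lia. }
        rewrite Rabs_mult, (Rabs_right h) by lra. rewrite S_INR.
        apply Rle_trans with (h * (2 * INR m)); [|nra].
        apply Rmult_le_compat_l; [lra|]. apply Rabs_le. lra.
      * apply (H5 (a / D)%nat z); auto. lia.
Qed.

(** * Estimates on the partition function *)

Definition sqn (N : nat) (z : nat -> R) : R := sumR N (fun i => z i ^ 2).

Lemma sqn_pos N z : 0 <= sqn N z.
Proof. apply sumR_nonneg; intros; apply pow2_ge_0. Qed.

Lemma explip_sqn N : explip N (sqn N).
Proof. apply explip_sum. intros. apply explip_pow2. now apply explip_coord. Qed.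

Lemma abs_mul_le_sqn N z i j : (i < N)%nat -> (j < N)%nat -> Rabs (z i * z j) <= sqn N z.
Proof.
  intros Hi Hj.
  assert (z i ^ 2 <= sqn N z) by (apply (sumR_term_le N (fun i => z i ^ 2)); auto; intros; apply pow2_ge_0).
  assert (z j ^ 2 <= sqn N z) by (apply (sumR_term_le N (fun i => z i ^ 2)); auto; intros; apply pow2_ge_0).
  rewrite Rabs_mult. rewrite <- (pow2_abs (z i)), <- (pow2_abs (z j)) in *.
  pose proof (pow2_ge_0 (Rabs (z i) - Rabs (z j))). nra.
Qed.

Definition quad (N : nat) (J z : nat -> R) : R :=
  sumR N (fun i => sumR N (fun j => Jentry N J i j * z i * z j)).

Lemma quad_diff_bound N J J' z z' B : 0 <= B ->
  (forall i j, (i < N)%nat -> (j < N)%nat -> Rabs (Jentry N J i j * z i * z j - Jentry N J' i j * z' i * z' j)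
     <= Rabs (Jentry N J i j - Jentry N J' i j) * B) ->
  Rabs (quad N J z - quad N J' z') <= dist1 (N * N) J J' * B.
Proof.
  intros HB H. unfold quad. rewrite <- sumR_minus.
  eapply Rle_trans; [apply Rabs_sumR|].
  unfold dist1, norm1. rewrite sumR_prod, <- sumR_scal_r. apply sumR_le. intros i Hi.
  rewrite <- sumR_minus. eapply Rle_trans; [apply Rabs_sumR|].
  rewrite <- sumR_scal_r. apply sumR_le. intros j Hj. now apply H.
Qed.

Lemma quad_lip_J N J J' z : Rabs (quad N J z - quad N J' z) <= dist1 (N * N) J J' * sqn N z.
Proof.
  apply quad_diff_bound; [apply sqn_pos|]. intros i j Hi Hj.
  replace (Jentry N J i j * z i * z j - Jentry N J' i j * z i * z j)
    with ((Jentry N J i j - Jentry N J' i j) * (z i * z j)) by ring.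
  rewrite Rabs_mult. apply Rmult_le_compat_l; [apply Rabs_pos|now apply abs_mul_le_sqn].
Qed.

Lemma quad_lip_z N J z z' B : 0 <= B ->
  (forall i j, (i < N)%nat -> (j < N)%nat -> Rabs (z i * z j - z' i * z' j) <= B) ->
  Rabs (quad N J z - quad N J z') <= norm1 (N * N) J * B.
Proof.
  intros HB H. unfold quad. rewrite <- sumR_minus.
  eapply Rle_trans; [apply Rabs_sumR|].
  unfold norm1. rewrite sumR_prod, <- sumR_scal_r. apply sumR_le. intros i Hi.
  rewrite <- sumR_minus. eapply Rle_trans; [apply Rabs_sumR|].
  rewrite <- sumR_scal_r. apply sumR_le. intros j Hj.
  replace (Jentry N J i j * z i * z j - Jentry N J i j * z' i * z' j)
    with (Jentry N J i j * (z i * z j - z' i * z' j)) by ring.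
  rewrite Rabs_mult. apply Rmult_le_compat_l; [apply Rabs_pos|auto].
Qed.

Lemma quad_bound N J z : Rabs (quad N J z) <= norm1 (N * N) J * sqn N z.
Proof.
  pose proof (quad_lip_J N J (fun _ => 0) z) as H.
  replace (quad N (fun _ => 0) z) with 0 in H.
  - rewrite Rminus_0_r in H. replace (norm1 (N * N) J) with (dist1 (N * N) J (fun _ => 0)); auto.
    apply sumR_ext; intros; f_equal; ring.
  - unfold quad. symmetry. rewrite (sumR_ext N _ (fun _ => 0)); [rewrite sumR_const; ring|].
    intros i Hi. rewrite (sumR_ext N _ (fun _ => 0)); [rewrite sumR_const; ring|].
    intros j Hj. unfold Jentry. ring.
Qed.

Section PartitionFunction.

Variables (N : nat) (beta lambda : R).
Hypothesis HN : (1 <= N)%nat.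
Hypothesis Hbeta : 0 < beta.
Hypothesis Hlambda : 0 <= lambda.

Let b := beta / sqrt (2 * INR N).
Let kap := beta ^ 2 / (4 * INR N).
Let H := Hamil N beta lambda.
Let nJ := norm1 (N * N).
Let S := sqn N.

Lemma INR_N : 1 <= INR N.
Proof. apply le_INR in HN. exact HN. Qed.

Lemma b_pos : 0 < b.
Proof. unfold b. apply Rdiv_lt_0_compat; auto. apply sqrt_lt_R0. pose proof INR_N. lra. Qed.

Lemma kap_pos : 0 < kap.
Proof. unfold kap. pose proof INR_N. apply Rdiv_lt_0_compat; nra. Qed.

Lemma H_eq J z : H J z = b * quad N J z - kap * S z ^ 2 + lambda / 2 * S z.
Proof. reflexivity. Qed.

Lemma explip_H J : explip N (H J).
Proof.
  change (explip N (fun z => b * quad N J z - kap * S z ^ 2 + lambda / 2 * S z)).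
  apply explip_plus; [apply explip_minus|]; apply explip_scal.
  - apply explip_sum; intros; apply explip_sum; intros.
    apply explip_mult; [|now apply explip_coord]. apply explip_scal. now apply explip_coord.
  - apply explip_pow2, explip_sqn.
  - apply explip_sqn.
Qed.

Lemma H_upper J z : H J z <= (b * nJ J + lambda / 2) * S z - kap * S z ^ 2.
Proof.
  rewrite H_eq. pose proof (quad_bound N J z). pose proof (Rle_abs (quad N J z)).
  pose proof b_pos. fold (nJ J) in *. fold (S z) in *. nra.
Qed.

(** The maximum over real [s] of [u s - kap s^2] with [u = b * nJ J + lambda / 2]. It is quadratic
    in the norm of [J], so its exponential falls outside the weighted class. *)
Definition topH (J : nat -> R) : R := (b * nJ J + lambda / 2) ^ 2 / (4 * kap).

Lemma H_le_top J z : H J z <= topH J.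
Proof.
  eapply Rle_trans; [apply H_upper|]. unfold topH. pose proof kap_pos.
  set (u := b * nJ J + lambda / 2). set (s := S z).
  apply (Rmult_le_reg_l (4 * kap)); [lra|].
  replace (4 * kap * (u ^ 2 / (4 * kap))) with (u ^ 2) by (field; lra).
  pose proof (pow2_ge_0 (u - 2 * kap * s)). nra.
Qed.

(** A factor linear in the norm of [J] is separated from a polynomial in [z] of finite Gaussian
    mean. *)
Lemma H_lower J z : - ((b + kap) * (1 + nJ J) * (1 + S z) ^ 2) <= H J z.
Proof.
  rewrite H_eq. pose proof (quad_bound N J z) as Q. pose proof (Rabs_le_between (quad N J z) (nJ J * S z)) as [Q' _].
  specialize (Q' Q). pose proof b_pos. pose proof kap_pos.
  pose proof (sqn_pos N z) as HS. fold (S z) in HS.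
  pose proof (norm1_pos (N * N) J) as Hn. fold (nJ J) in Hn.
  assert (0 <= lambda / 2 * S z) by nra.
  assert (b * (- (nJ J * S z)) <= b * quad N J z) by (apply Rmult_le_compat_l; lra).
  assert (P1 : b * (nJ J * S z) <= b * ((1 + nJ J) * (1 + S z) ^ 2)).
  { apply Rmult_le_compat_l; [lra|]. apply Rmult_le_compat; nra. }
  assert (P2 : kap * S z ^ 2 <= kap * ((1 + nJ J) * (1 + S z) ^ 2)).
  { apply Rmult_le_compat_l; [lra|].
    assert (S z ^ 2 <= (1 + S z) ^ 2) by nra. assert (0 <= (1 + S z) ^ 2) by apply pow2_ge_0. nra. }
  nra.
Qed.

Lemma explip_expH J : explip N (fun z => exp (H J z)).
Proof.
  apply (explip_exp N (H J) (topH J) 0); [|lra| |apply explip_H].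
  - unfold topH. apply Rdiv_le_0_compat; [apply pow2_ge_0|]. pose proof kap_pos; lra.
  - intros z. pose proof (H_le_top J z). lra.
Qed.

Definition ZZ (J : nat -> R) : R := EG N (fun z => exp (H J z)).

Lemma Z_N_eq J : Z_N N beta lambda J = ZZ J.
Proof. apply Egauss_EG, explip_expH. Qed.

Let V z := (1 + S z) ^ 2.
Definition v2 : R := EG N (fun z => (1 + sqn N z) ^ 2).
(** Linear in the norm of [J], unlike [topH], so that [exp (mJ J)] stays in the weighted class. *)
Definition mJ (J : nat -> R) : R := 2 * ((b + kap) * (1 + nJ J) * v2).

Lemma explip_V : explip N (fun z => (1 + sqn N z) ^ 2).
Proof. apply explip_pow2, explip_plus; [apply explip_const|apply explip_sqn]. Qed.

Lemma v2_nonneg : 0 <= v2.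
Proof. apply EG_nonneg; [apply explip_V|intros; apply pow2_ge_0]. Qed.

Lemma nJ_pos J : 0 <= nJ J.
Proof. apply norm1_pos. Qed.

Lemma mJ_nonneg J : 0 <= mJ J.
Proof.
  unfold mJ. pose proof b_pos. pose proof kap_pos. pose proof (nJ_pos J). pose proof v2_nonneg.
  assert (0 <= (b + kap) * (1 + nJ J)) by nra. nra.
Qed.

(* Jensen's inequality in the form [e^H >= e^(-m) (1 + m + H)], with [m] chosen as twice the mean of a bound on [-H]. *)
Lemma cut_lower X J : explip N X -> (forall z, 0 <= X z <= 1) -> 1 / 2 <= EG N X ->
  exp (- mJ J) / 2 <= EG N (fun z => X z * exp (H J z)).
Proof.
  intros cX HX HE.
  set (g := (b + kap) * (1 + nJ J)). set (m := mJ J).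
  assert (Em : m = 2 * (g * v2)) by reflexivity.
  apply Rle_trans with (EG N (fun z => exp (- m) * ((1 + m) * X z - g * (1 + sqn N z) ^ 2))).
  - rewrite EG_scal by (apply explip_minus; apply explip_scal; [auto|apply explip_V]).
    rewrite EG_minus by (apply explip_scal; first [exact cX|apply explip_V]).
    rewrite !EG_scal by (first [exact cX|apply explip_V]). fold v2.
    pose proof (exp_pos (- m)). pose proof (mJ_nonneg J) as Hm. fold m in Hm.
    assert ((1 + m) * (1/2) <= (1 + m) * EG N X) by (apply Rmult_le_compat_l; lra).
    (* With [EG N X >= 1/2], the part [m / 2] of the first term is exactly [g * v2], and 1/2
       remains. *)
    assert (/ 2 <= (1 + m) * EG N X - g * v2) by lra. nra.
  - apply EG_le.
    + apply explip_scal, explip_minus; apply explip_scal; [auto|apply explip_V].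
    + apply explip_mult; [auto|apply explip_expH].
    + intros z. pose proof (H_lower J z) as HL. fold g in HL. fold (S z).
      specialize (HX z). pose proof (exp_pos (- m)).
      assert (0 <= g * (1 + S z) ^ 2).
      { apply Rmult_le_pos; [|apply pow2_ge_0]. unfold g. pose proof b_pos. pose proof kap_pos. pose proof (nJ_pos J). nra. }
      pose proof (mJ_nonneg J) as Hm. fold m in Hm.
      pose proof (exp_ineq1_le (m + H J z)) as He.
      assert (Hx : exp (H J z) = exp (- m) * exp (m + H J z)) by (rewrite <- exp_plus; f_equal; ring).
      rewrite Hx.
      replace (X z * (exp (- m) * exp (m + H J z))) with (exp (- m) * (X z * exp (m + H J z))) by ring.
      apply Rmult_le_compat_l; [lra|]. set (T := g * (1 + S z) ^ 2) in *. set (ee := exp (m + H J z)) in *.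
      assert (1 + m - T <= ee) by lra.
      assert (X z * (1 + m - T) <= X z * ee) by (apply Rmult_le_compat_l; lra). nra.
Qed.

Lemma ZZ_lower J : exp (- mJ J) / 2 <= ZZ J.
Proof.
  unfold ZZ. replace (fun z => exp (H J z)) with (fun z => (fun _ => 1) z * exp (H J z))
    by (apply functional_extensionality; intros; ring).
  apply cut_lower; [apply explip_const|intros; lra|rewrite EG_const; lra].
Qed.

Lemma ZZ_pos J : 0 < ZZ J.
Proof. pose proof (ZZ_lower J). pose proof (exp_pos (- mJ J)). lra. Qed.

Lemma ZZ_upper J : ZZ J <= exp (topH J).
Proof.
  rewrite <- (EG_const N (exp (topH J))). apply EG_le; [apply explip_expH|apply explip_const|].
  intros z. apply exp_le, H_le_top.
Qed.

(** Bound for the Gibbs mean of [|z|^2]: the quotient is the threshold beyond which [H <= - S], and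
    [2 * exp (mJ J)] dominates [1 / ZZ J], the cost of the region beyond it. *)
Definition BJ (J : nat -> R) : R := (b * nJ J + lambda / 2 + 1) / kap + 2 * exp (mJ J).

Lemma BJ_ge_1 J : 1 <= BJ J.
Proof.
  unfold BJ. pose proof (exp_ge_1 (mJ J) (mJ_nonneg J)). pose proof kap_pos. pose proof b_pos. pose proof (nJ_pos J).
  assert (0 <= (b * nJ J + lambda / 2 + 1) / kap) by (apply Rdiv_le_0_compat; nra). lra.
Qed.

Lemma explip_nJ : explip (N * N) nJ.
Proof. apply explip_norm1. Qed.

Lemma explip_mJ : explip (N * N) mJ.
Proof.
  unfold mJ. apply explip_scal, explip_mult; [|apply explip_const]. apply explip_scal, explip_plus; [apply explip_const|apply explip_nJ].
Qed.

Lemma explip_topH : explip (N * N) topH.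
Proof.
  unfold topH, Rdiv. apply explip_mult; [|apply explip_const]. apply explip_pow2, explip_plus; [apply explip_scal, explip_nJ|apply explip_const].
Qed.

Lemma explip_BJ : explip (N * N) BJ.
Proof.
  unfold BJ, Rdiv. apply explip_plus.
  - apply explip_mult; [|apply explip_const]. apply explip_plus; [|apply explip_const].
    apply explip_plus; [apply explip_scal, explip_nJ|apply explip_const].
  - apply explip_scal. apply (explip_exp (N * N) mJ (2 * (b + kap) * v2) (2 * (b + kap) * v2)).
    + pose proof b_pos. pose proof kap_pos. pose proof v2_nonneg. nra.
    + pose proof b_pos. pose proof kap_pos. pose proof v2_nonneg. nra.
    + intros J. unfold mJ, nJ. right. ring.
    + apply explip_mJ.
Qed.

(* Where [S] is large, [H <= - S]; where it is not, [S] is bounded by a function of [J]. *)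
Lemma moment_bound J : EG N (fun z => S z * exp (H J z)) <= BJ J * ZZ J.
Proof.
  set (K := (b * nJ J + lambda / 2 + 1) / kap).
  pose proof kap_pos as Hk. pose proof b_pos. pose proof (nJ_pos J).
  assert (HK : kap * K = b * nJ J + lambda / 2 + 1) by (unfold K; field; lra).
  apply Rle_trans with (EG N (fun z => K * exp (H J z) + 1)).
  - apply EG_le.
    + apply explip_mult; [apply explip_sqn|apply explip_expH].
    + apply explip_plus; [apply explip_scal, explip_expH|apply explip_const].
    + intros z. pose proof (exp_pos (H J z)). pose proof (sqn_pos N z) as HS. fold (S z) in HS.
      destruct (Rle_dec (S z) K) as [Hle|Hle]; [nra|].
      apply Rnot_le_lt in Hle.
      assert (H J z <= - S z).
      { pose proof (H_upper J z). assert (kap * K < kap * S z) by (apply Rmult_lt_compat_l; lra). nra. }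
      assert (S z * exp (H J z) <= 1).
      { apply Rle_trans with (S z * exp (- S z)); [apply Rmult_le_compat_l; [auto|now apply exp_le]|].
        pose proof (exp_ineq1_le (S z)). pose proof (exp_pos (- S z)).
        assert (exp (S z) * exp (- S z) = 1) by (rewrite <- exp_plus, Rplus_opp_r; apply exp_0). nra. }
      assert (0 <= K) by (unfold K; apply Rdiv_le_0_compat; nra). nra.
  - rewrite EG_plus by (first [apply explip_scal, explip_expH|apply explip_const]).
    rewrite EG_scal, EG_const by apply explip_expH. fold (ZZ J). unfold BJ. fold K.
    pose proof (ZZ_lower J). pose proof (exp_pos (mJ J)).
    assert (exp (mJ J) * exp (- mJ J) = 1) by (rewrite <- exp_plus, Rplus_opp_r; apply exp_0). nra.
Qed.

Lemma H_lip_J J J' z : Rabs (H J z - H J' z) <= b * dist1 (N * N) J J' * S z.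
Proof.
  rewrite !H_eq.
  replace (b * quad N J z - kap * S z ^ 2 + lambda / 2 * S z - (b * quad N J' z - kap * S z ^ 2 + lambda / 2 * S z))
    with (b * (quad N J z - quad N J' z)) by ring.
  pose proof b_pos. rewrite Rabs_mult, (Rabs_right b) by lra. rewrite Rmult_assoc.
  apply Rmult_le_compat_l; [lra|]. apply quad_lip_J.
Qed.

(** Jensen's inequality under the Gibbs measure at [J]: the change of [ln ZZ] is at least the Gibbs
    mean of [H J' - H J], hence at least [- d] times that of [|z|^2]. It is run through the tangent
    line of [exp] at [- m]. *)
Lemma lnZZ_lower_lip J J' : ln (ZZ J) - b * dist1 (N * N) J J' * BJ J <= ln (ZZ J').
Proof.
  set (d := b * dist1 (N * N) J J'). set (m := d * BJ J).
  pose proof (ZZ_pos J) as Hp.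
  assert (Hd : 0 <= d) by (unfold d; pose proof b_pos; pose proof (dist1_pos (N * N) J J'); nra).
  assert (Hm : 0 <= m) by (unfold m; pose proof (BJ_ge_1 J); nra).
  assert (K : exp (- m) * ZZ J <= ZZ J').
  { apply Rle_trans with (EG N (fun z => exp (- m) * ((1 + m) * exp (H J z) - d * (S z * exp (H J z))))).
    - assert (c1 := explip_expH J).
      assert (c2 : explip N (fun z => S z * exp (H J z))) by (apply explip_mult; [apply explip_sqn|auto]).
      rewrite EG_scal by (apply explip_minus; now apply explip_scal).
      rewrite EG_minus by now apply explip_scal.
      rewrite !EG_scal by auto. fold (ZZ J).
      pose proof (moment_bound J). pose proof (exp_pos (- m)).
      assert (d * EG N (fun z => S z * exp (H J z)) <= m * ZZ J).
      { unfold m. rewrite Rmult_assoc. now apply Rmult_le_compat_l. }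
      apply Rmult_le_compat_l; lra.
    - apply EG_le; [|apply explip_expH|].
      + apply explip_scal, explip_minus; apply explip_scal; [|apply explip_mult; [apply explip_sqn|]]; apply explip_expH.
      + intros z. pose proof (H_lip_J J J' z) as HL. apply Rabs_le_between in HL. fold d in HL.
        pose proof (exp_ineq1_le (m + (H J' z - H J z))) as He.
        assert (Hx : exp (H J' z) = exp (- m) * (exp (H J z) * exp (m + (H J' z - H J z))))
          by (rewrite <- !exp_plus; f_equal; ring).
        rewrite Hx. apply Rmult_le_compat_l; [apply Rlt_le, exp_pos|].
        replace ((1 + m) * exp (H J z) - d * (S z * exp (H J z))) with (exp (H J z) * (1 + m - d * S z)) by ring.
        apply Rmult_le_compat_l; [apply Rlt_le, exp_pos|]. lra. }
  assert (L : ln (exp (- m) * ZZ J) <= ln (ZZ J')).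
  { apply ln_le'; auto. apply Rmult_lt_0_compat; [apply exp_pos|auto]. }
  rewrite ln_mult, ln_exp in L by (auto; apply exp_pos). unfold m, d in *. lra.
Qed.

Lemma explip_lnZZ : explip (N * N) (fun J => ln (ZZ J)).
Proof.
  destruct (explip_growth _ _ explip_BJ) as (C & a & HC & Ha & HB).
  pose proof b_pos. exists (b * (2 * C)), a. split; [nra|split; [auto|]]. intros J J'.
  pose proof (lnZZ_lower_lip J J') as L1. pose proof (lnZZ_lower_lip J' J) as L2.
  replace (dist1 (N * N) J' J) with (dist1 (N * N) J J') in L2
    by (apply sumR_ext; intros; apply Rabs_minus_sym).
  assert (B1 := HB J). assert (B2 := HB J').
  pose proof (Rle_abs (BJ J)). pose proof (Rle_abs (BJ J')).
  pose proof (wt_ge_1 (N * N) a J Ha). pose proof (wt_ge_1 (N * N) a J' Ha).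
  set (d := dist1 (N * N) J J') in *. assert (Hd : 0 <= d) by apply dist1_pos.
  set (P := wt (N * N) a J * wt (N * N) a J').
  assert (wt (N * N) a J <= P) by (unfold P; nra). assert (wt (N * N) a J' <= P) by (unfold P; nra).
  assert (BJ J <= 2 * C * P) by nra. assert (BJ J' <= 2 * C * P) by nra.
  assert (0 <= b * d) by nra.
  assert (b * d * BJ J <= b * d * (2 * C * P)) by (apply Rmult_le_compat_l; auto).
  assert (b * d * BJ J' <= b * d * (2 * C * P)) by (apply Rmult_le_compat_l; auto).
  apply Rabs_le. nra.
Qed.

(** Chosen to cover both cases of the truncation estimate; [topH + mJ + 1] is the crude gap between
    [ln (ZZ J)] and the truncated logarithm. *)
Definition DJ (J : nat -> R) : R := 2 * BJ J * (1 + (topH J + mJ J + 1)).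

Lemma explip_DJ : explip (N * N) DJ.
Proof.
  apply explip_mult; [apply explip_scal, explip_BJ|]. apply explip_plus; [apply explip_const|].
  apply explip_plus; [|apply explip_const]. apply explip_plus; [apply explip_topH|apply explip_mJ].
Qed.

Lemma ln2_le_1 : ln 2 <= 1.
Proof. pose proof (ln_le_minus_1 2 ltac:(lra)). lra. Qed.

Lemma topH_nonneg J : 0 <= topH J.
Proof. unfold topH. apply Rdiv_le_0_compat; [apply pow2_ge_0|]. pose proof kap_pos; lra. Qed.

(** By Markov's inequality the cut-off loses at most the fraction [u = BJ J / L^2] of [ZZ J]. For
    [u <= 1/2] one has [- ln (1 - u) <= 2 u]; otherwise [2 u > 1] and the crude gap between the
    logarithms is multiplied by it. *)
Lemma truncation X L J : explip N X -> (forall z, 0 <= X z <= 1) -> 1 / 2 <= EG N X -> 0 < L ->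
  (forall z, 1 - X z <= S z * / L ^ 2) ->
  ln (ZZ J) <= ln (EG N (fun z => X z * exp (H J z))) + DJ J * / L ^ 2.
Proof.
  intros cX HX HE HL HT.
  set (ZX := EG N (fun z => X z * exp (H J z))).
  assert (LX := cut_lower X J cX HX HE). fold ZX in LX. pose proof (exp_pos (- mJ J)).
  assert (HZX : 0 < ZX) by lra. pose proof (ZZ_pos J) as HZ.
  assert (HL2 : 0 < / L ^ 2) by (apply Rinv_0_lt_compat; nra).
  set (u := BJ J * / L ^ 2).
  assert (Hu : 0 < u) by (unfold u; pose proof (BJ_ge_1 J); nra).
  assert (Hdiff : ZZ J * (1 - u) <= ZX).
  { assert (c1 : explip N (fun z => S z * exp (H J z))) by (apply explip_mult; [apply explip_sqn|apply explip_expH]).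
    assert (c2 := explip_expH J).
    assert (EG N (fun z => exp (H J z) - / L ^ 2 * (S z * exp (H J z))) <= ZX).
    { apply EG_le.
      - apply explip_minus; [auto|now apply explip_scal].
      - now apply explip_mult.
      - intros z. specialize (HT z). pose proof (exp_pos (H J z)). nra. }
    rewrite EG_minus, EG_scal in H1 by (auto; now apply explip_scal). fold (ZZ J) in H1.
    pose proof (moment_bound J).
    assert (/ L ^ 2 * EG N (fun z => S z * exp (H J z)) <= / L ^ 2 * (BJ J * ZZ J)) by (apply Rmult_le_compat_l; lra).
    unfold u. lra. }
  assert (HQ : 0 <= topH J + mJ J + 1) by (pose proof (topH_nonneg J); pose proof (mJ_nonneg J); lra).
  replace (DJ J * / L ^ 2) with (2 * u * (1 + (topH J + mJ J + 1))) by (unfold DJ, u; ring).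
  destruct (Rle_dec u (1/2)) as [Hs|Hs].
  - assert (L1 : ln (ZZ J * (1 - u)) <= ln ZX) by (apply ln_le'; auto; nra).
    rewrite ln_mult in L1 by lra.
    assert (L2 : - (2 * u) <= ln (1 - u)).
    { pose proof (ln_le_minus_1 (/ (1 - u)) ltac:(apply Rinv_0_lt_compat; lra)) as L2.
      rewrite ln_Rinv in L2 by lra.
      assert (/ (1 - u) - 1 <= 2 * u).
      { apply (Rmult_le_reg_l (1 - u)); [lra|]. rewrite Rmult_minus_distr_l, Rinv_r by lra. nra. }
      lra. }
    nra.
  - assert (U : ln (ZZ J) <= topH J).
    { rewrite <- (ln_exp (topH J)). apply ln_le'; [auto|apply ZZ_upper]. }
    assert (Lw : - mJ J - 1 <= ln ZX).
    { assert (ln (exp (- mJ J) / 2) <= ln ZX) by (apply ln_le'; lra).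
      unfold Rdiv in H1. rewrite ln_mult, ln_exp, ln_Rinv in H1 by lra. pose proof ln2_le_1. lra. }
    assert (1 < 2 * u) by lra. nra.
Qed.

(** Modulus of continuity of [H J] on the enlarged box: [16 * L^2 / r] bounds the change of each
    product [z i * z j], and [32 * INR N * L^2] bounds [S z + S z'] in the difference of the quartic
    terms. *)
Definition EJ (L : R) (J : nat -> R) : R :=
  (b * nJ J + kap * (32 * INR N * L ^ 2) * INR N + lambda / 2 * INR N) * (16 * L ^ 2).

Lemma explip_EJ L : explip (N * N) (EJ L).
Proof.
  apply explip_mult; [|apply explip_const]. apply explip_plus; [|apply explip_const].
  apply explip_plus; [|apply explip_const]. apply explip_scal, explip_nJ.
Qed.

Lemma H_lip_z L r J z z' : 1 <= L -> 1 <= r ->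
  (forall i, (i < N)%nat -> Rabs (z i - z' i) <= 2 * L / r /\ Rabs (z' i) <= 2 * L) ->
  H J z <= H J z' + EJ L J / r.
Proof.
  intros HL Hr Hz.
  set (del := 2 * L / r) in *.
  assert (Hdel : 0 <= del <= 2 * L).
  { unfold del. split; [apply Rdiv_le_0_compat; lra|]. apply Rle_div_l; nra. }
  assert (Hb : forall i, (i < N)%nat -> Rabs (z i) <= 4 * L).
  { intros i Hi. destruct (Hz i Hi). replace (z i) with ((z i - z' i) + z' i) by ring.
    eapply Rle_trans; [apply Rabs_triang|]. lra. }
  (* The product rule gives [4 L del + 2 L del], rounded up. *)
  set (B := 8 * L * del).
  assert (HB : 0 <= B) by (unfold B; nra).
  assert (Hprod : forall i j, (i < N)%nat -> (j < N)%nat -> Rabs (z i * z j - z' i * z' j) <= B).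
  { intros i j Hi Hj. destruct (Hz i Hi). destruct (Hz j Hj). pose proof (Hb i Hi).
    replace (z i * z j - z' i * z' j) with (z i * (z j - z' j) + (z i - z' i) * z' j) by ring.
    eapply Rle_trans; [apply Rabs_triang|]. rewrite !Rabs_mult.
    pose proof (Rabs_pos (z i)). pose proof (Rabs_pos (z j - z' j)). pose proof (Rabs_pos (z i - z' i)). pose proof (Rabs_pos (z' j)).
    assert (Rabs (z i) * Rabs (z j - z' j) <= 4 * L * del) by (apply Rmult_le_compat; lra).
    assert (Rabs (z i - z' i) * Rabs (z' j) <= del * (2 * L)) by (apply Rmult_le_compat; lra).
    unfold B. nra. }
  pose proof INR_N as HN'. pose proof b_pos. pose proof kap_pos.
  assert (Q := quad_lip_z N J z z' B HB Hprod). fold (nJ J) in Q.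
  assert (HS : Rabs (S z - S z') <= INR N * B).
  { unfold S, sqn. rewrite <- sumR_minus. eapply Rle_trans; [apply Rabs_sumR|].
    rewrite <- sumR_const. apply sumR_le. intros i Hi. replace (z i ^ 2 - z' i ^ 2) with (z i * z i - z' i * z' i) by ring. auto. }
  assert (S1 : 0 <= S z <= INR N * (16 * L ^ 2)).
  { split; [apply sqn_pos|]. unfold S, sqn. rewrite <- sumR_const. apply sumR_le. intros i Hi.
    specialize (Hb i Hi). rewrite <- pow2_abs. pose proof (Rabs_pos (z i)). nra. }
  assert (S2 : 0 <= S z' <= INR N * (16 * L ^ 2)).
  { split; [apply sqn_pos|]. unfold S, sqn. rewrite <- sumR_const. apply sumR_le. intros i Hi.
    destruct (Hz i Hi). rewrite <- pow2_abs. pose proof (Rabs_pos (z' i)). nra. }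
  rewrite !H_eq. apply Rabs_le_between in Q. apply Rabs_le_between in HS.
  assert (b * (quad N J z - quad N J z') <= b * (nJ J * B)) by (apply Rmult_le_compat_l; lra).
  assert (lambda / 2 * (S z - S z') <= lambda / 2 * (INR N * B)) by (apply Rmult_le_compat_l; lra).
  assert (K1 : (S z' - S z) * (S z' + S z) <= (INR N * B) * (32 * INR N * L ^ 2)).
  { apply Rle_trans with ((INR N * B) * (S z' + S z)).
    - apply Rmult_le_compat_r; lra.
    - apply Rmult_le_compat_l; [nra|lra]. }
  assert (kap * ((S z' - S z) * (S z' + S z)) <= kap * ((INR N * B) * (32 * INR N * L ^ 2))) by (apply Rmult_le_compat_l; lra).
  assert (EE : EJ L J / r = (b * nJ J + kap * (32 * INR N * L ^ 2) * INR N + lambda / 2 * INR N) * B).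
  { unfold EJ, B, del. field. lra. }
  rewrite EE. nra.
Qed.

End PartitionFunction.

(** * Removal of the discretisation and the variational formula *)

Lemma explip_ln_expsum n Q (w : nat -> R) (h : nat -> (nat -> R) -> R) a0 (A B : nat -> R) :
  (forall a, (a < Q)%nat -> 0 <= w a) -> (a0 < Q)%nat -> 0 < w a0 ->
  (forall a, 0 <= A a) -> (forall a, 0 <= B a) ->
  (forall a, explip n (h a)) -> (forall a y, Rabs (h a y) <= A a + B a * norm1 n y) ->
  explip n (fun y => ln (sumR Q (fun a => w a * exp (h a y)))).
Proof.
  intros Hw Ha0 Hw0 HA HB Hc Hb.
  apply (explip_ln n _ (w a0 * exp (- A a0)) (B a0)); auto.
  - apply Rmult_lt_0_compat; auto. apply exp_pos.
  - intros y. apply Rle_trans with (w a0 * exp (h a0 y)).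
    + rewrite Rmult_assoc. apply Rmult_le_compat_l; [lra|]. unfold wt. rewrite <- exp_plus. apply exp_le.
      specialize (Hb a0 y). apply Rabs_le_between in Hb. lra.
    + apply (sumR_term_le Q (fun a => w a * exp (h a y))); auto.
      intros a Ha. apply Rmult_le_pos; auto. apply Rlt_le, exp_pos.
  - apply explip_sum. intros a Ha. apply explip_scal. apply (explip_exp n (h a) (A a) (B a)); auto.
    intros y. specialize (Hb a y). pose proof (Rle_abs (h a y)). lra.
Qed.

Lemma exists_pos_term Q (w : nat -> R) : 0 < sumR Q w -> exists a, (a < Q)%nat /\ 0 < w a.
Proof.
  induction Q; simpl; intros H; [lra|].
  destruct (Rlt_dec 0 (w Q)) as [K|K]; [exists Q; split; [lia|auto]|].
  destruct IHQ as (a & Ha & Hw); [lra|]. exists a. split; [lia|auto].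
Qed.

Lemma le_of_le_inv_nat x y c : (forall m, (1 <= m)%nat -> x <= y + c / INR m) -> x <= y.
Proof.
  intros H. apply Rnot_lt_le. intros Hlt.
  destruct (INR_unbounded (Rabs c / (x - y) + 1)) as [m Hm].
  assert (0 <= Rabs c / (x - y)) by (apply Rdiv_le_0_compat; [apply Rabs_pos|lra]).
  assert (1 <= m)%nat by (apply INR_le; simpl; lra).
  specialize (H m H1).
  assert (c / INR m < x - y).
  { apply Rlt_div_l; [lra|]. pose proof (Rle_abs c).
    assert ((x - y) * (Rabs c / (x - y)) = Rabs c) by (field; lra).
    assert ((x - y) * (Rabs c / (x - y)) < (x - y) * INR m) by (apply Rmult_lt_compat_l; lra). lra. }
  lra.
Qed.

Lemma norm1_shift N y : norm1 N (fun i => y (N * N + i)%nat) <= norm1 (N * N + N) y.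
Proof.
  unfold norm1. rewrite (sumR_app (N * N)).
  pose proof (sumR_nonneg (N * N) (fun i => Rabs (y i)) ltac:(intros; apply Rabs_pos)). lra.
Qed.

Lemma EG_sqn N : EG N (sqn N) = INR N.
Proof.
  unfold sqn. rewrite (EG_sum N N (fun i z => z i ^ 2)) by (intros; apply explip_pow2; now apply explip_coord).
  rewrite (sumR_ext N _ (fun _ => 1)) by (intros; now apply EG_sq). rewrite sumR_const. ring.
Qed.

Section MainBound.

Variables (N : nat) (beta lambda : R).
Hypothesis HN : (1 <= N)%nat.
Hypothesis Hbeta : 0 < beta.
Hypothesis Hlambda : 0 <= lambda.

Lemma explip_Hamil_J z : explip (N * N) (fun J => Hamil N beta lambda J z).
Proof.
  change (explip (N * N) (fun J => beta / sqrt (2 * INR N) * quad N J z - beta ^ 2 / (4 * INR N) * sqn N z ^ 2 + lambda / 2 * sqn N z)).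
  apply explip_plus; [|apply explip_const]. apply explip_minus; [|apply explip_const]. apply explip_scal.
  apply explip_sum; intros i Hi; apply explip_sum; intros j Hj.
  apply explip_mult; [|apply explip_const]. apply explip_mult; [|apply explip_const].
  apply explip_coord. now apply index_lt.
Qed.

Lemma Hamil_J_bound z J : Rabs (Hamil N beta lambda J z) <=
  Rabs (beta ^ 2 / (4 * INR N) * sqn N z ^ 2 - lambda / 2 * sqn N z) +
  beta / sqrt (2 * INR N) * sqn N z * norm1 (N * N) J.
Proof.
  change (Hamil N beta lambda J z) with
   (beta / sqrt (2 * INR N) * quad N J z - beta ^ 2 / (4 * INR N) * sqn N z ^ 2 + lambda / 2 * sqn N z).
  set (b := beta / sqrt (2 * INR N)).
  assert (Hb : 0 < b) by (apply (b_pos N beta); auto).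
  set (s := sqn N z). set (q := quad N J z).
  replace (b * q - beta ^ 2 / (4 * INR N) * s ^ 2 + lambda / 2 * s)
    with (- (beta ^ 2 / (4 * INR N) * s ^ 2 - lambda / 2 * s) + b * q) by ring.
  eapply Rle_trans; [apply Rabs_triang|]. rewrite Rabs_Ropp, Rabs_mult, (Rabs_right b) by lra.
  pose proof (quad_bound N J z) as Q. fold q in Q. fold s in Q.
  rewrite Rmult_assoc. assert (b * Rabs q <= b * (norm1 (N * N) J * s)) by (apply Rmult_le_compat_l; lra). lra.
Qed.

(** The weights are means of the [T a], so the node sum is itself a mean over [z]. On the support of
    [T a] the node may be exchanged for [z] at the cost of one mesh error, the total weight is at
    most 1, and the remaining Gaussian integral is explicit. *)
Lemma Yd_upper L m Q T zeta : 1 <= L -> (1 <= m)%nat ->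
  (forall a, (a < Q)%nat -> explip N (T a)) ->
  (forall a z, (a < Q)%nat -> 0 <= T a z) ->
  (forall z, 0 <= sumR Q (fun a => T a z) <= 1) ->
  (forall a z, (a < Q)%nat -> T a z <> 0 -> forall i, (i < N)%nat ->
       Rabs (z i - zeta a i) <= 2 * L / INR m /\ Rabs (zeta a i) <= 2 * L) ->
  forall y, Yd N lambda Q (fun a => EG N (T a)) zeta y <=
    exp (sqrt lambda * (2 * L) / INR m * norm1 (N * N + N) y
         + lambda / 2 * sumR N (fun i => y (N * N + i)%nat ^ 2)).
Proof.
  intros HL Hm cT HT HT1 HTs y.
  assert (Hm' : 1 <= INR m) by (apply le_INR in Hm; exact Hm).
  set (g := fun i => y (N * N + i)%nat). set (del := 2 * L / INR m) in *.
  assert (Hdel : 0 <= del) by (apply Rdiv_le_0_compat; lra).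
  set (om := sqrt lambda * (del * norm1 (N * N + N) y)).
  pose proof (sqrt_pos lambda) as Hsl.
  set (G := fun z => exp (sumR N (fun i => (sqrt lambda * g i) * z i))).
  assert (cG : explip N G) by apply explip_exp_linear.
  assert (E : Yd N lambda Q (fun a => EG N (T a)) zeta y =
     EG N (fun z => sumR Q (fun a => G (zeta a) * T a z))).
  { rewrite (EG_sum N Q (fun a z => G (zeta a) * T a z)) by (intros; now apply explip_scal, cT).
    unfold Yd. apply sumR_ext. intros a Ha. rewrite EG_scal by now apply cT.
    rewrite Rmult_comm. f_equal. unfold G. f_equal. rewrite <- sumR_scal. apply sumR_ext; intros; unfold g; ring. }
  rewrite E.
  apply Rle_trans with (EG N (fun z => exp om * G z)).
  - apply EG_le; [apply explip_sum; intros; now apply explip_scal, cT|now apply explip_scal|].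
    intros z.
    apply Rle_trans with (sumR Q (fun a => exp om * G z * T a z)).
    + apply sumR_le. intros a Ha. specialize (HT a z Ha).
      destruct (Req_dec (T a z) 0) as [->|Hne]; [lra|].
      apply Rmult_le_compat_r; auto. unfold G. rewrite <- exp_plus. apply exp_le.
      assert (Hd : sumR N (fun i => sqrt lambda * g i * zeta a i) - sumR N (fun i => sqrt lambda * g i * z i) <= om); [|lra].
      rewrite <- sumR_minus.
      apply Rle_trans with (sqrt lambda * (del * norm1 N g)).
      * unfold norm1. rewrite <- !sumR_scal. apply sumR_le. intros i Hi.
        destruct (HTs a z Ha Hne i Hi) as [K _].
        replace (sqrt lambda * g i * zeta a i - sqrt lambda * g i * z i) with (sqrt lambda * (- (g i * (z i - zeta a i)))) by ring.
        apply Rmult_le_compat_l; auto.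
        eapply Rle_trans; [apply Rle_abs|]. rewrite Rabs_Ropp, Rabs_mult, (Rmult_comm del).
        apply Rmult_le_compat_l; [apply Rabs_pos|auto].
      * apply Rmult_le_compat_l; auto. apply Rmult_le_compat_l; auto. apply norm1_shift.
    + rewrite sumR_scal. specialize (HT1 z).
      assert (0 < exp om * G z) by (apply Rmult_lt_0_compat; apply exp_pos). nra.
  - rewrite EG_scal by auto. unfold G. rewrite EG_exp_linear, <- exp_plus. apply exp_le. right.
    unfold om, del. f_equal; [field; lra|].
    rewrite (sumR_ext N _ (fun i => lambda * g i ^ 2)).
    + rewrite sumR_scal. unfold g. field.
    + intros i Hi. rewrite <- (pow2_sqrt lambda Hlambda) at 2. ring.
Qed.

Lemma discretisation L m Q T zeta : 1 <= L -> (1 <= m)%nat ->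
  (forall a, (a < Q)%nat -> explip N (T a)) ->
  (forall a z, (a < Q)%nat -> 0 <= T a z) ->
  (forall a z, (a < Q)%nat -> T a z <> 0 -> forall i, (i < N)%nat ->
       Rabs (z i - zeta a i) <= 2 * L / INR m /\ Rabs (zeta a i) <= 2 * L) ->
  forall J, EG N (fun z => sumR Q (fun a => T a z) * exp (Hamil N beta lambda J z)) <=
    exp (EJ N beta lambda L J / INR m) * Zd N beta lambda Q (fun a => EG N (T a)) zeta J.
Proof.
  intros HL Hm cT HT HTs J.
  assert (Hm' : 1 <= INR m) by (apply le_INR in Hm; exact Hm).
  set (om := EJ N beta lambda L J / INR m).
  assert (E : exp om * Zd N beta lambda Q (fun a => EG N (T a)) zeta J =
    EG N (fun z => sumR Q (fun a => (exp om * exp (Hamil N beta lambda J (zeta a))) * T a z))).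
  { rewrite (EG_sum N Q (fun a z => (exp om * exp (Hamil N beta lambda J (zeta a))) * T a z))
      by (intros; now apply explip_scal, cT).
    unfold Zd. rewrite <- sumR_scal. apply sumR_ext. intros a Ha. rewrite EG_scal by now apply cT. ring. }
  rewrite E. apply EG_le.
  - apply explip_mult; [now apply explip_sum|now apply explip_expH].
  - apply explip_sum; intros; now apply explip_scal, cT.
  - intros z. rewrite <- sumR_scal_r. apply sumR_le. intros a Ha. specialize (HT a z Ha).
    (* Off the support of [T a] both sides vanish; on it, [z] and the node are close enough for
       [H_lip_z]. *)
    destruct (Req_dec (T a z) 0) as [->|Hne]; [lra|].
    rewrite (Rmult_comm (T a z)). apply Rmult_le_compat_r; auto.
    rewrite <- exp_plus. apply exp_le. rewrite Rplus_comm.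
    apply (H_lip_z N beta lambda HN Hbeta Hlambda L (INR m) J z (zeta a) HL Hm').
    now apply HTs.
Qed.

(** Truncation and discretisation bring the mean down to the node model, interpolation passes to the
    linear one, and [Yd_upper] evaluates that. The numerator over [INR m] involves [L] but neither
    [m] nor the nodes. *)
Lemma bound_with_errors L m : 1 <= L -> 2 * INR N <= L ^ 2 -> (1 <= m)%nat ->
  EG (N * N) (fun J => ln (ZZ N beta lambda J)) <=
    INR N * (lambda / 2 + lambda ^ 2 / (4 * beta ^ 2))
    + (sqrt lambda * (2 * L) * EG (N * N + N) (norm1 (N * N + N)) + EG (N * N) (EJ N beta lambda L)) / INR m
    + EG (N * N) (DJ N beta lambda) * / L ^ 2.
Proof.
  intros HL HL2 Hm.
  assert (Hm' : 1 <= INR m) by (apply le_INR in Hm; exact Hm).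
  pose proof (INR_N N HN) as HN'.
  destruct (nodes_exist N L m HL Hm) as (Q & T & zeta & cT & HT & HT1 & HTt & HTs).
  set (X := fun z => sumR Q (fun a => T a z)).
  assert (cX : explip N X) by now apply explip_sum.
  (* Chebyshev's inequality with [EG N (sqn N) = INR N]; this is where [2 * INR N <= L ^ 2]
     enters. *)
  assert (HX : 1 / 2 <= EG N X).
  { apply Rle_trans with (EG N (fun z => 1 - / L ^ 2 * sqn N z)).
    - rewrite EG_minus by (first [apply explip_const|apply explip_scal, explip_sqn]).
      rewrite EG_scal, EG_const, EG_sqn by apply explip_sqn.
      assert (/ L ^ 2 * INR N <= 1 / 2); [|lra].
      apply (Rmult_le_reg_l (L ^ 2)); [nra|]. rewrite <- Rmult_assoc, Rinv_r by nra. lra.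
    - apply EG_le; [apply explip_minus; [apply explip_const|apply explip_scal, explip_sqn]|auto|].
      intros z. specialize (HTt z). unfold sqn. fold (X z) in HTt. lra. }
  set (w := fun a => EG N (T a)).
  assert (Hw : forall a, (a < Q)%nat -> 0 <= w a) by (intros a Ha; apply EG_nonneg; auto).
  assert (Hws : sumR Q w = EG N X) by (unfold X; rewrite (EG_sum N Q T); auto).
  destruct (exists_pos_term Q w) as (a0 & Ha0 & Hw0); [lra|].
  assert (cZd : explip (N * N) (fun J => ln (Zd N beta lambda Q w zeta J))).
  { apply (explip_ln_expsum (N * N) Q w (fun a J => Hamil N beta lambda J (zeta a)) a0
      (fun a => Rabs (beta ^ 2 / (4 * INR N) * sqn N (zeta a) ^ 2 - lambda / 2 * sqn N (zeta a)))
      (fun a => beta / sqrt (2 * INR N) * sqn N (zeta a))); auto.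
    - intros; apply Rabs_pos.
    - intros a. pose proof (b_pos N beta HN Hbeta). pose proof (sqn_pos N (zeta a)). apply Rmult_le_pos; lra.
    - intros; apply explip_Hamil_J.
    - intros; apply Hamil_J_bound. }
  assert (cYd : explip (N * N + N) (fun y => ln (Yd N lambda Q w zeta y))).
  { apply (explip_ln_expsum (N * N + N) Q w (fun a y => sqrt lambda * sumR N (fun i => y (N * N + i)%nat * zeta a i)) a0
      (fun a => 0) (fun a => sqrt lambda * norm1 N (zeta a))); auto.
    - intros; lra.
    - intros a. apply Rmult_le_pos; [apply sqrt_pos|apply norm1_pos].
    - intros a. apply explip_scal, explip_sum. intros i Hi. apply explip_mult; [apply explip_coord; lia|apply explip_const].
    - intros a y. rewrite Rabs_mult, (Rabs_right (sqrt lambda)) by (apply Rle_ge, sqrt_pos).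
      rewrite Rplus_0_l, Rmult_assoc. apply Rmult_le_compat_l; [apply sqrt_pos|].
      eapply Rle_trans; [apply Rabs_sumR|].
      apply Rle_trans with (norm1 N (zeta a) * norm1 N (fun i => y (N * N + i)%nat)).
      + unfold norm1 at 2. rewrite <- sumR_scal. apply sumR_le. intros i Hi. rewrite Rabs_mult, Rmult_comm.
        apply Rmult_le_compat_r; [apply Rabs_pos|now apply norm1_coord].
      + apply Rmult_le_compat_l; [apply norm1_pos|apply norm1_shift]. }
  assert (cE := explip_EJ N beta lambda L). assert (cD := explip_DJ N beta lambda HN Hbeta).
  assert (S1 : EG (N * N) (fun J => ln (ZZ N beta lambda J)) <=
    EG (N * N) (fun J => ln (Zd N beta lambda Q w zeta J)) + EG (N * N) (EJ N beta lambda L) / INR m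
    + EG (N * N) (DJ N beta lambda) * / L ^ 2).
  { replace (EG (N * N) (fun J => ln (Zd N beta lambda Q w zeta J)) + EG (N * N) (EJ N beta lambda L) / INR m
      + EG (N * N) (DJ N beta lambda) * / L ^ 2)
      with (EG (N * N) (fun J => ln (Zd N beta lambda Q w zeta J) + (/ INR m * EJ N beta lambda L J + / L ^ 2 * DJ N beta lambda J))).
    2:{ rewrite EG_plus by (auto; apply explip_plus; now apply explip_scal).
        rewrite EG_plus, !EG_scal by (auto; now apply explip_scal). unfold Rdiv. ring. }
    apply EG_le.
    - now apply explip_lnZZ.
    - apply explip_plus; [auto|apply explip_plus; now apply explip_scal].
    - intros J.
      pose proof (truncation N beta lambda HN Hbeta Hlambda X L J cX HT1 HX ltac:(lra) HTt) as Tr.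
      pose proof (discretisation L m Q T zeta HL Hm cT HT HTs J) as Di. fold w in Di.
      pose proof (cut_lower N beta lambda HN Hbeta Hlambda X J cX HT1 HX) as Lo.
      assert (Hpos : 0 < EG N (fun z => X z * exp (Hamil N beta lambda J z))).
      { pose proof (exp_pos (- mJ N beta J)). lra. }
      assert (Hzd : 0 < Zd N beta lambda Q w zeta J).
      { pose proof (exp_pos (EJ N beta lambda L J / INR m)). unfold X in Hpos. nra. }
      apply ln_le' in Di; [|exact Hpos]. rewrite ln_mult, ln_exp in Di by (auto; apply exp_pos).
      change (fun z => sumR Q (fun a => T a z) * exp (Hamil N beta lambda J z))
        with (fun z => X z * exp (Hamil N beta lambda J z)) in Di.
      unfold Rdiv in Di. lra. }
  (* The linear field is adjoined as [N] further independent coordinates, as the interpolation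
     requires. *)
  rewrite <- (EG_extend (N * N) N _ cZd) in S1.
  pose proof (guerra_nodes N beta lambda Q w zeta a0 HN Hbeta Hlambda Hw Ha0 Hw0) as S2.
  assert (S3 : EG (N * N + N) (fun y => ln (Yd N lambda Q w zeta y)) <=
    sqrt lambda * (2 * L) / INR m * EG (N * N + N) (norm1 (N * N + N)) + lambda / 2 * INR N).
  { set (cg := fun y : nat -> R => sumR N (fun i => y (N * N + i)%nat ^ 2)).
    assert (cc : forall i, (i < N)%nat -> explip (N * N + N) (fun y => y (N * N + i)%nat ^ 2))
      by (intros; apply explip_pow2, explip_coord; lia).
    assert (ccg : explip (N * N + N) cg) by (apply explip_sum; auto).
    apply Rle_trans with (EG (N * N + N) (fun y => sqrt lambda * (2 * L) / INR m * norm1 (N * N + N) y + lambda / 2 * cg y)).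
    - apply EG_le; [auto|apply explip_plus; apply explip_scal; [apply explip_norm1|auto]|].
      intros y. rewrite <- (ln_exp (_ + _)). apply ln_le'.
      + unfold Yd. apply Rlt_le_trans with (w a0 * exp (sqrt lambda * sumR N (fun i => y (N * N + i)%nat * zeta a0 i))).
        * apply Rmult_lt_0_compat; [auto|apply exp_pos].
        * apply (sumR_term_le Q (fun a => w a * exp (sqrt lambda * sumR N (fun i => y (N * N + i)%nat * zeta a i)))); auto.
          intros a Ha. apply Rmult_le_pos; auto. apply Rlt_le, exp_pos.
      + now apply (Yd_upper L m).
    - rewrite EG_plus by (apply explip_scal; first [apply explip_norm1|auto]).
      rewrite !EG_scal by (first [apply explip_norm1|auto]). right. f_equal. f_equal.
      unfold cg. rewrite (EG_sum (N * N + N) N (fun i y => y (N * N + i)%nat ^ 2)) by auto.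
      rewrite (sumR_ext N _ (fun _ => 1)) by (intros; apply EG_sq; lia). rewrite sumR_const. ring. }
  unfold Rdiv in *. lra.
Qed.

(** The limits are taken in order: [m] to infinity for fixed [L], which removes the mesh errors, and
    then [L] to infinity. *)
Lemma EG_lnZZ_le : EG (N * N) (fun J => ln (ZZ N beta lambda J)) <=
    INR N * (lambda / 2 + lambda ^ 2 / (4 * beta ^ 2)).
Proof.
  pose proof (INR_N N HN) as HN'.
  set (d := EG (N * N) (DJ N beta lambda)).
  apply le_of_le_inv_nat with (Rabs d). intros l Hl.
  assert (Hl' : 1 <= INR l) by (apply le_INR in Hl; exact Hl).
  (* This meets both size conditions on [L] and gives [/ L ^ 2 <= / INR l]. *)
  set (L := INR l * (2 * INR N)).
  assert (L1 : 1 <= L) by (unfold L; nra).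
  assert (L2 : 2 * INR N <= L ^ 2).
  { assert (2 * INR N <= L) by (unfold L; nra). nra. }
  apply Rle_trans with (INR N * (lambda / 2 + lambda ^ 2 / (4 * beta ^ 2)) + d * / L ^ 2).
  - eapply le_of_le_inv_nat. intros m Hm.
    pose proof (bound_with_errors L m L1 L2 Hm) as B. fold d in B.
    eapply Rle_trans; [exact B|]. right. rewrite !Rplus_assoc. f_equal. apply Rplus_comm.
  - apply Rplus_le_compat_l. unfold Rdiv.
    assert (/ L ^ 2 <= / INR l).
    { apply Rinv_le_contravar; [lra|].
      assert (INR l <= L) by (unfold L; nra). nra. }
    assert (0 < / L ^ 2) by (apply Rinv_0_lt_compat; nra).
    pose proof (Rle_abs d). pose proof (Rabs_pos d). nra.
Qed.

End MainBound.

(** The quadratic term scales by [s^2] and the quartic one by [s^4], consistently with coefficients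
    proportional to [beta] and [beta^2]. The ratio of densities only alters the coefficient of
    [|z|^2], to [(1 - s^2 (1 - lambda)) / 2]. *)
Lemma Z_N_scale N beta lambda s J : (1 <= N)%nat -> 0 < beta -> 0 < s ->
  Z_N N beta lambda J = s ^ N * ZZ N (beta * s ^ 2) (1 - s ^ 2 * (1 - lambda)) J.
Proof.
  intros HN Hb Hs.
  assert (E : forall z, exp (Hamil N beta lambda J (fun i => s * z i)) * exp ((1 - s ^ 2) / 2 * sumR N (fun i => z i ^ 2))
     = exp (Hamil N (beta * s ^ 2) (1 - s ^ 2 * (1 - lambda)) J z)).
  { intros z. rewrite <- exp_plus. f_equal. unfold Hamil.
    rewrite (sumR_ext N (fun i => sumR N (fun j => Jentry N J i j * (s * z i) * (s * z j)))
      (fun i => s ^ 2 * sumR N (fun j => Jentry N J i j * z i * z j))).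
    2:{ intros i Hi. rewrite <- sumR_scal. apply sumR_ext; intros; ring. }
    rewrite (sumR_ext N (fun i => (s * z i) ^ 2) (fun i => s ^ 2 * z i ^ 2)) by (intros; ring).
    rewrite !sumR_scal. unfold Rdiv. ring. }
  assert (E' : (fun z => exp (Hamil N beta lambda J (fun i => s * z i)) * exp ((1 - s ^ 2) / 2 * sumR N (fun i => z i ^ 2)))
    = (fun z => exp (Hamil N (beta * s ^ 2) (1 - s ^ 2 * (1 - lambda)) J z)))
    by (apply functional_extensionality; exact E).
  assert (Hb' : 0 < beta * s ^ 2) by (apply Rmult_lt_0_compat; [auto|now apply pow_lt]).
  rewrite Z_N_eq by auto. unfold ZZ at 1.
  rewrite (EG_scale s N Hs (fun z => exp (Hamil N beta lambda J z))).
  - now rewrite E'.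
  - now apply explip_expH.
  - rewrite E'. now apply explip_expH.
Qed.

Lemma A_N_le N beta lambda s : (1 <= N)%nat -> 0 < beta -> 0 < s -> 0 <= 1 - s ^ 2 * (1 - lambda) ->
  A_N N beta lambda <= ln s + (1 - s ^ 2 * (1 - lambda)) / 2 + (1 - s ^ 2 * (1 - lambda)) ^ 2 / (4 * (beta * s ^ 2) ^ 2).
Proof.
  intros HN Hb Hs Hl. set (l := 1 - s ^ 2 * (1 - lambda)) in *. set (b := beta * s ^ 2).
  assert (Hb' : 0 < b) by (apply Rmult_lt_0_compat; [auto|now apply pow_lt]).
  pose proof (INR_N N HN) as HN'.
  assert (E : (fun J => ln (Z_N N beta lambda J)) = (fun J => INR N * ln s + ln (ZZ N b l J))).
  { apply functional_extensionality; intros J. rewrite (Z_N_scale N beta lambda s) by auto.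
    pose proof (ZZ_pos N b l HN Hb' Hl J).
    rewrite ln_mult by (auto; now apply pow_lt). rewrite ln_pow by auto. reflexivity. }
  unfold A_N. rewrite E.
  assert (cZ : explip (N * N) (fun J => ln (ZZ N b l J))) by now apply explip_lnZZ.
  rewrite Egauss_EG by (apply explip_plus; [apply explip_const|auto]).
  rewrite EG_plus, EG_const by (auto; apply explip_const).
  pose proof (EG_lnZZ_le N b l HN Hb' Hl) as B.
  apply (Rmult_le_reg_l (INR N)); [lra|]. rewrite <- Rmult_assoc, Rinv_r, Rmult_1_l by lra.
  lra.
Qed.

(** * Minimisation of the replica symmetric functional *)

Section ReplicaSymmetricInfimum.

Variables (beta lambda : R).
Hypothesis Hbeta : 0 < beta.

Let Dd q := 1 - lambda + beta ^ 2 * q.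

Lemma Atilde_eq q : 0 < Dd q ->
  Atilde beta lambda q = - (1 / 2) * ln (Dd q) + 1 / 2 * beta ^ 2 * q / Dd q + beta ^ 2 / 4 * q ^ 2.
Proof.
  intros H. unfold Atilde, sigma. fold (Dd q).
  assert (Hs : 0 < sqrt (Dd q)) by now apply sqrt_lt_R0.
  rewrite ln_Rinv by auto.
  assert (E : ln (Dd q) = 2 * ln (sqrt (Dd q))).
  { rewrite <- (sqrt_sqrt (Dd q)) at 1 by lra. rewrite ln_mult by auto. ring. }
  rewrite E. rewrite pow_inv, pow2_sqrt by lra. unfold Rdiv. field. lra.
Qed.

(** The derivative of [Atilde] is [1/2 * beta^2 * q * (1 - beta^2 / Dd q^2)]: for [q >= 0] its sign
    is decided by comparing the increasing function [Dd] with [beta]. *)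
Lemma Atilde_mvt q0 q : D_set beta lambda q0 -> D_set beta lambda q ->
  exists c, Rmin q0 q <= c <= Rmax q0 q /\
    Atilde beta lambda q - Atilde beta lambda q0 = 1 / 2 * beta ^ 2 * c * (1 - beta ^ 2 / Dd c ^ 2) * (q - q0).
Proof.
  intros [H0 K0] [H1 K1].
  assert (HD : forall x, Rmin q0 q <= x <= Rmax q0 q -> 0 < Dd x).
  { intros x Hx. assert (0 < beta ^ 2) by nra. unfold Dd.
    destruct (Rle_dec q0 q); [rewrite Rmin_left in Hx by lra|rewrite Rmin_right in Hx by lra]; nra. }
  set (g := fun q => - (1 / 2) * ln (Dd q) + 1 / 2 * beta ^ 2 * q / Dd q + beta ^ 2 / 4 * q ^ 2).
  assert (D : forall x, Rmin q0 q <= x <= Rmax q0 q -> is_derive g x (1 / 2 * beta ^ 2 * x * (1 - beta ^ 2 / Dd x ^ 2))).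
  { intros x Hx. specialize (HD x Hx). unfold g, Dd in *. auto_derive.
    - split; [exact HD|]. split; [lra|auto].
    - simpl. field. simpl in HD. lra. }
  destruct (MVT_gen g q0 q (fun x => 1 / 2 * beta ^ 2 * x * (1 - beta ^ 2 / Dd x ^ 2))) as [c [Hc Hc']].
  - intros x Hx. apply D. lra.
  - intros x Hx. apply derivable_continuous_pt. eexists. apply is_derive_Reals, D, Hx.
  - exists c. split; auto. rewrite !Atilde_eq by (unfold Dd; lra). exact Hc'.
Qed.

Lemma ratio_sign c : beta <= Dd c -> 0 <= 1 - beta ^ 2 / Dd c ^ 2.
Proof.
  intros H. assert (beta ^ 2 / Dd c ^ 2 <= 1); [|lra]. apply Rle_div_l; nra.
Qed.

Lemma ratio_sign' c : 0 < Dd c <= beta -> 1 - beta ^ 2 / Dd c ^ 2 <= 0.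
Proof.
  intros H. assert (HD : 0 < Dd c ^ 2) by nra.
  assert (1 <= beta ^ 2 / Dd c ^ 2); [|lra]. apply (proj1 (Rle_div_r _ _ _ HD)). nra.
Qed.

Lemma Atilde_ge_high_temp q : beta <= 1 - lambda -> D_set beta lambda q ->
  Atilde beta lambda 0 <= Atilde beta lambda q.
Proof.
  intros Hle Hq. assert (H0 : D_set beta lambda 0) by (split; lra).
  destruct (Atilde_mvt 0 q H0 Hq) as (c & Hc & E). destruct Hq as [Hq _].
  rewrite Rmin_left, Rmax_right in Hc by lra.
  pose proof (ratio_sign c ltac:(unfold Dd; nra)) as R.
  assert (0 <= 1 / 2 * beta ^ 2 * c) by (assert (0 < beta ^ 2) by nra; nra).
  assert (0 <= 1 / 2 * beta ^ 2 * c * (1 - beta ^ 2 / Dd c ^ 2)) by (apply Rmult_le_pos; auto). nra.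
Qed.

Lemma Dd_qstar : Dd (qstar beta lambda) = beta.
Proof. unfold Dd, qstar. field. lra. Qed.

Lemma D_set_qstar : beta > 1 - lambda -> D_set beta lambda (qstar beta lambda).
Proof.
  intros H. split.
  - unfold qstar. apply Rdiv_le_0_compat; nra.
  - fold (Dd (qstar beta lambda)). rewrite Dd_qstar. exact Hbeta.
Qed.

(** Since [Dd] takes the value [beta] at [qstar], the derivative is nonpositive to the left of
    [qstar] and nonnegative to the right. *)
Lemma Atilde_ge_low_temp q : beta > 1 - lambda -> D_set beta lambda q ->
  Atilde beta lambda (qstar beta lambda) <= Atilde beta lambda q.
Proof.
  intros Hlt Hq. pose proof (D_set_qstar Hlt) as H0.
  destruct (Atilde_mvt _ q H0 Hq) as (c & Hc & E).
  pose proof Dd_qstar as Es. destruct Hq as [Hq HDq]. destruct H0 as [H0 _].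
  set (q0 := qstar beta lambda) in *. fold (Dd q) in HDq.
  assert (Hb2 : 0 < beta ^ 2) by nra.
  destruct (Rle_dec q0 q) as [Hle|Hle].
  - rewrite Rmin_left, Rmax_right in Hc by lra.
    pose proof (ratio_sign c ltac:(rewrite <- Es; unfold Dd; nra)) as R.
    assert (0 <= 1 / 2 * beta ^ 2 * c) by nra.
    assert (0 <= 1 / 2 * beta ^ 2 * c * (1 - beta ^ 2 / Dd c ^ 2)) by (apply Rmult_le_pos; auto). nra.
  - rewrite Rmin_right, Rmax_left in Hc by lra.
    assert (Dd q <= Dd c) by (unfold Dd; nra). assert (Dd c <= Dd q0) by (unfold Dd; nra).
    pose proof (ratio_sign' c ltac:(lra)) as R.
    assert (0 <= 1 / 2 * beta ^ 2 * c) by nra.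
    assert (1 / 2 * beta ^ 2 * c * (1 - beta ^ 2 / Dd c ^ 2) <= 0) by nra. nra.
Qed.

End ReplicaSymmetricInfimum.

Lemma ln_inv_sqrt x : 0 < x -> ln (/ sqrt x) = - 1 / 2 * ln x.
Proof.
  intros H. assert (Hs : 0 < sqrt x) by now apply sqrt_lt_R0.
  rewrite ln_Rinv by auto.
  rewrite <- (sqrt_sqrt x) at 2 by lra. rewrite ln_mult by auto. field.
Qed.

Lemma is_inf_attained (E : R -> Prop) m : E m -> (forall x, E x -> m <= x) -> is_inf E m.
Proof. intros H K. split; auto. Qed.

Theorem mainTheorem10 (beta lambda : R) (hbeta : 0 < beta) :
  (lambda < 1 -> beta <= 1 - lambda ->
     is_inf (fun a => exists q, D_set beta lambda q /\ a = Atilde beta lambda q)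
            (- 1 / 2 * ln (1 - lambda))
     /\ D_set beta lambda 0
     /\ Atilde beta lambda 0 = - 1 / 2 * ln (1 - lambda)
     /\ (forall N : nat, (1 <= N)%nat ->
           A_N N beta lambda <= - 1 / 2 * ln (1 - lambda)))
  /\
  (beta > 1 - lambda ->
     let q := qstar beta lambda in
     let v := - 1 / 2 * ln beta + beta * q / 2 + beta ^ 2 * q ^ 2 / 4 in
     is_inf (fun a => exists q', D_set beta lambda q' /\ a = Atilde beta lambda q') v
     /\ D_set beta lambda q
     /\ Atilde beta lambda q = v
     /\ (forall N : nat, (1 <= N)%nat -> A_N N beta lambda <= v)).
Proof.
  split.
  - intros Hl Hle.
    assert (HD : D_set beta lambda 0) by (split; lra).
    assert (HA : Atilde beta lambda 0 = - 1 / 2 * ln (1 - lambda)).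
    { rewrite Atilde_eq by lra. replace (1 - lambda + beta ^ 2 * 0) with (1 - lambda) by ring. field. lra. }
    split; [|split; [exact HD|split; [exact HA|]]].
    + apply is_inf_attained; [exists 0; auto|]. intros x (q & Hq & ->). rewrite <- HA.
      now apply Atilde_ge_high_temp.
    + intros N HN.
      (* The scale is [sigma] at [q = 0]; the rescaled [lambda] is then 0 and the bound reduces to
         [ln s]. *)
      assert (Hs : 0 < / sqrt (1 - lambda)) by (apply Rinv_0_lt_compat, sqrt_lt_R0; lra).
      assert (Hs2 : (/ sqrt (1 - lambda)) ^ 2 = / (1 - lambda)) by (rewrite pow_inv, pow2_sqrt; lra).
      assert (E0 : 1 - / (1 - lambda) * (1 - lambda) = 0) by (field; lra).
      pose proof (A_N_le N beta lambda (/ sqrt (1 - lambda)) HN hbeta Hs) as B.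
      rewrite Hs2, E0, ln_inv_sqrt in B by lra.
      specialize (B ltac:(lra)). unfold Rdiv in *. rewrite pow_i, !Rmult_0_l in B by lia. lra.
  - intros Hlt q v.
    assert (HD : D_set beta lambda q) by now apply D_set_qstar.
    assert (HA : Atilde beta lambda q = v).
    { rewrite Atilde_eq by (destruct HD; lra). unfold q. rewrite Dd_qstar by auto. unfold v, q. field. lra. }
    split; [|split; [exact HD|split; [exact HA|]]].
    + apply is_inf_attained; [exists q; auto|]. intros x (q' & Hq & ->). rewrite <- HA.
      now apply Atilde_ge_low_temp.
    + intros N HN.
      (* The scale is [sigma] at [qstar]; the rescaled [beta] is then 1 and the rescaled [lambda] is
         [beta * q], which is nonnegative. *)
      assert (Hs : 0 < / sqrt beta) by (apply Rinv_0_lt_compat, sqrt_lt_R0; lra).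
      assert (Hs2 : (/ sqrt beta) ^ 2 = / beta) by (rewrite pow_inv, pow2_sqrt; lra).
      assert (E0 : 1 - / beta * (1 - lambda) = beta * q) by (unfold q, qstar; field; lra).
      pose proof (A_N_le N beta lambda (/ sqrt beta) HN hbeta Hs) as B.
      rewrite Hs2, E0, ln_inv_sqrt in B by lra.
      destruct HD as [Hq _]. specialize (B ltac:(nra)).
      replace ((beta * q) ^ 2 / (4 * (beta * / beta) ^ 2)) with (beta ^ 2 * q ^ 2 / 4) in B by (field; lra).
      exact B.
Qed.
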